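(* Let $G$ be a pro-$p$ group, $W$ a valuation on $G$ and $H$ a closed subgroup of $G$ for which $[G:H]_W<\infty$. Then $$rk_W(H)-1\le [G:H]_W\cdot (rk_W(G)-1).$$ Moreover, if $G$ is free and $W$ is a weight function, then $$rk_W(H)-1= [G:H]_W\cdot (rk_W(G)-1).$$
   Context: Conventions: $p$ is a prime; ''countable'' means finite or countably infinite; pro-$p$ groups are countably based; generation is topological; infinite generating sets are countable and converge to $1$. The $W$-rank may be $+\infty$. Valuations. A valuation on a pro-$p$ group $G$ is a continuous function $W:G\to[0,1)$ such that $W(g)=0$ iff $g=1$; $W(fg)\le\max\{W(f),W(g)\}$; $W([f,g])\le W(f)W(g)$, where $[f,g]=f^{-1}g^{-1}fg$; and $W(g^p)\le W(g)^p$ for all $f,g\in G$. The restriction of $W$ to a closed subgroup is a valuation, again denoted $W$; for a closed normal subgroup $N$, $W$ induces the valuation $W(xN)=\min\{W(y):y\in xN\}$ on $G/N$, again denoted $W$. $W$-rank and $W$-index. For a pro-$p$ group $H$ with valuation $W$ and $\alpha\in(0,1)$, let $H_\alpha=\{h\in H:W(h)\le\alpha\}$, $H_{<\alpha}=\{h\in H:W(h)<\alpha\}$ and $c_\alpha(H)=\log_p[H_\alpha:H_{<\alpha}]$. Let $\Phi(H)$ be the closure of $[H,H]H^p$ and $\overline H=H/\Phi(H)$ with the induced valuation. The $W$-rank of $H$ is $$rk_W(H)=\sum_{\alpha\in \mathrm{Im}\,W,\ \alpha>0} c_\alpha(\overline H)\,\alpha .$$ For a closed subgroup $H$ of $G$,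 the $W$-index is $$[G:H]_W=\prod_{\alpha\in\mathrm{Im}\,W,\ \alpha>0}\left(\frac{1-\alpha^p}{1-\alpha}\right)^{c_\alpha(G)-c_\alpha(H)}\in[1,\infty].$$ Weight functions. For a countable set $X$, the free pro-$p$ group on $X$ is, for $X$ finite, the pro-$p$ completion of the free abstract group on $X$; for $X$ infinite it is the completion of the free abstract group on $X$ in the topology whose base of neighborhoods of $1$ consists of the normal subgroups of $p$-power index containing all but finitely many elements of $X$. If $F$ is a free pro-$p$ group with free generating set $X$, $\mathbb F_p[[F]]$ is identified with the algebra $A=\mathbb F_p\langle\langle Q\rangle\rangle$ of noncommutative power series in $Q=\{x-1:x\in X\}$ (for infinite $Q=\{q_1,q_2,\ldots\}$ the inverse limit of the $\mathbb F_p\langle\langle q_1,\dots,q_n\rangle\rangle$). A weight function on $A$ with respect to $Q$ is a continuous function $w:A\to[0,1]$ with $w(f)=0$ iff $f=0$, $w(1)=1$, $w(f+g)\le\max\{w(f),w(g)\}$, $w(fg)=w(f)w(g)$, and $w(\sum_\alpha\lambda_\alpha m_\alpha)=\max\{w(m_\alpha):\lambda_\alpha\ne0\}$ whenever $\lambda_\alpha\in\mathbb F_p$ and the $m_\alpha$ are distinct monic monomials in $Q$. A valuation $W$ on $F$ is a weight function with respect to $X$ if there is such a $w$ with $W(f)=w(f-1)$ for all $f\in F$; $W$ is a weight function if it is a weight function with respect to some free generating set $X$. *)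

(* Defs.v *)
From HB Require Import structures.
From mathcomp Require Import all_boot all_order all_algebra.
From mathcomp Require Import finmap all_classical all_reals all_analysis.

Set Implicit Arguments.
Unset Strict Implicit.
Unset Printing Implicit Defensive.

Import Order.TTheory GRing.Theory Num.Theory.
Import numFieldNormedType.Exports.

Local Open Scope classical_set_scope.
Local Open Scope ring_scope.

Section Subgroups.
Variable G : groupType.
Implicit Types A H N : set G.
Local Open Scope group_scope.

Definition is_subgroup H : Prop :=
  [/\ H 1, forall x y, H x -> H y -> H (x * y) & forall x, H x -> H x^-1].

Definition is_normal N : Prop :=
  is_subgroup N /\ forall x n, N n -> N (n ^ x).

Definition subgroup_gen A : set G := smallest is_subgroup A.

Definition set_mul A B : set G := [set a * b | a in A & b in B].

Definition lcoset x N : set G := [set x * n | n in N].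

(* The elements of the quotient H / N are left cosets, multiplied by
   set_mul. *)
Definition quotient_set H N : set (set G) := [set lcoset x N | x in H].

Definition derived_subgroup H : set G :=
  subgroup_gen [set commg x y | x in H & y in H].

Definition power_subgroup (n : nat) H : set G :=
  subgroup_gen [set x ^+ n | x in H].

End Subgroups.

(* Cosets and indices are relative to an explicit product, so that they apply
   both to a group (product mul) and to a quotient of it (product set_mul). *)
Definition cosets_of (T : Type) (op : T -> T -> T) (A B : set T) :
    set (set T) :=
  [set [set op a b | b in B] | a in A].

(* The value 0 stands for an infinite index. *)
Definition group_index (T : Type) (op : T -> T -> T) (A B : set T) : nat :=
  #|` fset_set (cosets_of op A B)|%fset.

Definition p_power_index (p : nat) (G : groupType) (N : set G) : Prop :=
  exists k : nat, (cosets_of *%g [set: G] N #= `I_(p ^ k))%card.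

HB.mixin Record isTopologicalGroup G & Topological G & Group G := {
  mulg_continuous : continuous (fun xy : G * G => (xy.1 * xy.2)%g) ;
  invg_continuous : continuous (fun x : G => x^-1%g)
}.

#[short(type="topologicalGroupType")]
HB.structure Definition TopologicalGroup :=
  {G of isTopologicalGroup G & Topological G & Group G}.

(* Countably based, as a standing convention. *)
Definition pro_p (p : nat) (G : topologicalGroupType) : Prop :=
  [/\ compact [set: G],
      hausdorff_space G,
      @second_countable G &
      forall U : set G, nbhs 1%g U ->
        exists N : set G,
          [/\ is_normal N, open N, p_power_index p N & N `<=` U]].

Section Valuations.
Variables (R : realType) (p : nat) (G : topologicalGroupType).
Implicit Types (W : G -> R) (H N : set G).

Definition valuation W : Prop :=
  [/\ continuous W,
      forall g, 0 <= W g < 1,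
      forall g, W g = 0 <-> g = 1%g,
      forall f g, W (f * g)%g <= Num.max (W f) (W g) &
      (forall f g, W (commg f g) <= W f * W g) /\
      (forall g, W (g ^+ p)%g <= W g ^+ p)].

(* The infimum is a minimum when N is closed, C being then compact. *)
Definition quotient_valuation W (C : set G) : R := inf [set W y | y in C].

Definition frattini H : set G :=
  closure (set_mul (derived_subgroup H) (power_subgroup p H)).

(* [S_alpha : S_{<alpha}] is a power of p, of which logn p is the logarithm in
   base p. *)
Definition c_coef (T : Type) (op : T -> T -> T) (V : T -> R) (S : set T)
    (alpha : R) : nat :=
  logn p (group_index op [set x | S x /\ V x <= alpha]
                         [set x | S x /\ V x < alpha]).

Definition c_sub W H (alpha : R) : nat := c_coef *%g W H alpha.

Definition c_quotient W H N (alpha : R) : nat :=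
  c_coef (@set_mul G) (quotient_valuation W) (quotient_set H N) alpha.

Definition W_rank W H : \bar R :=
  \esum_(alpha in [set alpha | (W @` H) alpha /\ 0 < alpha])
    ((c_quotient W H (frattini H) alpha)%:R * alpha)%:E.

(* All the factors are at least 1, so the product is the supremum of its finite
   subproducts. The truncated subtraction is the actual one: H_alpha/H_{<alpha}
   embeds in G_alpha/G_{<alpha}. *)
Definition W_index W H : \bar R :=
  ereal_sup
    [set (\big[*%R/1]_(alpha \in F)
            ((1 - alpha ^+ p) / (1 - alpha)) ^+
              (c_sub W [set: G] alpha - c_sub W H alpha)%N)%:E
    | F in fsets [set alpha | range W alpha /\ 0 < alpha]].

End Valuations.

(* The abstract free group on T: reduced words in the letters (x, true),
   standing for x, and (x, false), standing for x^-1. *)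
Section FreeGroup.
Variable T : choiceType.
Implicit Types (a b : T * bool) (s w : seq (T * bool)).

Definition inv_letter a : T * bool := (a.1, ~~ a.2).

Definition reduced s : bool := sorted (fun a b => b != inv_letter a) s.

Definition push_letter a s :=
  if s is b :: s' then if b == inv_letter a then s' else a :: s else [:: a].

Definition reduce s := foldr push_letter [::] s.

Definition inv_word s := rev (map inv_letter s).

Lemma inv_letterK : involutive inv_letter.
Proof. by case=> x b; rewrite /inv_letter /= negbK. Qed.

Lemma reduced_push a s : reduced s -> reduced (push_letter a s).
Proof.
case: s => [//|b s] /=; case: ifP => [_|/negbT nab] /= pbs; last first.
  by rewrite /reduced /= nab.
by apply: path_sorted pbs.
Qed.

Lemma reduced_reduce s : reduced (reduce s).
Proof. by elim: s => //= a s; apply: reduced_push. Qed.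

Lemma reduce_id s : reduced s -> reduce s = s.
Proof.
elim: s => //= a s IHs pas.
rewrite [X in push_letter _ X](_ : _ = s); last first.
  by apply: IHs; exact: path_sorted pas.
by case: s pas {IHs} => //= b s /andP[/negbTE-> _].
Qed.

Lemma push_letterK a s :
  reduced s -> push_letter (inv_letter a) (push_letter a s) = s.
Proof.
case: s => [|b s] /=; first by rewrite inv_letterK eqxx.
case: (b =P inv_letter a) => [->|_] /=; last by rewrite inv_letterK eqxx.
by case: s => [|c s] //= /andP[/negbTE-> _].
Qed.

Lemma foldr_push_push a s w : reduced s -> reduced w ->
  foldr push_letter w (push_letter a s) =
  push_letter a (foldr push_letter w s).
Proof.
move=> rs rw; case: s rs => [//|b s] rs /=; case: eqP => [->|_] //=.
rewrite -[a in push_letter a]inv_letterK push_letterK//.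
by elim: s {rs} => //= c s; apply: reduced_push.
Qed.

Lemma foldr_push_reduce s w : reduced w ->
  foldr push_letter w (reduce s) = foldr push_letter w s.
Proof.
move=> rw; elim: s => //= a s IHs.
by rewrite foldr_push_push ?reduced_reduce// IHs.
Qed.

Lemma reduce_cat s w : reduce (s ++ w) = foldr push_letter (reduce w) s.
Proof. by rewrite /reduce foldr_cat. Qed.

Lemma reduce_catl s w : reduce (reduce s ++ w) = reduce (s ++ w).
Proof. by rewrite !reduce_cat foldr_push_reduce// reduced_reduce. Qed.

Lemma reduce_catr s w : reduce (s ++ reduce w) = reduce (s ++ w).
Proof. by rewrite !reduce_cat reduce_id// reduced_reduce. Qed.

Lemma reduce_inv_cat s : reduce (inv_word s ++ s) = [::].
Proof.
suff H w : reduced w ->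
    foldr push_letter (foldr push_letter w s) (inv_word s) = w.
  by rewrite /reduce foldr_cat H.
elim: s w => //= a s IHs w rw.
rewrite /inv_word /= rev_cons -cats1 foldr_cat /= push_letterK; last first.
  by elim: s {IHs} => //= c s; apply: reduced_push.
exact: IHs.
Qed.

Lemma inv_wordK : involutive inv_word.
Proof. by move=> s; rewrite /inv_word map_rev revK mapK//; exact: inv_letterK. Qed.

Definition free_group := {s : seq (T * bool) | reduced s}.

HB.instance Definition _ := SubType.on free_group.
HB.instance Definition _ := Choice.on free_group.

Definition fg_of_word s : free_group := exist reduced _ (reduced_reduce s).
Definition fg_one : free_group := fg_of_word [::].
Definition fg_inv (u : free_group) : free_group := fg_of_word (inv_word (val u)).
Definition fg_mul (u v : free_group) : free_group :=
  fg_of_word (val u ++ val v).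

Lemma fg_mulA : associative fg_mul.
Proof.
by move=> u v w; apply/val_inj => /=; rewrite reduce_catl reduce_catr catA.
Qed.

Lemma fg_mul1g : left_id fg_one fg_mul.
Proof. by move=> u; apply/val_inj => /=; rewrite reduce_id//; exact: valP. Qed.

Lemma fg_mulg1 : right_id fg_one fg_mul.
Proof.
by move=> u; apply/val_inj => /=; rewrite cats0 reduce_id//; exact: valP.
Qed.

Lemma fg_mulVg : left_inverse fg_one fg_inv fg_mul.
Proof.
by move=> u; apply/val_inj => /=; rewrite reduce_catl reduce_inv_cat.
Qed.

Lemma fg_mulgV : right_inverse fg_one fg_inv fg_mul.
Proof.
move=> u; apply/val_inj => /=; rewrite reduce_catr.
by rewrite -{1}(inv_wordK (val u)) reduce_inv_cat.
Qed.

HB.instance Definition _ := isGroup.Build free_group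
  fg_mulA fg_mul1g fg_mulg1 fg_mulVg fg_mulgV.

Definition fg_gen (x : T) : free_group := fg_of_word [:: (x, true)].

Definition fg_lift (K : groupType) (f : T -> K) (u : free_group) : K :=
  foldr (fun a y => ((if a.2 then f a.1 else (f a.1)^-1) * y)%g) 1%g (val u).

End FreeGroup.

Section FreeProP.
Variables (p : nat) (G : topologicalGroupType).

(* The base of neighbourhoods of 1 in the free group on T for the topology whose
   completion is the free pro-p group; the last condition is void for finite
   T. *)
Definition free_group_base (T : choiceType) (N : set (free_group T)) : Prop :=
  [/\ is_normal N, p_power_index p N & finite_set [set x | ~ N (fg_gen x)]].

(* A compact (hence complete) Hausdorff group G is the completion of a
   topological group Gamma along a homomorphism iota : Gamma -> G if and only if
   iota has dense image and the topology of Gamma is induced by that of G. Here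
   Gamma is the free group on X and iota extends the inclusion of X in G. *)
Definition free_generating_set (X : set G) : Prop :=
  let iota := @fg_lift X G (fun x => val x) in
  [/\ countable X,
      closure (range iota) = [set: G] &
      forall A : set (free_group X),
        (exists2 N, free_group_base N & N `<=` A) <->
        (exists2 U, nbhs (1%g : G) U & iota @^-1` U `<=` A)].

Definition free_pro_p : Prop := exists X : set G, free_generating_set X.

End FreeProP.

(* Noncommutative power series over F_p in the indeterminates q_x, x : T, as
   functions of the monomials (words in T). For infinite T this is the inverse
   limit of the power series in finitely many indeterminates, every monomial
   involving only finitely many of them; the topology is the product topology,
   F_p being discrete. *)
Definition ncseries (p : nat) (T : choiceType) : Type :=
  {ptws seq T -> discrete_topology 'F_p}.

Section NCSeries.
Variables (p : nat) (T : choiceType).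
Implicit Types (f g h : ncseries p T) (m : seq T).

HB.instance Definition _ := Topological.on (ncseries p T).

Definition ncs_coef f m : 'F_p := f m.
Definition ncs_zero : ncseries p T := fun=> 0 : 'F_p.
Definition ncs_mono m : ncseries p T := fun m' => (m' == m)%:R : 'F_p.
Definition ncs_one : ncseries p T := ncs_mono [::].
Definition ncs_opp f : ncseries p T := fun m => - ncs_coef f m.
Definition ncs_add f g : ncseries p T := fun m => ncs_coef f m + ncs_coef g m.

(* The sum ranges over the factorizations m = u v. *)
Definition ncs_mul f g : ncseries p T := fun m =>
  \sum_(i < (size m).+1) ncs_coef f (take i m) * ncs_coef g (drop i m).

Lemma ncs_addA : associative ncs_add.
Proof. by move=> f g h; apply/funext => m; exact: addrA. Qed.

Lemma ncs_addC : commutative ncs_add.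
Proof. by move=> f g; apply/funext => m; exact: addrC. Qed.

Lemma ncs_add0 : left_id ncs_zero ncs_add.
Proof. by move=> f; apply/funext => m; exact: add0r. Qed.

Lemma ncs_addN : left_inverse ncs_zero ncs_opp ncs_add.
Proof. by move=> f; apply/funext => m; exact: addNr. Qed.

Lemma ncs_mul1 : left_id ncs_one ncs_mul.
Proof.
move=> f; apply/funext => m; rewrite /ncs_mul big_ord_recl take0 drop0.
rewrite /ncs_coef {1}/ncs_one/ncs_mono eqxx mul1r big1 ?addr0// => i _.
case: m i => [[]//|a m] i; rewrite /ncs_one/ncs_mono/=.
by rewrite mul0r.
Qed.

Lemma ncs_mul1r : right_id ncs_one ncs_mul.
Proof.
move=> f; apply/funext => m; rewrite /ncs_mul big_ord_recr /= take_size.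
rewrite drop_size /ncs_coef {2}/ncs_one/ncs_mono eqxx mulr1 big1 ?add0r//.
move=> i _; rewrite /ncs_one/ncs_mono -size_eq0 size_drop subn_eq0.
by rewrite leqNgt ltn_ord mulr0.
Qed.

Lemma ncs_mulDl : left_distributive ncs_mul ncs_add.
Proof.
move=> f g h; apply/funext => m; rewrite /ncs_mul/ncs_add/ncs_coef -big_split.
by apply: eq_bigr => i _; rewrite mulrDl.
Qed.

Lemma ncs_mulDr : right_distributive ncs_mul ncs_add.
Proof.
move=> f g h; apply/funext => m; rewrite /ncs_mul/ncs_add/ncs_coef -big_split.
by apply: eq_bigr => i _; rewrite mulrDr.
Qed.

Lemma ncs_mulA : associative ncs_mul.
Proof.
move=> f g h; apply/funext => m; rewrite /ncs_mul/ncs_coef.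
pose F i j := f (take i m) * (g (drop i (take j m)) * h (drop j m)) : 'F_p.
transitivity (\sum_(i < (size m).+1) \sum_(j < (size m).+1 | (i <= j)%N) F i j).
  apply: eq_bigr => i _; rewrite big_distrr /=.
  have lei : (i <= size m)%N by rewrite -ltnS.
  rewrite -(big_mkord predT (fun j => f (take i m) *
    (g (take j (drop i m)) * h (drop j (drop i m))) : 'F_p)).
  rewrite -(big_mkord (fun j => (i <= j)%N) (F i)).
  transitivity (\sum_((0 + i)%N <= j < (size m).+1) F i j); last first.
    by rewrite add0n (big_nat_widenl i 0).
  rewrite big_addn size_drop subSn//.
  apply: eq_bigr => j _; rewrite /F take_drop drop_drop.
  by rewrite addnC.
rewrite (exchange_big_dep predT)//=; apply: eq_bigr => j _.
rewrite big_distrl /=.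
have lej : (j <= size m)%N by rewrite -ltnS.
rewrite -(big_mkord (fun i => (i <= j)%N) (fun i => F i j)).
rewrite -(big_mkord predT (fun i => f (take i (take j m)) *
    g (drop i (take j m)) * h (drop j m) : 'F_p)).
rewrite size_takel// [RHS](big_nat_widen _ _ (size m).+1)//=.
rewrite [LHS]big_nat_cond [RHS]big_nat_cond; apply: eq_big => i.
  by rewrite ltnS.
by move=> /andP[_ leij]; rewrite /F mulrA take_takel.
Qed.

HB.instance Definition _ := GRing.isZmodule.Build (ncseries p T)
  ncs_addA ncs_addC ncs_add0 ncs_addN.
HB.instance Definition _ := GRing.Zmodule_isPzRing.Build (ncseries p T)
  ncs_mulA ncs_mul1 ncs_mul1r ncs_mulDl ncs_mulDr.

End NCSeries.

Section WeightFunctions.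
Variables (R : realType) (p : nat).

(* The last field says that w f is the maximum of the weights of the monomials
   that occur in f; the case f = 0 is covered by the second field. *)
Definition series_weight (T : choiceType) (w : ncseries p T -> R) : Prop :=
  [/\ continuous w /\ (forall f, 0 <= w f <= 1),
      forall f, w f = 0 <-> f = 0,
      w 1 = 1,
      (forall f g, w (f + g) <= Num.max (w f) (w g)) /\
      (forall f g, w (f * g) = w f * w g) &
      forall f, f != 0 ->
        (exists2 m, ncs_coef f m != 0 & w f = w (ncs_mono p m)) /\
        (forall m, ncs_coef f m != 0 -> w (ncs_mono p m) <= w f)].

Variable G : topologicalGroupType.

(* The identification of F_p[[G]] with the power series ring, restricted to G:
   the continuous multiplicative map such that x |-> 1 + q_x for x in X. It is
   unique, since X generates G topologically. *)
Definition magnus_embedding (X : set G) (mu : G -> ncseries p X) : Prop :=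
  [/\ continuous mu, mu 1%g = 1,
      forall g h, mu (g * h)%g = mu g * mu h &
      forall x : X, mu (val x) = 1 + ncs_mono p [:: x]].

Definition weight_function_wrt (X : set G) (W : G -> R) : Prop :=
  exists (mu : G -> ncseries p X) (w : ncseries p X -> R),
    [/\ magnus_embedding mu, series_weight w &
        forall g, W g = w (mu g - 1)].

Definition weight_function (W : G -> R) : Prop :=
  exists X : set G, free_generating_set p X /\ weight_function_wrt X W.

End WeightFunctions.

(* Main.v *)
(* Everything is read off the finite quotients G / G_{<eps}: for alpha >= eps the
   numbers c_alpha of H and of H / Phi(H) are those of the image of H, so the rank
   and the index are limits of their analogues for finite p-groups.

   In a finite p-group, H is reached from G by steps of index p.  Let V be maximal
   in U, t in U \ V of minimal weight a, and t, x_j generators of U of minimal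
   total weight, with the x_j moved into V by powers of t.  Then V is generated by
   t^p and the commutators [x_j, t, ..., t] with k < p entries t, of weight at most
   a^p and a^k W(x_j).  With N = 1 + a + ... + a^(p-1) = (1 - a^p) / (1 - a) this is
   rk V - 1 <= N (rk U - 1), and the product of the factors N is the W-index.

   If G is free and W is a weight function, the generators x_j of U can be chosen
   such that the x_j - 1 are free right generators of the augmentation ideal on
   which w is the maximum norm.  This property passes from the x_j to the above
   generators of V, and it makes them generators of minimal total weight, of weight
   exactly a^p and a^k W(x_j).  Along the chain, the steps with a >= theta multiply
   rk - 1 by N up to generators of small weight, and the steps with a < theta lose
   at most the sum of their a, which tends to 0 with theta since the W-index is
   finite. *)
Require Import Defs.
From HB Require Import structures.
From mathcomp Require Import all_boot all_order all_algebra.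
From mathcomp Require Import all_fingroup all_solvable.
From mathcomp Require Import finmap all_classical all_reals all_analysis.
From mathcomp Require Import lra.

Set Implicit Arguments.
Unset Strict Implicit.
Unset Printing Implicit Defensive.

Import Order.TTheory GRing.Theory Num.Theory.
Import numFieldNormedType.Exports.

Local Open Scope ring_scope.

(** * Valuations on groups and Schreier generators *)

(** The equality cannot be proved inside the finite quotients: they are not free, and generators of
    weight below eps are trivial there. So the generating families are kept in G, and a homomorphism
    to a finite p-group only tells which subgroup they generate. X may be infinite, but finitely
    many free generators, of weight at least eps, already generate the quotient. Freeness is tested
    against coefficients in the abstract group ring of the family, so that all sums are finite. It
    yields exponent sums modulo p, and those of the generators above a threshold depend only on the
    image of an element; this makes the image of a free family a generating family of minimal total
    weight. The constant eps must be fixed before the chain from G to H is known, although every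
    step with a >= theta may shrink weights by theta^(p-1). The finite W-index resolves this: every
    such step contributes a factor N >= 1 + theta, which bounds the number of these steps for all
    eps at once. *)

Section MultiplicativeMap.
Variables (G K : groupType) (phi : G -> K).
Hypothesis phiM : forall g h, phi (g * h)%g = (phi g * phi h)%g.

Lemma mulmap1 : phi 1%g = 1%g.
Proof. by apply: (mulgI (phi 1%g)); rewrite -phiM !mulg1. Qed.

Lemma mulmapV g : phi g^-1%g = (phi g)^-1%g.
Proof. by apply: (mulgI (phi g)); rewrite -phiM !mulgV mulmap1. Qed.

Lemma mulmapX g n : phi (g ^+ n)%g = (phi g ^+ n)%g.
Proof. by elim: n => [|n IHn]; rewrite ?expg0 ?mulmap1// !expgS phiM IHn. Qed.

Lemma mulmapR g h : phi [~ g, h]%g = [~ phi g, phi h]%g.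
Proof. by rewrite !commgEl !conjgE !phiM !mulmapV. Qed.

End MultiplicativeMap.

Section ValuatedGroup.
Variables (R : realType) (p : nat) (G : groupType).
Implicit Types (W : G -> R) (f g h : G).

(** Free of topology, so that it applies to G and to its finite quotients alike. *)
Definition group_valuation W : Prop :=
  [/\ forall g, 0 <= W g < 1,
      forall g, W g = 0 <-> g = 1%g,
      forall f g, W (f * g)%g <= Num.max (W f) (W g),
      forall f g, W [~ f, g]%g <= W f * W g &
      forall g, W (g ^+ p)%g <= W g ^+ p].

Variable W : G -> R.
Hypotheses (p_pr : prime p) (hW : group_valuation W).

Lemma gval_ge0 g : 0 <= W g.
Proof. by case: hW => /(_ g)/andP[]. Qed.

Lemma gval_lt1 g : W g < 1.
Proof. by case: hW => /(_ g)/andP[]. Qed.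

Lemma gval1 : W 1%g = 0.
Proof. by case: hW => _ /(_ 1%g)[_ ->]. Qed.

Lemma gval_eq0 g : W g = 0 -> g = 1%g.
Proof. by case: hW => _ /(_ g)[]. Qed.

Lemma gvalM_le s f g : W f <= s -> W g <= s -> W (f * g)%g <= s.
Proof.
move=> hf hg; case: hW => _ _ /(_ f g)/le_trans + _ _; apply.
by rewrite ge_max hf.
Qed.

Lemma gvalM_lt s f g : W f < s -> W g < s -> W (f * g)%g < s.
Proof.
move=> hf hg; case: hW => _ _ /(_ f g)/le_lt_trans + _ _; apply.
by rewrite gt_max hf.
Qed.

Lemma gvalX_le g n : W (g ^+ n)%g <= W g.
Proof.
elim: n => [|n IHn]; first by rewrite expg0 gval1 gval_ge0.
by rewrite expgS gvalM_le.
Qed.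

(* [g^-1 = g^(p-1) * (g^-1)^p] and [W ((g^-1)^p) < W g^-1] unless [g = 1]. *)
Lemma gvalV_le g : W g^-1%g <= W g.
Proof.
have [/gval_eq0 g1|Wg0] := eqVneq (W g^-1%g) 0.
  by rewrite g1 gval1 gval_ge0.
have p0 := prime_gt0 p_pr.
have lt_p : W (g^-1 ^+ p)%g < W g^-1%g.
  case: hW => _ _ _ _ /(_ g^-1%g)/le_lt_trans; apply.
  rewrite ltr_iXnr ?prime_gt1// ?gval_lt1// lt_neqAle eq_sym.
  by rewrite Wg0 gval_ge0.
have gE : (g^-1 = g ^+ p.-1 * g^-1 ^+ p)%g.
  by rewrite -{2}(prednK p0) expgSr mulgA expgVn mulgV mul1g.
rewrite leNgt; apply/negP => lt_g.
suff : W g^-1%g < W g^-1%g by rewrite ltxx.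
rewrite {1}gE gvalM_lt//; exact: le_lt_trans (gvalX_le _ _) lt_g.
Qed.

Lemma gvalV g : W g^-1%g = W g.
Proof.
by apply/eqP; rewrite eq_le gvalV_le/= -{1}(invgK g) gvalV_le.
Qed.

Lemma gvalJ g h : W (g ^ h)%g = W g.
Proof.
suff le_J f k : W (f ^ k)%g <= W f.
  by apply/eqP; rewrite eq_le le_J/= -{1}(conjgK h g) le_J.
rewrite -(mulKVg f (f ^ k)%g) gvalM_le// -commgEl.
case: hW => _ _ _ /(_ f k)/le_trans + _; apply.
by rewrite ler_piMr ?gval_ge0// ltW// gval_lt1.
Qed.

Lemma gvalM_id g h : W h < W g -> W (g * h)%g = W g.
Proof.
move=> lt_hg; apply/eqP; rewrite eq_le gvalM_le ?(ltW lt_hg)//=.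
rewrite leNgt; apply/negP => lt_gh; suff : W g < W g by rewrite ltxx.
by rewrite -{1}(mulgK h g) gvalM_lt// gvalV.
Qed.

End ValuatedGroup.

Section SchreierGenerators.
Variables (G : groupType) (p : nat) (J : finType) (x : J -> G) (t : J).

(** [None] stands for the p-th power, [Some (j, k)] for the commutator with k entries [x t]. For n
    generators there are 1 + p (n - 1) indices, the rank of a subgroup of index p in a free group of
    rank n. *)
Definition schreier_index := option ({j | j != t} * 'I_p).

Definition schreier_family (i : schreier_index) : G :=
  if i is Some (j, k) then iter k (fun g => [~ g, x t]%g) (x (val j))
  else (x t ^+ p)%g.

Definition normalized_family (a : J -> nat) (j : J) : G :=
  if j == t then x t else (x j * x t ^+ a j)%g.

End SchreierGenerators.

Section SchreierWeights.
Variables (R : realType) (p : nat) (J : finType) (t : J) (w : J -> R).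

(** Upper bounds for the weights of [schreier_family], attained by free families. *)
Definition schreier_weight (i : schreier_index p t) : R :=
  if i is Some (j, k) then w t ^+ k * w (val j) else w t ^+ p.

(** The filter [c] is trivial in the inequality and a threshold in the free case. *)
Lemma sum_schreier_weight (c : R -> bool) :
  \sum_(i | c (schreier_weight i)) schreier_weight i =
  (if c (w t ^+ p) then w t ^+ p else 0) +
  \sum_(j | j != t) \sum_(k < p | c (w t ^+ k * w j)) w t ^+ k * w j.
Proof.
rewrite big_mkcond/= (bigD1 None)//=; congr (_ + _).
pose F i := if c (schreier_weight i) then schreier_weight i else 0.
have -> : \sum_(i | i != None) F i = \sum_(i : {j | j != t} * 'I_p) F (Some i).
  rewrite (reindex_omap (fun i : {j | j != t} * 'I_p => Some i) id)/=.
    by apply: eq_bigl => i; rewrite eqxx.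
  by case.
rewrite (eq_bigr (fun i => F (Some (i.1, i.2)))) => [|[]//].
rewrite -(pair_bigA _ (fun j k => F (Some (j, k))))/=.
under [LHS]eq_bigr do rewrite -big_mkcond/=.
rewrite [RHS](reindex_omap (val : {j | j != t} -> J) insub)/=; last first.
  by move=> j tj; rewrite insubT.
by apply: eq_bigl => -[j tj] /=; rewrite insubT tj /= eqxx.
Qed.

End SchreierWeights.

Lemma schreier_le (R : realType) (p : nat) (G : groupType) (W : G -> R)
    (J : finType) (x : J -> G) (t : J) (i : schreier_index p t) :
  group_valuation p W ->
  W (schreier_family x i) <= schreier_weight (W \o x) i.
Proof.
move=> hW; have [_ _ _ wR wX] := hW; case: i => [[[j tj] k]|] /=; last exact: wX.
elim: (nat_of_ord k) => [|m IHm] /=; first by rewrite expr0 mul1r.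
apply: le_trans (wR _ _) _; rewrite exprS -mulrA mulrC.
by rewrite ler_wpM2l// (gval_ge0 hW).
Qed.

(** * Finite valued p-groups *)

Section FiniteValuedGroup.
Import boot.ssrbool boot.fintype boot.finset.
Variables (R : realType) (p : nat) (gT : finGroupType) (w : gT -> R).
Hypotheses (p_pr : prime p) (hw : group_valuation p w).
Hypothesis pG : (p.-group [set: gT])%g.
Implicit Types (U V K : {group gT}) (J : finType).
Local Open Scope group_scope.

Let w_ge0 := gval_ge0 hw.
Let w1 := gval1 hw.
Let wM := gvalM_le hw.
Let wJ := gvalJ hw.

Let pgr U : p.-group U.
Proof. by apply: pgroupS pG; apply: subsetT. Qed.

(* The disjunct [x == 1] only makes this a group also for [s < 0]. *)
Definition level (U : {set gT}) (s : R) : {set gT} :=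
  [set x in U | (x == 1) || (w x <= s)%R].

Lemma level_group_set U s : group_set (level U s).
Proof.
apply/group_setP; split => [|x y]; first by rewrite inE group1 eqxx.
rewrite !inE => /andP[Ux /orP[/eqP->|wx]] /andP[Uy hy].
  by rewrite mul1g Uy.
rewrite groupM//=; case/orP: hy => [/eqP->|wy]; first by rewrite mulg1 wx orbT.
by rewrite wM// orbT.
Qed.
Canonical level_group U s := Group (level_group_set U s).

Lemma in_level U s x : (0 <= s)%R ->
  (x \in level U s) = (x \in U) && (w x <= s)%R.
Proof.
by move=> s0; rewrite inE; case: eqP => // ->; rewrite group1 w1 s0.
Qed.

Lemma level_sub U s : level U s \subset U.
Proof. by apply/subsetP => x /[!inE]/andP[]. Qed.

Lemma level_norm U s : U \subset 'N(level U s).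
Proof.
apply/normsP => u Uu; apply/setP => x; rewrite mem_conjg !inE wJ groupJr ?groupV//.
by rewrite -{1}(conj1g u^-1) (inj_eq (conjg_inj _)).
Qed.

Lemma levelS U s r : (s <= r)%R -> level U s \subset level U r.
Proof.
move=> sr; apply/subsetP => x; rewrite !inE => /andP[-> /orP[->//|wx]] /=.
by rewrite (le_trans wx sr) orbT.
Qed.

(** For s >= 0, the preimage in [U] of the elements of weight at most s in U / Phi(U), with respect
    to the induced valuation. *)
Definition Phi_level U (s : R) : {set gT} := 'Phi(U) <*> level U s.
Canonical Phi_level_group U s := Eval hnf in [group of Phi_level U s].

Lemma Phi_level_sub U s : Phi_level U s \subset U.
Proof. by rewrite join_subG Phi_sub level_sub. Qed.

Lemma Phi_sub_level U s : 'Phi(U) \subset Phi_level U s.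
Proof. exact: joing_subl. Qed.

Lemma level_sub_Phi_level U s : level U s \subset Phi_level U s.
Proof. exact: joing_subr. Qed.

Lemma Phi_over_normal U K : 'Phi(U) \subset K -> K \subset U -> normal K U.
Proof.
move=> PK KU; apply: sub_der1_normal => //; apply: subset_trans PK.
by rewrite (Phi_joing (pgr U)) joing_subl.
Qed.

Lemma Phi_level_normal U s : normal (Phi_level U s) U.
Proof. by rewrite Phi_over_normal ?Phi_sub_level ?Phi_level_sub. Qed.

Lemma Phi_over_abelem U K : 'Phi(U) \subset K -> K \subset U -> p.-abelem (U / K).
Proof.
move=> PK KU; have /andP[_ nKU] := Phi_over_normal PK KU.
rewrite -trivg_Phi ?quotient_pgroup// -(quotient_Phi (pgr U) nKU).
by rewrite (quotientS1 PK).
Qed.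

(** The dimension over F_p of the quotient by [Phi_level], hence the least possible number of
    generators of weight above s. *)
Definition Phi_index U (s : R) : nat := logn p #|U : Phi_level U s|.

Lemma indexg_pexp U V : #|U : V| = (p ^ logn p #|U : V|)%N.
Proof.
rewrite -p_part part_pnat_id//.
exact: pnat_dvd (dvdn_indexg _ _) (pgr _).
Qed.

Lemma logn_indexM U V K : K \subset V -> V \subset U ->
  logn p #|U : K| = (logn p #|U : V| + logn p #|V : K|)%N.
Proof. by move=> KV VU; rewrite -lognM ?indexg_gt0// Lagrange_index. Qed.

Lemma logn_index_gt0 U V u : u \in U -> u \notin V -> (0 < logn p #|U : V|)%N.
Proof.
move=> Uu Vu; rewrite lt0n; apply/eqP => l0.
move: (indexg_pexp U V); rewrite l0 expn0 => /eqP; rewrite indexg_eq1.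
by move=> /subsetP/(_ u Uu); apply/negP.
Qed.

(** U / K is elementary abelian, so its dimension is its minimal number of generators, and the
    images of the [x j] with [P j] generate it. *)
Lemma index_gen_le U K J (x : J -> gT) (P : pred J) :
  'Phi(U) \subset K -> K \subset U -> <<[set x j | j : J]>> = U ->
  (forall j, ~~ P j -> x j \in K) -> (logn p #|U : K| <= #|P|)%N.
Proof.
move=> PK KU genU xK; have nKU := normal_norm (Phi_over_normal PK KU).
have xU j : x j \in U by rewrite -genU mem_gen ?imset_f.
rewrite -(card_quotient nKU) -rank_abelem ?Phi_over_abelem//.
rewrite -grank_abelian ?(abelem_abelian (Phi_over_abelem PK KU))//.
pose B := [set coset K (x j) | j in P].
apply: leq_trans (leq_imset_card (fun j => coset K (x j)) P).
suff -> : 'm(U / K) = 'm(<<B>>) by exact: grank_min.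
congr 'm(_); apply/eqP; rewrite eqEsubset; apply/andP; split.
  have xN : [set x j | j : J] \subset 'N(K).
    by apply: subset_trans nKU; apply/subsetP => _ /imsetP[j _ ->].
  rewrite -[X in quotient X K]genU quotient_gen//.
  rewrite gen_subG; apply/subsetP => y /morphimP[z nz /imsetP[j _ zE] ->] /=.
  rewrite {z}zE in nz *; have [Pj|/xK Kj] := boolP (P j).
    by rewrite mem_gen//; apply/imsetP; exists j.
  by rewrite coset_id// group1.
rewrite gen_subG; apply/subsetP => y /imsetP[j _ ->].
by rewrite mem_quotient.
Qed.

Lemma Phi_index_gen_le U J (x : J -> gT) s : (0 <= s)%R ->
  <<[set x j | j : J]>> = U -> (Phi_index U s <= #|[pred j | (s < w (x j))%R]|)%N.
Proof.
move=> s0 genU; apply: (index_gen_le (Phi_sub_level U s) (Phi_level_sub U s) genU).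
move=> j /=; rewrite -leNgt => xs; apply: (subsetP (level_sub_Phi_level U s)).
by rewrite in_level// xs -genU mem_gen ?imset_f.
Qed.

(* A tight family realizes the minimal number of generators modulo each
   [Phi_level U s], hence minimizes the total weight. *)
Definition tight U J (x : J -> gT) : Prop :=
  <<[set x j | j : J]>> = U /\
  forall s : R, (0 <= s)%R -> (#|[pred j | (s < w (x j))%R]| <= Phi_index U s)%N.

Lemma tight_count U J (x : J -> gT) s : tight U x -> (0 <= s)%R ->
  #|[pred j | (s < w (x j))%R]| = Phi_index U s.
Proof.
move=> [genU xle] s0; apply/eqP.
by rewrite eqn_leq xle// Phi_index_gen_le.
Qed.


(** Generators are picked from the largest weights down. If r0 is the smallest weight above s, a
    family for r0 is completed by lifts of a basis of [Phi_level U r0] modulo [Phi_level U s]. *)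
Lemma tight_exists_above U (s : R) : (0 <= s)%R ->
  exists (J : finType) (x : J -> gT),
    [/\ forall j, x j \in U, <<[set x j | j : J]>> <*> Phi_level U s = U,
        (#|J| <= Phi_index U s)%N &
        forall r : R, (0 <= r)%R ->
          (#|[pred j | (r < w (x j))%R]| <= Phi_index U r)%N].
Proof.
have [n] := ubnP #|[set u in U | (s < w u)%R]|.
elim: n s => // n IHn s; rewrite ltnS => le_n s0.
have [u0 /andP[Uu0 su0]|no] := pickP [pred u in U | (s < w u)%R]; last first.
  exists 'I_0, (fun=> 1); split => [[]//|||r _]; last first.
  - by rewrite (leq_trans (max_card _))// card_ord.
  - by rewrite card_ord.
  apply/eqP; rewrite eqEsubset join_subG Phi_level_sub andbT gen_subG.
  apply/andP; split; first by apply/subsetP => x /imsetP[[]].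
  apply: subset_trans (joing_subr _ _); apply: subset_trans (joing_subr _ _).
  apply/subsetP => u Uu; rewrite in_level// Uu /= leNgt.
  by have /= := no u; rewrite Uu /= => ->.
pose P := [pred u in U | (s < w u)%R].
have Pu0 : P u0 by rewrite /= Uu0.
case: (arg_minP w Pu0) => u /andP[/= Uu su] u_min.
set r0 := w u in u_min su.
have [|J0 [x0 [x0U gen0 card0 x0le]]] := IHn r0 _ (w_ge0 u).
  apply: leq_trans le_n; apply: proper_card; apply/properP; split.
    by apply/subsetP => v; rewrite !inE => /andP[->] /(lt_trans su).
  by exists u; rewrite !inE Uu ?ltxx.
have nDU := normal_norm (Phi_level_normal U s).
(* No weight of [U] lies strictly between s and r0. *)
have sub_s r : (r < r0)%R -> level U r \subset level U s.
  move=> rr0; apply/subsetP => v; rewrite !inE => /andP[Uv /orP[->|wv]].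
    by rewrite Uv.
  rewrite Uv orbC [(w v <= s)%R]leNgt; case: ltP => //= sv.
  by have /= := u_min v; rewrite Uv sv => /(_ isT); rewrite leNgt (le_lt_trans wv).
have DD : Phi_level U s \subset Phi_level U r0.
  rewrite join_subG Phi_sub_level (subset_trans (levelS U (ltW su)))//.
  exact: level_sub_Phi_level.
have lN : level U r0 \subset 'N(Phi_level U s).
  exact: subset_trans (level_sub _ _) nDU.
(* Hence a basis of this quotient lifts to elements of weight at most r0. *)
have DE : Phi_level U r0 / Phi_level U s = level U r0 / Phi_level U s.
  rewrite -(quotientYidl lN)/=.
  suff -> : Phi_level U r0 = Phi_level U s <*> level U r0 by [].
  apply/eqP; rewrite eqEsubset; apply/andP; split; last first.
    by apply/joing_subP; split=> //; exact: level_sub_Phi_level.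
  apply/joing_subP; split; last exact: joing_subr.
  exact: subset_trans (Phi_sub_level _ _) (joing_subl _ _).
have [B genB cardB] := grank_witness (level U r0 / Phi_level U s).
have abE : p.-abelem (level U r0 / Phi_level U s).
  apply: abelemS (Phi_over_abelem (Phi_sub_level U s) (Phi_level_sub U s)).
  exact: quotientS (level_sub _ _).
have cB : #|B| = logn p #|Phi_level U r0 : Phi_level U s|.
  rewrite cardB grank_abelian ?(abelem_abelian abE)// (rank_abelem abE)/= -DE.
  by rewrite card_quotient// (subset_trans (Phi_level_sub _ _)).
pose lift b := odflt 1 [pick y in level U r0 | coset (Phi_level U s) y == b].
have liftP b : b \in B ->
    lift b \in level U r0 /\ coset (Phi_level U s) (lift b) = b.
  move=> Bb; rewrite /lift; case: pickP => [y /andP[yl /eqP//]|noy].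
  have : b \in level U r0 / Phi_level U s by rewrite -genB mem_gen.
  by case/morphimP=> y _ yl bE; have := noy y; rewrite bE yl eqxx.
pose J : finType := (J0 + {b | b \in B})%type.
pose x (j : J) := match j with inl j => x0 j | inr b => lift (val b) end.
have xU j : x j \in U.
  case: j => [j|[b Bb]] /=; first exact: x0U.
  by have [/(subsetP (level_sub _ _))] := liftP b Bb.
have cJ : (#|J| <= Phi_index U s)%N.
  rewrite card_sum card_sig cB.
  rewrite /Phi_index (logn_indexM DD (Phi_level_sub _ _)) leq_add2r.
  exact: card0.
exists J, x; split => // [|r rge0].
  apply/eqP; rewrite eqEsubset join_subG Phi_level_sub andbT gen_subG.
  apply/andP; split; first by apply/subsetP => y /imsetP[j _ ->].
  rewrite -{1}gen0 join_subG gen_subG; apply/andP; split.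
    apply/subsetP => y /imsetP[j _ ->]; apply: (subsetP (joing_subl _ _)).
    by rewrite mem_gen//; apply/imsetP; exists (inl j).
  have XN : <<[set x j | j : J]>> \subset 'N(Phi_level U s).
    apply: subset_trans nDU; rewrite gen_subG.
    by apply/subsetP => y /imsetP[j _ ->].
  have DN : Phi_level U r0 \subset 'N(Phi_level U s).
    by rewrite (subset_trans (Phi_level_sub _ _)).
  apply: (@subset_trans _ _ (Phi_level U s * <<[set x j | j : J]>>)); last first.
    by rewrite mul_subG ?joing_subr ?joing_subl.
  rewrite -quotientSK// DE -genB gen_subG; apply/subsetP => b Bb.
  have [_ <-] := liftP b Bb; apply: mem_quotient; rewrite mem_gen//.
  by apply/imsetP; exists (inr (exist _ b Bb)).
(* Below r0 the whole family may be counted; from r0 on, none of the lifts is. *)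
have [rr0|r0r] := ltP r r0.
  apply: leq_trans (max_card _) (leq_trans cJ _).
  rewrite /Phi_index (@logn_indexM U (Phi_level_group U s) (Phi_level_group U r)).
  - exact: leq_addr.
  - apply/joing_subP; split; first exact: Phi_sub_level.
    exact: subset_trans (sub_s _ rr0) (level_sub_Phi_level _ _).
  - exact: Phi_level_sub.
apply: leq_trans (x0le r rge0).
rewrite -!sum1_card big_sumType/= [X in (_ + X)%N]big_pred0 ?addn0//.
move=> b; have [+ _] := liftP _ (valP b); rewrite in_level ?w_ge0// => /andP[_ wl].
by apply/negbTE; rewrite inE -leNgt (le_trans wl).
Qed.

Lemma tight_exists U : exists (J : finType) (x : J -> gT), tight U x.
Proof.
have [J [x [xU genU _ xle]]] := tight_exists_above U (lexx 0%R).
exists J, x; split=> //.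
have lev0 : level U 0 = 1.
  apply/eqP; rewrite eqEsubset sub1G andbT; apply/subsetP => u.
  rewrite in_level// => /andP[_ u0]; apply/set1P; apply: (gval_eq0 hw).
  by apply/eqP; rewrite eq_le u0 w_ge0.
apply: (@Phi_nongen _ U [set x j | j : J]).
by move: genU; rewrite /Phi_level lev0 joingG1 joingC joing_idr.
Qed.

Definition min_outside U V (a : R) : Prop :=
  (exists2 u, u \in U :\: V & w u = a) /\ (forall u, u \in U :\: V -> (a <= w u)%R).

Lemma min_outside_exists U V : V \proper U -> exists a, min_outside U V a.
Proof.
case/properP => _ [u Uu Vu].
have Pu : [pred u in U :\: V] u by rewrite /= inE Vu.
case: (arg_minP w Pu) => v UVv v_min; exists (w v); split=> //; by exists v.
Qed.

Lemma level_min_outside U V a s : V \subset U -> min_outside U V a ->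
  (s < a)%R -> level U s = level V s.
Proof.
move=> VU [_ a_min] sa; apply/setP => x; rewrite !inE.
have [Vx|Vx] := boolP (x \in V); first by rewrite (subsetP VU).
rewrite andbC; apply/negbTE/negP => /andP[+ Ux].
case/orP=> [/eqP x1|xs]; first by rewrite x1 group1 in Vx.
have /a_min : x \in U :\: V by rewrite inE Vx.
by rewrite leNgt (le_lt_trans xs).
Qed.

(* If all [x j] of weight at most [a] were in [V], then [U / (V :&: Phi_level U
   a)] would be generated by as few elements as its proper quotient
   [U / Phi_level U a] needs. *)
Lemma tight_min_outside U V a J (x : J -> gT) :
  tight U x -> maximal V U -> min_outside U V a ->
  exists2 t, x t \notin V & w (x t) = a.
Proof.
move=> tx maxV [[u /setDP[Uu Vu] wu] a_min].
have [genU xle] := tx; have a0 : (0 <= a)%R by rewrite -wu.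
have xU j : x j \in U by rewrite -genU mem_gen ?imset_f.
have [/existsP[t /andP[Vt wt]]|] :=
  boolP [exists t, (x t \notin V) && (w (x t) <= a)%R].
  by exists t => //; apply/eqP; rewrite eq_le wt a_min// inE Vt xU.
rewrite negb_exists => /forallP no.
pose K := (V :&: Phi_level U a)%G.
have PK : 'Phi(U) \subset K by rewrite subsetI Phi_sub_max ?Phi_sub_level.
have KU : K \subset U by rewrite subIset// Phi_level_sub orbT.
have KD : K \subset Phi_level U a by exact: subsetIr.
have := index_gen_le (P := [pred j | (a < w (x j))%R]) PK KU genU.
rewrite (logn_indexM KD (Phi_level_sub _ _)) => le_n; suff: False by [].
have Du : u \in Phi_level U a.
  by apply: (subsetP (level_sub_Phi_level _ _)); rewrite in_level// Uu wu /=.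
have Ku : u \notin K by rewrite inE (negbTE Vu).
have := logn_index_gt0 Du Ku; apply/negP; rewrite -leqNgt.
rewrite -(leq_add2l (Phi_index U a)) addn0.
apply: leq_trans (le_n _) (xle a a0) => j /=; rewrite -leNgt => xja.
rewrite inE; have := no j; rewrite xja andbT negbK => -> /=.
by apply: (subsetP (level_sub_Phi_level _ _)); rewrite in_level// xU.
Qed.

(** The image of [x t] generates U / V. The second clause keeps the weights under control: only
    elements outside [V] are changed, and they weigh at least as much as [x t] once [x t] has
    minimal weight there. *)
Lemma normalize_into_maximal U V J (x : J -> gT) t :
  maximal V U -> (forall j, x j \in U) -> x t \notin V ->
  exists a : J -> nat, forall j,
    (j != t -> x j * x t ^+ a j \in V) /\ (x j \in V -> a j = 0%N).
Proof.
move=> maxV xU Vt.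
have nV := p_maximal_normal (pgr U) maxV.
have UE : V * <[x t]> = U.
  apply: mulg_normal_maximal => //; first by rewrite cycle_subG.
  by rewrite cycle_subG.
have ex j : exists a, (x j * x t ^+ a \in V) && ((x j \in V) ==> (a == 0%N)).
  have [Vj|Vj] := boolP (x j \in V); first by exists 0%N; rewrite expg0 mulg1 Vj /=.
  have : x j \in V * <[x t]> by rewrite UE.
  case/mulsgP => v c Vv /cyclePmin[k kt ->] ->.
  exists (#[x t] - k)%N; rewrite -mulgA -expgD subnKC ?expg_order ?mulg1 ?Vv//.
  exact: ltnW.
exists (fun j => ex_minn (ex j)) => j; case: ex_minnP => m /andP[-> Vm] _.
by split=> // /(implyP Vm)/eqP.
Qed.

Lemma normalized_gen J (x : J -> gT) t (a : J -> nat) :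
  <<[set normalized_family x t a j | j : J]>> = <<[set x j | j : J]>>.
Proof.
apply/eqP; rewrite eqEsubset !gen_subG; apply/andP; split.
  apply/subsetP => _ /imsetP[j _ ->]; rewrite /normalized_family.
  have X i : x i \in <<[set x j | j : J]>> by rewrite mem_gen ?imset_f.
  by case: eqP => // _; rewrite groupM ?groupX.
have N i : normalized_family x t a i \in <<[set normalized_family x t a j | j : J]>>.
  by rewrite mem_gen ?imset_f.
have Xt : x t \in <<[set normalized_family x t a j | j : J]>>.
  by have := N t; rewrite {1}/normalized_family eqxx.
apply/subsetP => _ /imsetP[j _ ->].
have := N j; rewrite {1}/normalized_family; case: eqP => [->//|_].
by rewrite groupMr ?groupX.
Qed.

(** Let K be the group generated by the family and t stand for [x t]. Conjugation by t maps the
    k-fold commutator y_k to y_k y_(k+1), so K contains the conjugates of [x j] by t^i for i < p,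
    and for all i because t^p is in K. Hence t normalizes K and U = K <t>; as t is not in V, an
    element k t^i of V has p | i and lies in K. *)
Lemma schreier_gen U V J (x : J -> gT) t :
  <<[set x j | j : J]>> = U -> maximal V U -> x t \notin V ->
  (forall j, j != t -> x j \in V) ->
  <<[set schreier_family x i | i : schreier_index p t]>> = V.
Proof.
move=> genU maxV Vt xV.
have xU j : x j \in U by rewrite -genU mem_gen ?imset_f.
have nV := p_maximal_normal (pgr U) maxV.
have [VU nVU] := andP nV.
have VtP : x t ^+ p \in V.
  have /(abelemP p_pr)[_ /(_ (coset V (x t)))] :=
    Phi_over_abelem (Phi_sub_max maxV) VU.
  have Nt : x t \in 'N(V) by exact: (subsetP nVU).
  rewrite mem_quotient// -morphX// => /(_ isT) /coset_idr; apply.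
  exact: groupX.
set K := <<_>>; have yK (i : schreier_index p t) : schreier_family x i \in K.
  by rewrite mem_gen ?imset_f.
have KtP : x t ^+ p \in K := yK None.
pose y j k := iter k (fun g => [~ g, x t]) (x j).
have yE j k : y j k ^ x t = y j k * y j k.+1 by rewrite /y iterS commgEl mulKVg.
have yK0 j k : j != t -> (k < p)%N -> y j k \in K.
  by move=> tj kp; exact: (yK (Some (exist _ j tj, Ordinal kp))).
have yK1 j k i : j != t -> (k + i < p)%N -> y j k ^ (x t ^+ i) \in K.
  move=> tj; elim: i k => [|i IHi] k; first by rewrite addn0 expg0 conjg1; exact: yK0.
  rewrite addnS => kip; rewrite expgS conjgM yE conjMg groupM ?IHi//.
  by rewrite (ltn_trans _ kip).
have yK2 j k i : j != t -> y j k ^ (x t ^+ i) \in K.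
  move=> tj; elim: k i => [|k IHk] i; last first.
    have -> : y j k.+1 = (y j k)^-1 * y j k ^ x t by rewrite yE mulKg.
    by rewrite conjMg conjVg -conjgM -expgS groupM ?groupV.
  rewrite (divn_eq i p) addnC expgD conjgM mulnC expgM groupJ//; last exact: groupX.
  by apply: yK1 => //; rewrite add0n ltn_mod prime_gt0.
have nKt : x t \in 'N(K).
  rewrite inE -genJ gen_subG; apply/subsetP => g.
  rewrite mem_conjg => /imsetP[[[[j tj] k]|] _ gE]; rewrite -(conjgKV (x t) g) gE /=.
    by have := yK2 j k 1%N tj; rewrite expg1.
  by rewrite conjXg conjgE mulKg; exact: KtP.
have KV : K \subset V.
  rewrite gen_subG; apply/subsetP => _ /imsetP[[[[j tj] k]|] _ ->] //=.
  elim: (nat_of_ord k) => [|m IHm] /=; first exact: xV.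
  by rewrite commgEl groupM ?groupV// memJ_norm// (subsetP nVU).
apply/eqP; rewrite eqEsubset KV; apply/subsetP => v Vv.
have : v \in K * <[x t]>.
  rewrite -norm_joinEr ?cycle_subG//.
  suff /subsetP : U \subset K <*> <[x t]> by apply; exact: (subsetP VU).
  rewrite -genU gen_subG; apply/subsetP => _ /imsetP[j _ ->].
  have [->|tj] := eqVneq j t.
    by apply: (subsetP (joing_subr _ _)); exact: cycle_id.
  apply: (subsetP (joing_subl _ _)).
  exact: (yK0 j 0%N tj (prime_gt0 p_pr)).
case/mulsgP => k c Kk /cycleP[i ->] vE; rewrite vE groupM//.
have Vi : x t ^+ i \in V.
  by move: Vv; rewrite vE groupMl// (subsetP KV).
(* If i is prime to p, a Bezout relation puts [x t] itself into [V]. *)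
have [/dvdnP[m ->]|npi] := boolP (p %| i)%N; first by rewrite mulnC expgM groupX.
have /eqP cop : coprime i p by rewrite coprime_sym prime_coprime.
have ip : (0 < i)%N by case: (i) npi => [/negP[]|]; rewrite ?dvdn0.
case/negP: Vt; have [u v' uv _] := egcdnP p ip.
have : x t ^+ (u * i) \in V by rewrite mulnC expgM groupX.
by rewrite uv cop expgD expg1 groupMl// mulnC expgM groupX.
Qed.

End FiniteValuedGroup.

(** * Comparison of sums by counting above thresholds *)

Section Domination.
Variable R : realType.
Implicit Types (a b : seq R).

(** Domination of the counts forces entrywise domination of the decreasing sequences: if the heads
    satisfied y < x, the threshold s = y would count x but nothing in b. *)
Lemma sum_le_of_count_gt_sorted a b :
  sorted >=%R a -> sorted >=%R b -> (forall y, y \in b -> 0 <= y) ->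
  (forall s, 0 <= s -> (count (> s) a <= count (> s) b)%N) ->
  \sum_(x <- a) x <= \sum_(y <- b) y.
Proof.
have ge_trans : transitive (>=%R : rel R) by move=> y x z /[swap]; exact: le_trans.
elim: a b => [|x a IHa] b; first by rewrite big_nil big_seq => *; rewrite sumr_ge0.
case: b => [|y b] xa yb b0 le_ab.
  rewrite big_nil big_seq sumr_le0// => z za; rewrite leNgt; apply/negP => z0.
  have := le_ab 0 (lexx 0); rewrite leqn0 -[_ == 0%N]negbK -lt0n -has_count.
  by move=> /hasP; apply; exists z.
have /allP ax : all (>=%R x) a by apply: order_path_min xa.
have /allP by_ : all (>=%R y) b by apply: order_path_min yb.
have y0 : 0 <= y by rewrite b0 ?mem_head.
have xy : x <= y.
  rewrite leNgt; apply/negP => lt_yx; have := le_ab y y0.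
  rewrite /= lt_yx ltxx/= add0n; suff -> : count (> y) b = 0%N by [].
  by apply/eqP; rewrite -[_ == _]negbK -lt0n -has_count;
    apply/hasPn => z /by_ /= ; rewrite -leNgt.
rewrite !big_cons lerD// IHa ?(path_sorted xa) ?(path_sorted yb)//.
  by move=> z zb; rewrite b0// in_cons zb orbT.
move=> s s0; have [sx|xs] := ltP s x.
  by have := le_ab s s0; rewrite /= sx (lt_le_trans sx xy).
suff -> : count (> s) a = 0%N by [].
apply/eqP; rewrite -[_ == _]negbK -lt0n -has_count.
by apply/hasPn => z /ax /=; rewrite -leNgt => /le_trans; apply.
Qed.

Lemma sum_le_of_count_gt (I J : finType) (x : I -> R) (y : J -> R) :
  (forall j, 0 <= y j) ->
  (forall s, 0 <= s -> (#|[pred i | (s < x i)%R]| <= #|[pred j | (s < y j)%R]|)%N) ->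
  \sum_i x i <= \sum_j y j.
Proof.
move=> y0 le_xy.
have sortE (K : finType) (z : K -> R) :
    \sum_i z i = \sum_(r <- sort >=%R [seq z i | i : K]) r.
  rewrite (perm_big [seq z i | i : K]) ?perm_sort//=.
  by rewrite big_image.
have countE (K : finType) (z : K -> R) s :
    count (> s) (sort >=%R [seq z i | i : K]) = #|[pred i | (s < z i)%R]|.
  rewrite count_sort count_map enumT cardE /enum_mem size_filter.
  by apply: eq_count => i; rewrite inE.
rewrite !sortE; apply: sum_le_of_count_gt_sorted.
- by apply: sort_sorted => r s; exact: le_total.
- by apply: sort_sorted => r s; exact: le_total.
- by move=> z; rewrite mem_sort => /mapP[j _ ->].
- by move=> s s0; rewrite !countE le_xy.
Qed.

End Domination.

Section SchreierFactor.
Variables (R : realType) (p : nat).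
Hypothesis p_pr : prime p.
Implicit Types (a : R) (l : seq R).

Definition schreier_factor a : R := \sum_(k < p) a ^+ k.

Lemma schreier_factor_mul a : schreier_factor a * (1 - a) = 1 - a ^+ p.
Proof.
by rewrite -opprB mulrN -[in RHS]opprB (subrX1 a p) mulrC.
Qed.

Lemma schreier_factorE a : a < 1 ->
  (1 - a ^+ p) / (1 - a) = schreier_factor a.
Proof.
by move=> a1; rewrite -schreier_factor_mul mulfK// subr_eq0 gt_eqF.
Qed.

Lemma schreier_factor_ge a : 0 <= a -> 1 + a <= schreier_factor a.
Proof.
move=> a0; rewrite /schreier_factor; case: p (prime_gt1 p_pr) => [|[|n]]// _.
rewrite !big_ord_recl/= expr0 expr1 addrA lerDl sumr_ge0// => i _.
exact: exprn_ge0.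
Qed.

Lemma schreier_factor_ge1 a : 0 <= a -> 1 <= schreier_factor a.
Proof. by move=> a0; apply: le_trans (schreier_factor_ge a0); rewrite lerDl. Qed.

(** Turns a finite W-index into bounds on the weights of a chain: on the number of heavy steps and
    on the sum of the light ones. *)
Lemma prod_schreier_factor_ge (c : pred R) l : all (>= 0) l ->
  1 + \sum_(a <- l | c a) a <= \prod_(a <- l | c a) schreier_factor a.
Proof.
elim: l => [|a l IHl] /=; first by rewrite !big_nil addr0.
move=> /andP[a0 l0]; rewrite !big_cons; case: ifP => _; last exact: IHl.
have := ler_pM _ _ (schreier_factor_ge a0) (IHl l0); set S := \sum_(_ <- _ | _) _.
have S0 : 0 <= S by rewrite /S big_seq_cond sumr_ge0// => x /andP[/(allP l0)].
move=> /(_ (addr_ge0 ler01 a0) (addr_ge0 ler01 S0)); apply: le_trans.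
by rewrite mulrDl mul1r mulrDr mulr1 addrACA addrA addrA lerDl mulr_ge0.
Qed.

Lemma prod_schreier_factor_ge1 (c : pred R) l : all (>= 0) l ->
  1 <= \prod_(a <- l | c a) schreier_factor a.
Proof.
move=> l0; apply: le_trans (prod_schreier_factor_ge c l0).
by rewrite lerDl big_seq_cond sumr_ge0// => x /andP[/(allP l0)].
Qed.

End SchreierFactor.

(** * The inequality and the two coefficients for finite p-groups *)

Section SchreierInequality.
Import boot.ssrbool boot.fintype boot.finset.
Variables (R : realType) (p : nat) (gT : finGroupType) (w : gT -> R).
Hypotheses (p_pr : prime p) (hw : group_valuation p w).
Hypothesis pG : (p.-group [set: gT])%g.
Implicit Types (U V H K : {group gT}) (l : seq R).
Local Open Scope group_scope.

Let w_ge0 := gval_ge0 hw.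
Let pgr U : p.-group U.
Proof. by apply: pgroupS pG; apply: subsetT. Qed.

Lemma tight_sum_le V (I J : finType) (z : I -> gT) (y : J -> gT) :
  tight p w V z -> <<[set y j | j : J]>> = V ->
  (\sum_i w (z i) <= \sum_j w (y j))%R.
Proof.
move=> tz genV; apply: (sum_le_of_count_gt (x := w \o z) (y := w \o y)) => [j|s s0] //=.
rewrite (tight_count hw pG tz s0).
exact: Phi_index_gen_le.
Qed.

Lemma normalized_family_le U V (J : finType) (x : J -> gT) t (a : J -> nat) b j :
  (forall j, x j \in U) -> min_outside w U V b -> w (x t) = b ->
  (x j \in V -> a j = 0%N) ->
  (w (normalized_family x t a j) <= w (x j))%R.
Proof.
move=> xU [_ b_min] wt Va; rewrite /normalized_family; case: eqP => [->//|_].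
have [/Va ->|Vj] := boolP (x j \in V); first by rewrite expg0 mulg1.
rewrite (gvalM_le hw)// (le_trans (gvalX_le hw _ _))// wt b_min//.
by rewrite inE Vj xU.
Qed.

Lemma schreier_step U V b (I J : finType) (z : I -> gT) (x : J -> gT) :
  tight p w U x -> maximal V U -> min_outside w U V b -> tight p w V z ->
  (\sum_i w (z i) - 1 <= schreier_factor p b * (\sum_j w (x j) - 1))%R.
Proof.
move=> tx maxV minb tz; have [genU _] := tx.
have [t Vt wt] := tight_min_outside hw pG tx maxV minb.
have xU j : x j \in U by rewrite -genU mem_gen ?imset_f.
have [a aP] := normalize_into_maximal pG maxV xU Vt.
set x' := normalized_family x t a.
have x't : x' t = x t by rewrite /x' /normalized_family eqxx.
have gen' : <<[set schreier_family x' i | i : schreier_index p t]>> = V.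
  apply: (schreier_gen p_pr pG (U := U)) => //; first by rewrite normalized_gen.
    by rewrite x't.
  move=> j tj; rewrite /x' /normalized_family (negbTE tj).
  by have [/(_ tj)] := aP j.
have := tight_sum_le tz gen'.
have x'le j : (w (x' j) <= w (x j))%R.
  by apply: (normalized_family_le (U := U) (V := V) (b := b)) => //; case: (aP j).
have le_y : (\sum_(i : schreier_index p t) w (schreier_family x' i) <=
    \sum_(i : schreier_index p t) schreier_weight (w \o x') i)%R.
  by apply: ler_sum => i _; exact: schreier_le.
move=> /le_trans /(_ le_y) {le_y}.
rewrite (@sum_schreier_weight R p J t (w \o x') xpredT)/= x't wt => le_z.
have b0 : (0 <= b)%R by rewrite -wt.
have -> : (\sum_j w (x j) = b + \sum_(j | j != t) w (x j))%R.
  by rewrite (bigD1 t)//= wt.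
set S := (\sum_(j | j != t) w (x j))%R.
have le_S : (\sum_(j | j != t) \sum_(k < p) b ^+ k * w (x' j) <=
    schreier_factor p b * S)%R.
  rewrite mulr_sumr; apply: ler_sum => j _; rewrite -mulr_suml.
  by rewrite ler_wpM2l// sumr_ge0// => k _; rewrite exprn_ge0.
(* The new weight is at most b^p + N S, and N (b + S - 1) = N S - (1 - b^p). *)
have := schreier_factor_mul p b; set N := schreier_factor p b in le_S *.
lra.
Qed.

(** Only the minimal weights of the steps are recorded; they determine the index
    ([level_index_chain]). *)
Fixpoint maximal_chain l U H : Prop :=
  if l is a :: l' then
    exists V, [/\ maximal V U, min_outside w U V a & maximal_chain l' V H]
  else U = H.

Lemma maximal_chain_exists U H : H \subset U -> exists l, maximal_chain l U H.
Proof.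
have [n] := ubnP #|U|; elim: n => // n IHn in U *; rewrite ltnS => le_n HU.
have [UH|[V maxV HV]] := maximal_exists HU.
  by exists [::]; apply/esym/val_inj.
have prV := maxgroupp maxV.
have [|l lV] := IHn V _ HV; first exact: leq_trans (proper_card prV) le_n.
by have [a ha] := min_outside_exists w prV; exists (a :: l), V.
Qed.

Lemma maximal_chain_mem l U H a : maximal_chain l U H -> a \in l ->
  exists2 u, u \in U & w u = a /\ u != 1.
Proof.
elim: l U => [|b l IHl] U //= [V [maxV [[u /setDP[Uu Vu] wu] _] lV]].
rewrite in_cons => /orP[/eqP->|/(IHl _ lV)[v Vv vP]]; last first.
  by exists v => //; apply: (subsetP (proper_sub (maxgroupp maxV))).
by exists u => //; split=> //; apply: contraNneq Vu => ->; rewrite group1.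
Qed.

Lemma maximal_chain_ge0 l U H : maximal_chain l U H -> all (>= 0)%R l.
Proof.
by move=> lU; apply/allP => a /(maximal_chain_mem lU)[u _ [<- _]] /=.
Qed.

Lemma schreier_inequality U H l (I J : finType) (z : I -> gT) (x : J -> gT) :
  maximal_chain l U H -> tight p w U x -> tight p w H z ->
  (\sum_i w (z i) - 1 <=
   \prod_(a <- l) schreier_factor p a * (\sum_j w (x j) - 1))%R.
Proof.
elim: l U J x => [|a l IHl] U J x /=.
  by move=> -> tx tz; rewrite big_nil mul1r lerD2r (tight_sum_le tz)//; case: tx.
move=> [V [maxV mina lV]] tx tz.
have [K [y ty]] := tight_exists hw pG V.
apply: le_trans (IHl _ _ _ lV ty tz) _.
rewrite big_cons (mulrC (schreier_factor p a)) -mulrA ler_wpM2l//; last first.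
  exact: (schreier_step tx maxV mina ty).
apply: le_trans ler01 _; apply: prod_schreier_factor_ge1 => //.
exact: maximal_chain_ge0 lV.
Qed.

(** This is c_a of [U]; [Phi_level_index] is c_a of U / Phi(U). *)
Definition level_index U (a : R) : nat :=
  logn p #|level w U a : [set x in U | (w x < a)%R]|.

Definition Phi_level_index U (a : R) : nat :=
  logn p #|Phi_level w U a : 'Phi(U) <*> [set x in U | (w x < a)%R]|.

(* The finitely many values leave a gap below [a]. *)
Lemma lt_level (a : R) : (0 < a)%R ->
  exists s : R, [/\ (0 <= s)%R, (s < a)%R,
    (forall x, (w x < a)%R = (w x <= s)%R) &
    forall U, [set x in U | (w x < a)%R] = level w U s].
Proof.
move=> a0; have P1 : [pred x | (w x < a)%R] 1 by rewrite /= (gval1 hw).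
case: (arg_maxP w P1) => x /= xa x_max.
have E y : (w y < a)%R = (w y <= w x)%R.
  by apply/idP/idP => [/x_max//|/le_lt_trans]; apply.
exists (w x); split=> // U.
by apply/setP => y; rewrite (in_level hw)// inE E.
Qed.

(** Below b the levels of U and V coincide; from b on the level of U covers U / V and is p times
    larger. So the indices of successive levels differ at a = b only. *)
Lemma level_index_step U V a b : maximal V U -> min_outside w U V b -> (0 < a)%R ->
  level_index U a = (level_index V a + (b == a))%N.
Proof.
move=> maxV minb a0; have VU := proper_sub (maxgroupp maxV).
have [s [s0 sa sE lE]] := lt_level a0; rewrite /level_index !lE.
have cardE r : #|level w U r| =
    (#|level w V r| * (if (b <= r)%R then p else 1))%N.
  case: ifPn => [br|]; last first.
    by rewrite -ltNge muln1 => rb; rewrite (level_min_outside VU minb rb).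
  have [[u /setDP[Uu Vu] wu] _] := minb.
  have r0 : (0 <= r)%R by apply: le_trans br; rewrite -wu.
  have nV := p_maximal_normal (pgr U) maxV.
  have IE : V :&: level w U r = level w V r.
    apply/setP => x; rewrite inE !(in_level hw)//.
    by case: (boolP (x \in V)) => //= Vx; rewrite (subsetP VU).
  have UE : V * level w U r = U.
    apply: (@mulg_normal_maximal _ U V (level_group hw U r)) => //.
      exact: level_sub.
    apply/negP => /subsetP/(_ u).
    by rewrite (in_level hw)// Uu wu br (negbTE Vu) => /(_ isT).
  apply/eqP; rewrite -(eqn_pmul2l (cardG_gt0 V)).
  rewrite (mul_cardG V (level_group hw U r))/= UE IE.
  by rewrite -(Lagrange VU) (p_maximal_index (pgr U) maxV) -mulnA (mulnC p).
have log_card K : logn p #|level w K a : level w K s| =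
    (logn p #|level w K a| - logn p #|level w K s|)%N.
  have le_K : level_group hw K s \subset level_group hw K a.
    exact: levelS (ltW sa).
  rewrite -[X in (logn p X - _)%N](Lagrange le_K) lognM ?cardG_gt0 ?indexg_gt0//.
  by rewrite addKn.
have log_level r : logn p #|level w U r| =
    (logn p #|level w V r| + (b <= r)%R)%N.
  rewrite cardE lognM; last 2 first.
  - exact: cardG_gt0 (level_group hw V r).
  - by case: ifP => // _; exact: prime_gt0.
  by case: ifP => _; rewrite ?logn1// -{3}(expn1 p) pfactorK.
rewrite !log_card !log_level.
have le_V : (logn p #|level w V s| <= logn p #|level w V a|)%N.
  have := cardSg (levelS w V (ltW sa) : level_group hw V s \subset level_group hw V a).
  by apply: dvdn_leq_log; exact: cardG_gt0 (level_group hw V a).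
have bsE : (b <= s)%R = (b < a)%R.
  have [[u /setDP[Uu Vu] <-] _] := minb.
  by rewrite sE.
rewrite bsE; case: ltgtP => _; rewrite ?addn0 ?addn1 ?subSS//.
by rewrite subSn.
Qed.

(** Thus the exponent of the factor for a in the W-index counts the steps of weight a, whatever the
    chain. *)
Lemma level_index_chain l U H a : maximal_chain l U H -> (0 < a)%R ->
  level_index U a = (level_index H a + count_mem a l)%N.
Proof.
move=> lU a0; elim: l U lU => [|b l IHl] U /=; first by move=> ->; rewrite addn0.
move=> [V [maxV minb lV]]; rewrite (level_index_step maxV minb a0) (IHl _ lV).
by rewrite -addnA (addnC (count _ _)).
Qed.

(** Difference of the counts above the next smaller weight and above [a]. *)
Lemma tight_Phi_level_index U (J : finType) (x : J -> gT) a :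
  tight p w U x -> (0 < a)%R -> Phi_level_index U a = #|[pred j | w (x j) == a]|.
Proof.
move=> tx a0; have [s [s0 sa sE lE]] := lt_level a0.
rewrite /Phi_level_index lE.
have DD : Phi_level_group w U s \subset Phi_level_group w U a.
  apply/joing_subP; split; first exact: Phi_sub_level.
  exact: subset_trans (levelS w U (ltW sa)) (level_sub_Phi_level _ _ _).
have := logn_indexM p DD (Phi_level_sub w U a).
rewrite -[logn p #|U : _|]/(Phi_index p w U s).
rewrite -[logn p #|U : _|]/(Phi_index p w U a).
rewrite -(tight_count hw pG tx s0) -(tight_count hw pG tx (ltW a0)) => cE.
apply/eqP; rewrite -(eqn_add2l #|[pred j | (a < w (x j))%R]|) -cE.
apply/eqP; rewrite -cardUI [X in (_ = _ + X)%N]eq_card0 ?addn0.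
  apply: eq_card => j; rewrite !inE -[(s < _)%R]negbK -leNgt -sE -leNgt le_eqVlt.
  by rewrite eq_sym orbC.
by move=> j; rewrite !inE; case: ltgtP.
Qed.

Lemma sum_tight_Phi_level_index U (J : finType) (x : J -> gT) (F : {fset R}) :
  tight p w U x -> (forall a, a \in F -> (0 < a)%R) ->
  (\sum_(a <- F) (Phi_level_index U a)%:R * a =
   \sum_(j | w (x j) \in F) w (x j))%R.
Proof.
move=> tx F0; transitivity
    (\sum_(a <- F) \sum_(j | w (x j) == a) w (x j))%R.
  apply: eq_big_seq => a aF; rewrite (tight_Phi_level_index tx (F0 a aF)).
  rewrite (eq_bigr (fun=> a)) => [|j /eqP//].
  by rewrite sumr_const mulr_natl.
rewrite (exchange_big_dep xpredT)//= [RHS]big_mkcond/=; apply: eq_bigr => j _.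
rewrite big_const_seq iter_addr_0; rewrite (@eq_count _ _ (pred1 (w (x j)))).
  by rewrite count_uniq_mem ?fset_uniq//; case: (_ \in _).
by move=> a /=; rewrite eq_sym.
Qed.

End SchreierInequality.

(** * Free families in a weighted group ring *)

Lemma big_ord_predl (V : nmodType) (n : nat) (F : nat -> V) : (0 < n)%N ->
  \sum_(k < n) F k = F 0%N + \sum_(k < n.-1) F k.+1.
Proof. by case: n => // n _; rewrite big_ord_recl. Qed.

Lemma big_ord_predr (V : nmodType) (n : nat) (F : nat -> V) : (0 < n)%N ->
  \sum_(k < n) F k = \sum_(k < n.-1) F k + F n.-1.
Proof. by case: n => // n _; rewrite big_ord_recr. Qed.

Section WeightedGroupRing.
Variables (R : realType) (p : nat) (G : groupType) (A : pzRingType).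
Variables (w : A -> R) (mu : G -> A) (W : G -> R).
Hypotheses (p_pr : prime p) (hW : group_valuation p W).
Hypothesis w_ge0 : forall f, 0 <= w f.
Hypothesis w_le1 : forall f, w f <= 1.
Hypothesis w_eq0 : forall f, w f = 0 <-> f = 0.
Hypothesis w1 : w 1 = 1.
Hypothesis wD : forall f g, w (f + g) <= Num.max (w f) (w g).
Hypothesis wM : forall f g, w (f * g) = w f * w g.
Hypothesis p0 : p%:R = 0 :> A.
Hypotheses (mu1 : mu 1%g = 1) (muM : forall g h, mu (g * h)%g = mu g * mu h).
Hypothesis WE : forall g, W g = w (mu g - 1).
Implicit Types (f : A) (v : R) (J : finType).

Lemma weight0 : w 0 = 0.
Proof. exact/w_eq0. Qed.

Lemma weightN f : w (- f) = w f.
Proof.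
rewrite -mulN1r wM; suff -> : w (-1) = 1 by rewrite mul1r.
have /eqP : w (-1) ^+ 2 = 1 by rewrite expr2 -wM mulrNN mul1r.
by rewrite sqrf_eq1 => /orP[/eqP//|/eqP wN]; have := w_ge0 (-1); rewrite wN oppr_ge0 ler10.
Qed.

Lemma weightD_lt v f g : w f < v -> w g < v -> w (f + g) < v.
Proof. by move=> fv gv; apply: le_lt_trans (wD f g) _; rewrite gt_max fv. Qed.

Lemma weightD_le v f g : w f <= v -> w g <= v -> w (f + g) <= v.
Proof. by move=> fv gv; apply: le_trans (wD f g) _; rewrite ge_max fv. Qed.

Lemma weightB_lt v f g : w f < v -> w g < v -> w (f - g) < v.
Proof. by move=> fv gv; rewrite weightD_lt ?weightN. Qed.

Lemma weightB_le v f g : w f <= v -> w g <= v -> w (f - g) <= v.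
Proof. by move=> fv gv; rewrite weightD_le ?weightN. Qed.

Lemma weight_sum_lt v (I : Type) (r : seq I) (P : pred I) (F : I -> A) :
  0 < v -> (forall i, P i -> w (F i) < v) -> w (\sum_(i <- r | P i) F i) < v.
Proof.
move=> v0 Fv; elim/big_ind: _ => //; first by rewrite weight0.
exact: weightD_lt.
Qed.

Lemma weight_sum_le v (I : Type) (r : seq I) (P : pred I) (F : I -> A) :
  0 <= v -> (forall i, P i -> w (F i) <= v) -> w (\sum_(i <- r | P i) F i) <= v.
Proof.
move=> v0 Fv; elim/big_ind: _ => //; first by rewrite weight0.
exact: weightD_le.
Qed.

Lemma weightX f n : w (f ^+ n) = w f ^+ n.
Proof. by elim: n => [|n IHn]; rewrite ?expr0// !exprS wM IHn. Qed.

Lemma muV g : mu g * mu g^-1%g = 1.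
Proof. by rewrite -muM mulgV mu1. Qed.

Lemma muX g n : mu (g ^+ n)%g = mu g ^+ n.
Proof. by elim: n => [|n IHn]; rewrite ?expg0 ?mu1// expgS exprS muM IHn. Qed.

Lemma weight_inv f g : f * g = 1 -> w f = 1.
Proof.
move=> fg; have := congr1 w fg; rewrite wM w1 => wfg.
apply/eqP; rewrite eq_le w_le1/= -wfg ler_piMr//.
Qed.

Lemma weight_mu g : w (mu g) = 1.
Proof. exact: weight_inv (muV g). Qed.

(** A nonzero constant is a unit, since p = 0 in [A], and units have weight 1. *)
Lemma weight_nat n : n%:R = 0 :> A \/ w n%:R = 1.
Proof.
have [/dvdnP[m ->]|npn] := boolP (dvdn p n); first by left; rewrite natrM p0 mulr0.
have n0 : (0 < n)%N by case: (n) npn => [/negP[]|]; rewrite ?dvdn0.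
have /eqP cop : coprime n p by rewrite coprime_sym prime_coprime.
right; have [u u' uE _] := egcdnP p n0; apply: (@weight_inv _ u%:R).
by rewrite -natrM mulnC uE cop natrD natrM p0 mulr0 add0r.
Qed.

(** The image in [A] of the group ring over F_p of the abstract group generated by the [x j].
    Building elements by left multiplication makes [group_span_repr] an induction on this
    predicate. *)
Inductive group_span J (x : J -> G) : A -> Prop :=
| group_span1 : group_span x 1
| group_spanN f : group_span x f -> group_span x (- f)
| group_spanD f g : group_span x f -> group_span x g -> group_span x (f + g)
| group_spanMl j f : group_span x f -> group_span x (mu (x j) * f)
| group_spanVl j f : group_span x f -> group_span x (mu (x j)^-1%g * f).

Definition in_group_span J (x : J -> G) (g : G) : Prop :=
  group_span x (mu g) /\ group_span x (mu g^-1%g).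

Section Span.
Variables (J : finType) (x : J -> G).
Local Notation B := (group_span x).
Local Notation Bg := (in_group_span x).

Lemma group_span0 : B 0.
Proof.
by rewrite -(subrr 1); apply: group_spanD; [|apply: group_spanN]; apply: group_span1.
Qed.

Lemma group_spanB f g : B f -> B g -> B (f - g).
Proof. by move=> Bf Bg'; apply: group_spanD => //; apply: group_spanN. Qed.

Lemma group_spanM f g : B f -> B g -> B (f * g).
Proof.
move=> Bf Bg'; elim: Bf => [|h _|h k _ Bh _ Bk|j h _|j h _].
- by rewrite mul1r.
- by rewrite mulNr => ?; apply: group_spanN.
- by rewrite mulrDl; apply: group_spanD.
- by rewrite -mulrA; apply: group_spanMl.
- by rewrite -mulrA; apply: group_spanVl.
Qed.

Lemma group_spanX f n : B f -> B (f ^+ n).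
Proof.
move=> Bf; elim: n => [|n IHn]; first by rewrite expr0; exact: group_span1.
by rewrite exprS; apply: group_spanM.
Qed.

Lemma group_span_sum (I : Type) (r : seq I) (P : pred I) (F : I -> A) :
  (forall i, B (F i)) -> B (\sum_(i <- r | P i) F i).
Proof.
move=> BF; elim/big_ind: _ => //; first exact: group_span0.
exact: group_spanD.
Qed.

Lemma in_group_span_gen j : Bg (x j).
Proof.
split; first by rewrite -[mu _]mulr1; apply: group_spanMl; apply: group_span1.
by rewrite -[mu _]mulr1; apply: group_spanVl; apply: group_span1.
Qed.

Lemma in_group_spanV g : Bg g -> Bg g^-1%g.
Proof. by case=> Bg1 Bg2; split; rewrite ?invgK. Qed.

Lemma in_group_spanM g h : Bg g -> Bg h -> Bg (g * h)%g.
Proof.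
by move=> [Bg1 Bg2] [Bh1 Bh2]; split; rewrite ?invgM muM; apply: group_spanM.
Qed.

Lemma in_group_spanX g n : Bg g -> Bg (g ^+ n)%g.
Proof.
move=> Bg'; elim: n => [|n IHn]; last by rewrite expgS; apply: in_group_spanM.
by rewrite expg0 /in_group_span invg1 mu1; split; apply: group_span1.
Qed.

Lemma in_group_spanR g h : Bg g -> Bg h -> Bg [~ g, h]%g.
Proof.
move=> Bg' Bh; rewrite commgEl conjgE; apply: in_group_spanM.
  exact: in_group_spanV.
apply: in_group_spanM; first exact: in_group_spanV.
exact: in_group_spanM.
Qed.

Lemma group_span_sub (I : finType) (y : I -> G) f :
  (forall i, Bg (y i)) -> group_span y f -> B f.
Proof.
move=> By; elim=> [|h _ ?|h k _ ? _ ?|j h _ ?|j h _ ?].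
- exact: group_span1.
- exact: group_spanN.
- exact: group_spanD.
- by apply: group_spanM => //; case: (By j).
- by apply: group_spanM => //; case: (By j).
Qed.

Lemma group_span_diff g : Bg g -> B (mu g - 1).
Proof. by case=> Bg1 _; apply: group_spanB => //; apply: group_span1. Qed.

(* The augmentation ideal is the right ideal generated by the [x j - 1]. *)
Lemma group_span_repr f : B f -> exists (n : nat) (h : J -> A),
  (forall j, B (h j)) /\ f = n%:R + \sum_j (mu (x j) - 1) * h j.
Proof.
have shift j (n : nat) (h : J -> A) (k : A) :
    n%:R + \sum_i (mu (x i) - 1) * h i + (mu (x j) - 1) * k =
    n%:R + \sum_i (mu (x i) - 1) * (h i + if i == j then k else 0).
  rewrite -addrA; congr (_ + _); rewrite (bigD1 j)//= [RHS](bigD1 j)//= eqxx.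
  rewrite mulrDr addrAC; congr (_ + _); apply: eq_bigr => i /negbTE ->.
  by rewrite addr0.
have Bshift j (h : J -> A) (k : A) : (forall i, B (h i)) -> B k ->
    forall i, B (h i + if i == j then k else 0).
  move=> Bh Bk i; apply: group_spanD => //; case: ifP => // _.
  exact: group_span0.
elim=> [|g _ [n [h [Bh ->]]]|g k _ [n [h [Bh ->]]] _ [m [l [Bl ->]]]
       |j g Bg' [n [h [Bh gE]]]|j g Bg' [n [h [Bh gE]]]].
- exists 1%N, (fun=> 0); split; first by move=> _; exact: group_span0.
  by rewrite big1 ?addr0// => j _; rewrite mulr0.
(* The constant -n is the natural number n (p - 1), as p = 0 in [A]. *)
- exists (n * p.-1)%N, (fun j => - h j); split.
    by move=> j; apply: group_spanN.
  rewrite opprD -sumrN; congr (_ + _); last first.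
    by apply: eq_bigr => j _; rewrite mulrN.
  apply/eqP; rewrite eq_sym -addr_eq0 -natrD -{2}[n]muln1 -mulnDr addn1.
  by rewrite prednK ?prime_gt0// natrM p0 mulr0.
- exists (n + m)%N, (fun j => h j + l j); split.
    by move=> j; apply: group_spanD.
  rewrite natrD addrACA -big_split/=; congr (_ + _).
  by apply: eq_bigr => j _; rewrite mulrDr.
- exists n, (fun i => h i + if i == j then g else 0); split; first exact: Bshift.
  by rewrite -shift -gE mulrBl mul1r addrC subrK.
(* From x^-1 g = g - (x - 1) x^-1 g. *)
- exists n, (fun i => h i + if i == j then - (mu (x j)^-1%g * g) else 0).
  split; first by apply: Bshift => //; apply: group_spanN; apply: group_spanVl.
  by rewrite -shift -gE mulrN mulrBl mulrA muV !mul1r opprB addrC subrK.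
Qed.

End Span.

(* The augmentation ideal of the group ring generated by the [x j] is a free
   right module on the [x j - 1], on which [w] is the maximum norm. *)
Definition aug_free J (x : J -> G) : Prop :=
  forall f : J -> A, (forall j, group_span x (f j)) ->
  forall j, W (x j) * w (f j) <= w (\sum_i (mu (x i) - 1) * f i).

(** * Normalization preserves weights and freeness *)

Section Normalize.
Variables (J : finType) (x : J -> G) (t : J) (a : J -> nat).
Hypothesis free_x : aug_free x.
Hypothesis a_le : forall j, j != t -> a j != 0%N -> W (x t) <= W (x j).
Local Notation x' := (normalized_family x t a).

Let s := mu (x t) - 1.
Let tau j := if j == t then 1 else mu (x t) ^+ a j.
Let rest j := if j == t then 0 else \sum_(i < a j) mu (x t) ^+ i.

(** From x t^a - 1 = (x - 1) t^a + (t^a - 1) and t^a - 1 = (t - 1) (1 + ... + t^(a-1)). *)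
Let normE j : mu (x' j) - 1 = (mu (x j) - 1) * tau j + s * rest j.
Proof.
rewrite /normalized_family /tau /rest; case: eqP => [->|_].
  by rewrite mulr1 mulr0 addr0.
rewrite muM muX mulrBl mul1r /s -subrX1 -addrA; congr (_ + _).
by rewrite addrA addNr add0r.
Qed.

Let Btau j : group_span x (tau j).
Proof.
rewrite /tau; case: eqP => _; first exact: group_span1.
by apply: group_spanX; case: (in_group_span_gen x t).
Qed.

Let Brest j : group_span x (rest j).
Proof.
rewrite /rest; case: eqP => _; first exact: group_span0.
by apply: group_span_sum => i; apply: group_spanX; case: (in_group_span_gen x t).
Qed.

Let wtau j : w (tau j) = 1.
Proof. by rewrite /tau; case: eqP => _ //; rewrite weightX weight_mu expr1n. Qed.

Let w_rest j f : W (x t) * w (rest j * f) <= W (x j) * w f.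
Proof.
rewrite wM mulrA; apply: ler_wpM2r => //.
rewrite /rest; case: eqVneq => [_|tj].
  by rewrite weight0 mulr0 (gval_ge0 hW).
have [->|/(a_le tj)] := eqVneq (a j) 0%N.
  by rewrite big_ord0 weight0 mulr0 (gval_ge0 hW).
by apply: le_trans; rewrite ler_piMr// (gval_ge0 hW).
Qed.

(** The change of coordinates from x' to x is triangular: units of weight 1 on the diagonal, and all
    other entries in row t. *)
Let normalized_sum (f : J -> A) : (forall j, group_span x (f j)) ->
  exists2 h : J -> A, (forall j, group_span x (h j)) &
  [/\ \sum_j (mu (x' j) - 1) * f j = \sum_j (mu (x j) - 1) * h j,
      forall j, j != t -> h j = tau j * f j &
      h t = f t + \sum_j rest j * f j].
Proof.
move=> Bf.
exists (fun j => tau j * f j + if j == t then \sum_i rest i * f i else 0).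
  move=> j; apply: group_spanD; first exact: group_spanM.
  case: eqP => _; last exact: group_span0.
  by apply: group_span_sum => i; apply: group_spanM.
split; last by rewrite eqxx /tau eqxx mul1r.
  under eq_bigr do rewrite normE mulrDl -!mulrA.
  under [RHS]eq_bigr do rewrite mulrDr.
  rewrite !big_split/=; congr (_ + _); rewrite -mulr_sumr [RHS](bigD1 t)//= eqxx.
  by rewrite [X in _ = _ + X]big1 ?addr0// => j /negbTE ->; rewrite mulr0.
by move=> j /negbTE ->; rewrite addr0.
Qed.

(** Freeness of [x], applied to the coordinates of x' j - 1 with respect to the x i - 1. *)
Lemma normalized_weight_ge j : W (x j) <= W (x' j).
Proof.
have Bd i : group_span x (if i == j then 1 else 0).
  by case: eqP => _; [exact: group_span1|exact: group_span0].
have [h Bh [hE h_ne h_t]] := normalized_sum Bd.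
have dE : \sum_i (mu (x' i) - 1) * (if i == j then 1 else 0) = mu (x' j) - 1.
  by rewrite (bigD1 j)//= eqxx mulr1 big1 ?addr0// => i /negbTE ->; rewrite mulr0.
rewrite [leRHS]WE -dE hE; apply: le_trans (free_x Bh j).
have [jt|tj] := eqVneq j t; last by rewrite (h_ne _ tj) eqxx mulr1 wtau mulr1.
rewrite jt h_t jt eqxx big1 ?addr0 ?w1 ?mulr1// => i _.
by rewrite /rest; case: (i =P t); rewrite ?mul0r ?mulr0.
Qed.

Lemma normalized_weight_le j : W (x' j) <= W (x j).
Proof.
rewrite /normalized_family; case: eqVneq => [->//|tj].
have [->|/(a_le tj) le_tj] := eqVneq (a j) 0%N; first by rewrite expg0 mulg1.
by rewrite (gvalM_le hW)// (le_trans (gvalX_le hW _ _)).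
Qed.

Lemma normalized_weight j : W (x' j) = W (x j).
Proof.
by apply/eqP; rewrite eq_le normalized_weight_le normalized_weight_ge.
Qed.

Lemma normalized_span j : in_group_span x (x' j).
Proof.
rewrite /normalized_family; case: eqP => _; first exact: in_group_span_gen.
apply: in_group_spanM; first exact: in_group_span_gen.
by apply: in_group_spanX; exact: in_group_span_gen.
Qed.

Lemma aug_free_normalized : aug_free x'.
Proof.
move=> f Bf' j; have Bf i : group_span x (f i).
  exact: group_span_sub normalized_span (Bf' i).
have [h Bh [-> h_ne h_t]] := normalized_sum Bf.
set S := \sum_i _; have hS := free_x Bh.
have f_ne i : i != t -> W (x i) * w (f i) <= w S.
  by move=> ti; apply: le_trans (hS i); rewrite (h_ne _ ti) wM wtau mul1r.
rewrite normalized_weight; have [->|tj] := eqVneq j t; last exact: f_ne.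
(* The coordinate at t differs from that for [x] by terms that [f_ne] and [w_rest] already bound. *)
have -> : f t = h t - \sum_j rest j * f j by rewrite h_t addrK.
have -> : W (x t) = w s by rewrite WE.
rewrite -wM mulrBr mulr_sumr weightB_le//; first by rewrite wM -[w s]WE.
apply: weight_sum_le => // i _; rewrite wM -[w s]WE.
have [->|ti] := eqVneq i t.
  by rewrite /rest eqxx mul0r weight0 mulr0.
exact: le_trans (w_rest _ _) (f_ne _ ti).
Qed.

End Normalize.

Lemma addrBD3 (V : zmodType) (b1 b2 b3 c1 c2 c3 : V) :
  b1 + b2 + b3 - (c1 + c2 + c3) = b1 + (b2 - c1 - c2) + (b3 - c3).
Proof.
rewrite !opprD -!addrA; congr (_ + (_ + _)).
by rewrite (addrCA b3 (- c1)) (addrCA b3 (- c2)).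
Qed.

Lemma mulr_commB1 (f h : A) :
  (f - 1) * (h - 1) - (h - 1) * (f - 1) = f * h - h * f.
Proof.
rewrite (mulrBl (h - 1)) (mulrBr (h - 1)) mul1r mulr1.
rewrite (opprB ((h - 1) * f)) addrA subrK.
by rewrite mulrBr mulrBl mul1r mulr1 (opprB (h * f)) addrA subrK.
Qed.

(** The commutator with h keeps the shape f hk + h b + e and replaces hk by hk h; this is the
    induction step of [iter_comm]. *)
Lemma mulr_comm3 (f b e h hk : A) :
  (f * hk + h * b + e) * h - h * (f * hk + h * b + e) =
  f * (hk * h) + h * (b * h - f * hk - h * b) + (e * h - h * e).
Proof. by rewrite !mulrDl !mulrDr !mulrN !mulrA addrBD3. Qed.

Lemma mulr_expand3 (f b e h hk k : A) :
  (f * hk + h * b + e) * k = h * (b * k) + f * (hk * k) + e * k.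
Proof. by rewrite !mulrDl -!mulrA (addrC (h * _)). Qed.

(** * The Schreier family of a free family is free *)

Section Schreier.
Variables (J : finType) (x : J -> G) (t : J).
Hypothesis free_x : aug_free x.
Hypothesis x_gt0 : forall j, 0 < W (x j).

Let s := mu (x t) - 1.
Let a := W (x t).
Let y (i : schreier_index p t) := schreier_family x i.
Let nu (i : schreier_index p t) := schreier_weight (W \o x) i.

Let ws : w s = a. Proof. by rewrite -WE. Qed.
Let a_gt0 : 0 < a. Proof. exact: x_gt0. Qed.
Let Bs : group_span x s.
Proof. exact: group_span_diff (in_group_span_gen x t). Qed.
Let BsX k : group_span x (s ^+ k).
Proof. exact: group_spanX. Qed.

Let nu_gt0 i : 0 < nu i.
Proof. by case: i => [[j k]|]; rewrite /nu/= ?mulr_gt0 ?exprn_gt0. Qed.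

Let zNone : mu (y None) - 1 = s ^+ p.
Proof.
have -> : mu (y None) = (s + 1) ^+ p by rewrite /y /= muX /s subrK.
rewrite exprD1n; case: p p_pr p0 => // n n_pr n0.
rewrite big_ord_recl big_ord_recr/= bin0 binn expr0.
rewrite [X in _ + (X + _)]big1; last first.
  move=> i _; have /dvdnP[m ->] : dvdn n.+1 'C(n.+1, bump 0 i).
    by apply: prime_dvd_bin => //; rewrite /bump/= add1n ltnS ltn_ord.
  by rewrite mulrnA -mulr_natr n0 mulr0.
by rewrite add0r /bump/= add1n addrAC subrr add0r.
Qed.

(* The leading term of [y (j, k) - 1] is the k-fold commutator of [x j - 1] with
   [s], of which only [(x j - 1) * s ^+ k] does not start with [s]. *)
Let iter_comm j k : j != t -> exists b e : A,
  [/\ group_span x b, a * w b <= a ^+ k * W (x j), w e < a ^+ k * W (x j) &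
      mu (iter k (fun g => [~ g, x t]%g) (x j)) - 1 =
      (mu (x j) - 1) * s ^+ k + s * b + e].
Proof.
move=> tj; set q := mu (x j) - 1; have wq : w q = W (x j) by rewrite WE.
elim: k => [|k [b [e [Bb wb we]]]].
  exists 0, 0; split; first exact: group_span0.
  - by rewrite weight0 mulr0 mul1r ltW.
  - by rewrite weight0 mul1r.
  - by rewrite expr0 mulr1 mulr0 !addr0.
rewrite iterS; set g := iter k _ _; set z := mu g - 1 => zE.
pose c := z * s - s * z; pose u := mu (g^-1 * (x t)^-1)%g.
have nu0 : 0 < a ^+ k * W (x j) by rewrite mulr_gt0 ?exprn_gt0.
have wz : w z <= a ^+ k * W (x j).
  rewrite zE weightD_le ?(ltW we)// weightD_le//; last by rewrite wM ws.
  by rewrite wM weightX wq ws mulrC.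
have wc : w c <= a ^+ k.+1 * W (x j).
  by rewrite exprSr -mulrA (mulrC a) mulrA weightB_le// wM ws
    ?(mulrC a) ler_wpM2r// ltW.
(* [g, t] - 1 = (t g)^-1 (g t - t g), and the unit u = (t g)^-1 is 1 up to weight below 1, so u c
   and c differ by an error term only. *)
have cE : mu [~ g, x t]%g - 1 = u * c.
  rewrite commgEl conjgE mulgA muM -/u muM /c.
  have -> : z * s - s * z = mu g * mu (x t) - mu (x t) * mu g.
    exact: mulr_commB1.
  rewrite mulrBr; congr (_ - _).
  by rewrite /u -!muM -!mulgA mulKg mulVg mu1.
have wu : w (u - 1) < 1 by rewrite -WE (gval_lt1 hW).
exists (b * s - q * s ^+ k - s * b), (e * s - s * e + (u - 1) * c); split.
- apply: group_spanB; last exact: group_spanM.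
  apply: group_spanB; first exact: group_spanM.
  apply: group_spanM => //.
  exact: group_span_diff (in_group_span_gen x j).
- rewrite exprS -mulrA ler_pM2l//.
  have wb' : w (s * b) <= a ^+ k * W (x j) by rewrite wM ws.
  rewrite weightB_le// weightB_le//; first by rewrite wM ws mulrC.
  by rewrite wM weightX wq ws mulrC.
- rewrite exprS -mulrA; apply: weightD_lt; last first.
    rewrite wM; apply: (@le_lt_trans _ _ (w (u - 1) * (a * (a ^+ k * W (x j))))).
      by rewrite ler_wpM2l// mulrA -exprS.
    by rewrite gtr_pMl// mulr_gt0.
  by apply: weightB_lt; rewrite wM ws ?(mulrC _ a) ltr_pM2l.
- rewrite cE mulrBl mul1r [RHS]addrA exprSr -mulr_comm3 -zE -/c.
  by rewrite addrC subrK.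
Qed.

Let By i : in_group_span x (y i).
Proof.
case: i => [[[j tj] k]|]; rewrite /y/=; last first.
  by apply: in_group_spanX; apply: in_group_span_gen.
elim: (nat_of_ord k) => [|m IHm] /=; first exact: in_group_span_gen.
by apply: in_group_spanR => //; apply: in_group_span_gen.
Qed.

Let Bsub f : group_span y f -> group_span x f.
Proof. by move=> Bf; exact: group_span_sub By Bf. Qed.

Let wz_le i : w (mu (y i) - 1) <= nu i.
Proof. by rewrite -WE; exact: schreier_le. Qed.

Let aug_free_split (h0 : A) (h : {j | j != t} -> A) v :
  group_span x h0 -> (forall u, group_span x (h u)) ->
  w (s * h0 + \sum_u (mu (x (val u)) - 1) * h u) < v ->
  forall u, W (x (val u)) * w (h u) < v.
Proof.
move=> Bh0 Bh lt_v u; pose H j := if insub j is Some u then h u else h0.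
have BH j : group_span x (H j) by rewrite /H; case: insubP.
have HE : \sum_j (mu (x j) - 1) * H j =
    s * h0 + \sum_u (mu (x (val u)) - 1) * h u.
  rewrite (bigD1 t)//= {1}/H insubF ?eqxx//; congr (_ + _).
  rewrite (reindex_omap (val : {j | j != t} -> J) insub)/=; last first.
    by move=> j tj; rewrite insubT.
  apply: eq_big => [[j tj]|[j tj] _] /=; first by rewrite insubT tj/= eqxx.
  by rewrite /H insubT.
have := free_x BH (val u); rewrite HE /H valK => le_v.
exact: le_lt_trans le_v lt_v.
Qed.

(* That the powers of [s] are independent over the group ring of the [y i], and
   that the [y i - 1] are independent, are proved together by downward induction
   on the weight [v]: dividing a relation by [s] or by some [x j - 1] raises its
   weight. *)
Let span_stable_lt v := forall g : nat -> A, (forall k, group_span y (g k)) ->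
  w (\sum_(k < p) s ^+ k * g k) < v -> forall k, (k < p)%N -> a ^+ k * w (g k) < v.

Let split_family (f : schreier_index p t -> A) :
  \sum_i (mu (y i) - 1) * f i =
  s ^+ p * f None +
  \sum_(u : {j | j != t}) \sum_(k < p) (mu (y (Some (u, k))) - 1) * f (Some (u, k)).
Proof.
rewrite (bigD1 None)//= zNone; congr (_ + _).
rewrite (reindex_omap (fun i : {j | j != t} * 'I_p => Some i) id)/=; last by case.
rewrite (pair_bigA _ (fun u k => (mu (y (Some (u, k))) - 1) * f (Some (u, k))))/=.
by apply: eq_big => [i|[u k] _] //; rewrite eqxx.
Qed.

(** Each y (u, k) - 1 is (x u - 1) s^k + s b + e by [iter_comm], and the errors e contribute less
    than m. Freeness of [x] then bounds the sum of the s^k f (u, k) by m / W (x u), and stability at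
    this larger weight bounds every f (u, k). What remains is s g. *)
Let core m (f : schreier_index p t -> A) (g : A) :
  0 < m -> (forall i, group_span y (f i)) -> group_span x g ->
  (forall u k, nu (Some (u, k)) * w (f (Some (u, k))) <= m) ->
  (forall u : {j | j != t}, span_stable_lt (m / W (x (val u)))) ->
  w (s * g + \sum_(u : {j | j != t}) \sum_(k < p)
       (mu (y (Some (u, k))) - 1) * f (Some (u, k))) < m ->
  (forall u k, nu (Some (u, k)) * w (f (Some (u, k))) < m) /\ w (s * g) < m.
Proof.
move=> m0 Bf Bg le_m stab lt_m.
have [b bP] : exists b : {j | j != t} -> 'I_p -> A, forall u k, exists e,
    [/\ group_span x (b u k), w e < nu (Some (u, k)) & mu (y (Some (u, k))) - 1 =
      (mu (x (val u)) - 1) * s ^+ k + s * b u k + e].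
  have /choice[b bP] : forall uk : {j | j != t} * 'I_p, exists b, exists e,
      [/\ group_span x b, w e < nu (Some uk) & mu (y (Some uk)) - 1 =
        (mu (x (val uk.1)) - 1) * s ^+ uk.2 + s * b + e].
    case=> -[j tj] k; have [b [e [Bb _ we eE]]] := iter_comm k tj.
    by exists b, e; split.
  by exists (fun u k => b (u, k)) => u k; exact: (bP (u, k)).
have /choice[e eP] : forall uk : {j | j != t} * 'I_p, exists e,
    [/\ group_span x (b uk.1 uk.2), w e < nu (Some uk) & mu (y (Some uk)) - 1 =
      (mu (x (val uk.1)) - 1) * s ^+ uk.2 + s * b uk.1 uk.2 + e].
  by case=> u k; exact: bP.
pose h0 := g + \sum_u \sum_k b u k * f (Some (u, k)).
pose h u := \sum_(k < p) s ^+ k * f (Some (u, k)).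
have SE : s * g + \sum_(u : {j | j != t}) \sum_(k < p)
       (mu (y (Some (u, k))) - 1) * f (Some (u, k)) =
    (s * h0 + \sum_u (mu (x (val u)) - 1) * h u) +
    \sum_u \sum_k e (u, k) * f (Some (u, k)).
  rewrite mulrDr -!addrA; congr (_ + _); rewrite addrA mulr_sumr -!big_split/=.
  apply: eq_bigr => u _; rewrite mulr_sumr /h mulr_sumr -!big_split/=.
  apply: eq_bigr => k _; have [_ _ ->] := eP (u, k).
  exact: (mulr_expand3 _ (b u k) _ s (s ^+ k)).
have err : w (\sum_u \sum_k e (u, k) * f (Some (u, k))) < m.
  apply: weight_sum_lt => // u _; apply: weight_sum_lt => // k _; rewrite wM.
  have [->|f0] := eqVneq (w (f (Some (u, k)))) 0; first by rewrite mulr0.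
  have f_gt0 : 0 < w (f (Some (u, k))) by rewrite lt_neqAle eq_sym f0 w_ge0.
  apply: lt_le_trans (le_m u k); rewrite ltr_pM2r//.
  by have [] := eP (u, k).
have lt_h : forall u, W (x (val u)) * w (h u) < m.
  apply: (aug_free_split (h0 := h0)).
  - apply: group_spanD => //; apply: group_span_sum => u; apply: group_span_sum => k.
    by apply: group_spanM; [case: (eP (u, k))|exact: Bsub].
  - by move=> u; apply: group_span_sum => k; apply: group_spanM => //; exact: Bsub.
  - by have := weightB_lt lt_m err; rewrite SE addrK.
have lt_f u k : nu (Some (u, k)) * w (f (Some (u, k))) < m.
  have Wu := x_gt0 (val u).
  (* [span_stable_lt] speaks of families indexed by [nat]: extension by 0. *)
  pose F n := if (insub n : option 'I_p) is Some i then f (Some (u, i)) else 0.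
  have BF n : group_span y (F n).
    by rewrite /F; case: insubP => // _; exact: group_span0.
  have := stab u F BF.
    rewrite (eq_bigr (fun i : 'I_p => s ^+ i * f (Some (u, i)))); last first.
    by move=> i _; rewrite /F valK.
  rewrite ltr_pdivlMr// mulrC => /(_ (lt_h u) k (ltn_ord k)).
  by rewrite /F valK ltr_pdivlMr// /nu/= mulrAC.
split=> //.
rewrite -(addrK (\sum_(u : {j | j != t}) \sum_(k < p)
       (mu (y (Some (u, k))) - 1) * f (Some (u, k))) (s * g)).
apply: weightB_lt lt_m _; apply: weight_sum_lt => // u _.
apply: weight_sum_lt => // k _; rewrite wM; apply: le_lt_trans (lt_f u k).
exact: ler_wpM2r.
Qed.

(** Stated with the expected weights [nu]; that these are the actual ones is deduced from it in
    [schreier_family_weight]. *)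
Let family_stable_lt v := forall f : schreier_index p t -> A,
  (forall i, group_span y (f i)) ->
  w (\sum_i (mu (y i) - 1) * f i) < v -> forall i, nu i * w (f i) < v.

Section Induction.
Variable r : R.
Hypotheses (r0 : 0 < r) (r_ge : forall j, W (x j) <= r).

(** Stage n of the induction covers the weights above r^n; division by one generator goes back one
    stage. *)
Let div_gt n m j : r ^+ n.+1 < m -> r ^+ n < m / W (x j).
Proof.
move=> lt_m; rewrite ltr_pdivlMr//; apply: le_lt_trans lt_m.
by rewrite exprSr ler_wpM2l ?exprn_ge0// ltW.
Qed.

(** Otherwise the maximal term m is at least v, and [core], with s^p f None as its term s g, shows
    that every term is less than m. *)
Let family_step n :
  (forall v, r ^+ n < v -> span_stable_lt v) ->
  forall v, r ^+ n.+1 < v -> family_stable_lt v.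
Proof.
move=> stab v lt_v f Bf lt_f i.
case: (@arg_maxP _ _ _ None xpredT (fun i => nu i * w (f i))) => // i0 _ i0_max.
apply: le_lt_trans (i0_max i isT) _; rewrite ltNge; apply/negP => le_v.
set m := nu i0 * w (f i0) in i0_max le_v.
have lt_m := lt_le_trans lt_v le_v.
have m0 : 0 < m by apply: le_lt_trans lt_m; rewrite exprn_ge0// ltW.
have pS : p = p.-1.+1 by rewrite prednK ?prime_gt0.
have sE : s ^+ p * f None = s * (s ^+ p.-1 * f None) by rewrite {1}pS exprS mulrA.
have [||||lt1 lt2] := @core m f (s ^+ p.-1 * f None) m0 Bf.
- by apply: group_spanM => //; exact: Bsub.
- by move=> u k; exact: i0_max.
- by move=> u; apply: stab; exact: div_gt.
- by rewrite -sE -split_family; exact: lt_le_trans le_v.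
have : nu i0 * w (f i0) < m; last by rewrite ltxx.
case: (i0) => [[u k]|]; first exact: lt1.
by move: lt2; rewrite -sE wM weightX ws.
Qed.

(** By [group_span_repr], g 0 is a constant, which must vanish, plus a combination of the y i - 1.
    Its term s^p f None and the s^k g k with k > 0 are divisible by s; the quotient is a sum of the
    same kind, shifted by one and with f None in the last place. The bound m becomes m / a, which
    belongs to the previous stage. *)
Let span_step n :
  (forall v, r ^+ n < v -> span_stable_lt v) ->
  (forall v, r ^+ n.+1 < v -> family_stable_lt v) ->
  forall v, r ^+ n.+1 < v -> span_stable_lt v.
Proof.
move=> stab fam v lt_v g Bg lt_g k kp.
have p_gt0 := prime_gt0 p_pr.
case: (@arg_maxP _ _ _ (Ordinal p_gt0) xpredT (fun i : 'I_p => a ^+ i * w (g i)))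
  => // k0 _ k0_max.
apply: le_lt_trans (k0_max (Ordinal kp) isT) _; rewrite ltNge; apply/negP => le_v.
set m := a ^+ k0 * w (g k0) in k0_max le_v.
have lt_m := lt_le_trans lt_v le_v.
have m0 : 0 < m by apply: le_lt_trans lt_m; rewrite exprn_ge0// ltW.
have m1 : m <= 1.
  apply: mulr_ile1 => //; first exact/exprn_ge0/ltW.
  by rewrite exprn_ile1 ?(ltW a_gt0)// ltW// (gval_lt1 hW).
have lt_gm := lt_le_trans lt_g le_v.
have pS : p = p.-1.+1 by rewrite prednK.
pose g' := \sum_(k < p.-1) s ^+ k * g k.+1.
have gE : \sum_(k < p) s ^+ k * g k = g 0%N + s * g'.
  rewrite (big_ord_predl (fun k => s ^+ k * g k))// expr0 mul1r; congr (_ + _).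
  by rewrite mulr_sumr; apply: eq_bigr => i _; rewrite exprS mulrA.
have [n' [f [Bf g0E]]] := group_span_repr (Bg 0%N).
have w_a1 : a < 1 by exact: (gval_lt1 hW).
(* A nonzero constant would have weight 1, while the whole sum and all other terms have weight below
   1. *)
have [n0|n1] := weight_nat n'; last first.
  have : w (n'%:R : A) < 1; last by rewrite n1 ltxx.
  have -> : n'%:R = (\sum_(k < p) s ^+ k * g k) -
      (\sum_i (mu (y i) - 1) * f i + s * g').
    by apply/esym/eqP; rewrite subr_eq gE g0E addrA.
  apply: weightB_lt; first exact: lt_le_trans m1.
  apply: weightD_lt; last first.
    by rewrite wM ws (le_lt_trans _ w_a1)// ler_piMr// ltW.
  apply: weight_sum_lt => // i _; rewrite wM -WE.
  by apply: le_lt_trans (gval_lt1 hW (y i)); rewrite ler_piMr// (gval_ge0 hW).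
rewrite n0 add0r in g0E.
have wg0 : w (g 0%N) <= m.
  by have := k0_max (Ordinal p_gt0) isT; rewrite /= expr0 mul1r.
(* Stability at the weight of a term above m would make this term smaller than itself. *)
have le_f i : nu i * w (f i) <= m.
  rewrite leNgt; apply/negP => lt_f.
  have := fam _ (lt_trans lt_m lt_f) f Bf; rewrite -g0E.
  by move=> /(_ (le_lt_trans wg0 lt_f) i); rewrite ltxx.
have sE : s ^+ p * f None = s * (s ^+ p.-1 * f None) by rewrite {1}pS exprS mulrA.
have [||||lt1 lt2] := @core m f (s ^+ p.-1 * f None + g') m0 Bf.
- apply: group_spanD; first by apply: group_spanM => //; exact: Bsub.
  by apply: group_span_sum => i; apply: group_spanM => //; exact: Bsub.
- by move=> u i; exact: le_f.
- by move=> u; apply: stab; exact: div_gt.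
- rewrite mulrDr -sE addrAC -split_family -g0E -gE.
  exact: lt_gm.
pose g'' k := if (k < p.-1)%N then g k.+1 else f None.
have Bg'' i : group_span y (g'' i) by rewrite /g''; case: ifP.
have g''E : \sum_(k < p) s ^+ k * g'' k = s ^+ p.-1 * f None + g'.
  rewrite (big_ord_predr (fun k => s ^+ k * g'' k))// /g'' ltnn addrC.
  congr (_ + _).
  by apply: eq_bigr => i _; rewrite ltn_ord.
have lt'' i : (i < p)%N -> a ^+ i.+1 * w (g'' i) < m.
  move=> ip; rewrite exprS -mulrA mulrC -ltr_pdivlMr//.
  apply: (stab (m / a) _ g'') => //; first exact: div_gt.
  by rewrite g''E ltr_pdivlMr// mulrC -ws -wM.
have lt_None : nu None * w (f None) < m.
  have := lt'' p.-1; rewrite -pS leqnn => /(_ isT).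
  by rewrite /g'' ltnn.
have : w (g 0%N) < m.
  rewrite g0E; apply: weight_sum_lt => // i _; rewrite wM.
  apply: (@le_lt_trans _ _ (nu i * w (f i))); first exact: ler_wpM2r.
  by case: i => [[u i]|]; [exact: lt1|exact: lt_None].
move=> wg0m; have lt_i i : (i < p)%N -> a ^+ i * w (g i) < m.
  case: i => [|i] ip; first by rewrite expr0 mul1r.
  have := lt'' i (ltnW ip); rewrite /g''.
  by rewrite -ltnS -pS ip.
by have := lt_i k0 (ltn_ord k0); rewrite ltxx.
Qed.

Lemma schreier_stable_lt n :
  (forall v, r ^+ n < v -> span_stable_lt v) /\
  (forall v, r ^+ n < v -> family_stable_lt v).
Proof.
elim: n => [|n [stab _]].
  have aX k : a ^+ k <= 1 by rewrite exprn_ile1 ?(ltW a_gt0)// ltW// (gval_lt1 hW).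
  rewrite expr0; split=> [v v1 g _ _ k _|v v1 f _ _ i]; apply: le_lt_trans v1.
    by apply: mulr_ile1 => //; exact/exprn_ge0/ltW.
  apply: mulr_ile1 => //; first exact: ltW.
  case: i => [[j k]|]; rewrite /nu/= ?aX//.
  apply: mulr_ile1; rewrite ?(gval_ge0 hW) ?exprn_ge0 ?aX ?(ltW a_gt0)//.
  exact: ltW (gval_lt1 hW _).
have fam := family_step stab.
by split=> //; exact: span_step.
Qed.

End Induction.

Let schreier_family_stable v : 0 < v -> family_stable_lt v.
Proof.
move=> v0; case: (@arg_maxP _ _ _ t xpredT (W \o x)) => // j0 _ j0_max.
have r1 : `|W (x j0)| < 1 by rewrite ger0_norm ?(gval_ge0 hW) ?(gval_lt1 hW).
have [n lt_n] : exists n, W (x j0) ^+ n < v.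
  have /cvgrPdist_lt/(_ v v0)[n _ /(_ n (leqnn n))] := cvg_expr r1.
  rewrite sub0r normrN ger0_norm ?exprn_ge0 ?(gval_ge0 hW)// => lt_n.
  by exists n.
have [_] := schreier_stable_lt (x_gt0 j0) (fun j => j0_max j isT) n.
exact.
Qed.

(** A smaller weight contradicts stability for the coefficients 1 at i and 0 elsewhere. *)
Lemma schreier_family_weight i : W (y i) = nu i.
Proof.
apply/eqP; rewrite eq_le schreier_le//= leNgt; apply/negP => lt_i.
pose f k := if k == i then 1 else 0 : A.
have Bf k : group_span y (f k).
  by rewrite /f; case: eqP => _; [exact: group_span1|exact: group_span0].
have := schreier_family_stable (nu_gt0 i) Bf.
rewrite (bigD1 i)//= /f eqxx mulr1 big1 ?addr0; last first.
  by move=> k /negbTE ->; rewrite mulr0.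
by rewrite -WE => /(_ lt_i i); rewrite eqxx w1 mulr1 ltxx.
Qed.

Lemma aug_free_schreier : aug_free y.
Proof.
move=> f Bf i; rewrite schreier_family_weight leNgt; apply/negP => lt_i.
have := schreier_family_stable (le_lt_trans (w_ge0 _) lt_i) Bf lt_i i.
by rewrite ltxx.
Qed.

End Schreier.

(** * Images of free families are tight; descent along a chain *)

Section Augmentation.
Variables (aug : A -> 'F_p).
Hypothesis augD : forall f g, aug (f + g) = aug f + aug g.
Hypothesis augM : forall f g, aug (f * g) = aug f * aug g.
Hypothesis aug1 : aug 1 = 1.
Hypothesis aug_lt1 : forall f, w f < 1 -> aug f = 0.
Variables (gT : finGroupType) (wt : gT -> R) (phi : G -> gT) (eps : R).
Hypotheses (hwt : group_valuation p wt) (pG : (p.-group [set: gT])%g).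
Hypothesis phiM : forall g h, phi (g * h)%g = (phi g * phi h)%g.
Hypothesis wtE : forall g, wt (phi g) = if eps <= W g then W g else 0.

Section ExponentSums.
Import boot.ssrbool boot.fintype boot.finset.
Variables (J : finType) (x : J -> G).
Hypothesis free_x : aug_free x.
Hypothesis x_gt0 : forall j, 0 < W (x j).

(* [c j] is the exponent sum of [x j] in [g], modulo p. *)
Definition exponent_sums (g : G) (c : J -> 'F_p) : Prop :=
  group_span x (mu g) /\
  exists2 f : J -> A, (forall j, group_span x (f j) /\ aug (f j) = c j) &
    mu g - 1 = \sum_j (mu (x j) - 1) * f j.

Lemma exponent_sums1 : exponent_sums 1%g (fun=> 0).
Proof.
split; first by rewrite mu1; exact: group_span1.
exists (fun=> 0); last by rewrite mu1 subrr big1// => j _; rewrite mulr0.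
by move=> j; split; [exact: group_span0|rewrite aug_lt1// weight0].
Qed.

Lemma exponent_sums_mul g h c d : exponent_sums g c -> exponent_sums h d ->
  exponent_sums (g * h)%g (fun j => c j + d j).
Proof.
move=> [Bg [f fP gE]] [Bh [k kP hE]]; split.
  by rewrite muM; exact: group_spanM.
exists (fun j => f j * mu h + k j) => [j|].
  have [[Bf fc] [Bk kd]] := (fP j, kP j); split.
    by apply: group_spanD => //; exact: group_spanM.
  rewrite augD augM fc kd.
  have h0 : aug (mu h - 1) = 0 by apply: aug_lt1; rewrite -WE (gval_lt1 hW).
  by rewrite -(subrK 1 (mu h)) augD h0 add0r aug1 mulr1.
rewrite (eq_bigr (fun j => (mu (x j) - 1) * f j * mu h + (mu (x j) - 1) * k j)).
  by rewrite big_split/= -mulr_suml -gE -hE muM mulrBl mul1r addrA subrK.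
by move=> j _; rewrite mulrDr mulrA.
Qed.

Lemma exponent_sums_gen i : exponent_sums (x i) (fun j => (j == i)%:R).
Proof.
split; first by case: (in_group_span_gen x i).
exists (fun j => if j == i then 1 else 0) => [j|].
  case: eqP => _; first by split; [exact: group_span1|].
  by split; [exact: group_span0|rewrite aug_lt1// weight0].
by rewrite (bigD1 i)//= eqxx mulr1 big1 ?addr0// => j /negbTE ->; rewrite mulr0.
Qed.

(** By freeness the coefficient of x j - 1 then has weight below 1, hence augmentation 0. *)
Lemma exponent_sums_lt g c j : exponent_sums g c -> W g < W (x j) -> c j = 0.
Proof.
move=> [Bg [f fP gE]] lt_g; have [_ <-] := fP j; apply: aug_lt1.
have Bf i : group_span x (f i) by case: (fP i).
have := free_x Bf j; rewrite -gE -WE => /le_lt_trans/(_ lt_g).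
by rewrite gtr_pMr.
Qed.

Variable U : {group gT}.
Hypothesis genU : <<[set phi (x j) | j : J]>>%g = U.

Let phi1 : phi 1%g = 1%g.
Proof. exact: mulmap1 phiM. Qed.

Let phiX := mulmapX phiM.

Lemma exponent_sums_lift u : u \in U ->
  exists g c, phi g = u /\ exponent_sums g c.
Proof.
rewrite -genU => /gen_prodgP[n [f fP ->]]; elim/big_ind: _ => [|v v'|i _].
- by exists 1%g, (fun=> 0); split=> //; exact: exponent_sums1.
- move=> [g [c [<- gc]]] [h [d [<- hd]]]; exists (g * h)%g, (fun j => c j + d j).
  by split; [exact: phiM|exact: exponent_sums_mul].
have /imsetP[j _ ->] := fP i.
by exists (x j), (fun i => (i == j)%:R); split=> //; exact: exponent_sums_gen.
Qed.

Let visible s : pred J := [pred j | s < wt (phi (x j))].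

Let exponent_sums_visible g c s j : 0 <= s -> exponent_sums g c ->
  wt (phi g) <= s -> visible s j -> c j = 0.
Proof.
move=> s0 gc gs sj; apply: (exponent_sums_lt gc).
have := sj; rewrite /visible/= wtE; case: ifP => [exj sxj|]; last by rewrite ltNge s0.
move: gs; rewrite wtE; case: ifP => [_ /le_lt_trans|/negbT]; first exact.
by rewrite -ltNge => /lt_le_trans + _; apply.
Qed.

(** Both g and h are multiplied by a power of h whose image inverts [phi h]. The products have
    trivial image, so their visible exponent sums vanish. *)
Let exponent_sums_fun g h c d s j : 0 <= s -> exponent_sums g c ->
  exponent_sums h d -> phi g = phi h -> visible s j -> c j = d j.
Proof.
move=> s0 gc hd gh sj.
have hX n : exists e, exponent_sums (h ^+ n)%g e.
  elim: n => [|n [e he]]; first by exists (fun=> 0); rewrite expg0; exact: exponent_sums1.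
  by exists (fun j => d j + e j); rewrite expgS; exact: exponent_sums_mul.
have [e he] := hX #[phi h].-1%g.
have inv : (phi h * phi (h ^+ #[phi h].-1) = 1)%g.
  by rewrite phiX -expgS prednK ?order_gt0// expg_order.
have zero g' c' : exponent_sums g' c' -> phi g' = phi h -> c' j + e j = 0.
  move=> gc' gh'; apply: (exponent_sums_visible s0 (exponent_sums_mul gc' he)) => //.
  by rewrite phiM gh' inv (gval1 hwt).
by apply: (addIr (e j)); rewrite (zero g)// (zero h).
Qed.

(** The exponent sums at the n generators of weight above s define a homomorphism from [U] onto
    F_p^n. Its kernel contains [Phi_level wt U s], whose index is therefore at least p^n. *)
Lemma aug_free_tight : tight p wt U (phi \o x).
Proof.
split=> // s s0.
have /choice[c cP] : forall u, exists c : J -> 'F_p, u \in U ->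
    exists2 g, phi g = u & exponent_sums g c.
  move=> u; have [/exponent_sums_lift[g [c [gu gc]]]|_] := boolP (u \in U).
    by exists c => _; exists g.
  by exists (fun=> 0).
set P := [pred j | _]; pose n := #|P|.
pose f u : 'rV['F_p]_n := \row_i c u (enum_val i).
have fM : {in U &, {morph f : u v / (u * v)%g}}.
  move=> u v Uu Uv; apply/rowP => i; rewrite !mxE.
  have [g gu gc] := cP u Uu; have [h hv hd] := cP v Uv.
  have [k kuv kc] := cP (u * v)%g (groupM Uu Uv).
  apply: (exponent_sums_fun s0 kc (exponent_sums_mul gc hd)).
    by rewrite kuv phiM gu hv.
  by have := enum_valP i.
pose F := Morphism fM.
have Fgen (i : 'I_n) : F (phi (x (enum_val i))) = delta_mx 0 i.
  have Ux j : phi (x j) \in U by rewrite -genU mem_gen ?imset_f.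
  apply/rowP => k; rewrite !mxE eqxx/=.
  have [g gx gc] := cP _ (Ux (enum_val i)).
  have -> := exponent_sums_fun s0 gc (exponent_sums_gen (enum_val i)) gx (enum_valP k).
  by rewrite (inj_eq enum_val_inj).
have Fsurj : (F @* U)%g = [set: 'rV['F_p]_n].
  apply/eqP; rewrite eqEsubset subsetT; apply/subsetP => v _.
  rewrite (row_sum_delta v).
  elim/big_ind: _ => [|a b aF bF|i _]; first exact: (group1 (F @* U)%G).
    exact: (groupM (G := (F @* U)%G)) aF bF.
  rewrite -Fgen -[v 0 i]natr_Zp scaler_nat -FinRing.zmodXgE.
  by rewrite groupX// mem_morphim// -genU mem_gen ?imset_f.
have in_ker u : u \in U -> (forall i : 'I_n, c u (enum_val i) = 0) -> u \in ('ker F)%g.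
  move=> Uu c0; apply/kerP => //; apply/rowP => i; rewrite !mxE.
  exact: c0.
have Dker : Phi_level wt U s \subset ('ker F)%g.
  apply/joing_subP; split; last first.
    apply/subsetP => u; rewrite (in_level hwt)// => /andP[Uu us].
    apply: in_ker => // i; have [g gu gc] := cP u Uu.
    apply: (exponent_sums_visible s0 gc); first by rewrite gu.
    by have := enum_valP i.
  have pU : (p.-group U)%g by apply: pgroupS pG; apply: subsetT.
  rewrite (Phi_joing pU) (MhoE 1 pU) derg1.
  apply/joing_subP; split; rewrite gen_subG; apply/subsetP => u.
    case/imset2P => v v' Uv Uv' ->; apply/kerP; first exact: groupR.
    by rewrite morphR//; apply/eqP/commgP; exact: FinRing.zmod_mulgC.
  case/imsetP => v Uv ->; apply/kerP; first exact: groupX.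
  rewrite morphX// FinRing.zmodXgE expn1; apply/rowP => i; rewrite mulmxnE !mxE.
  by rewrite -mulr_natr pchar_Fp_0// mulr0.
have : #|(F @* U)%g| = (p ^ n)%N.
  by rewrite Fsurj cardsT card_mx card_Fp// mul1n.
rewrite card_morphim setIid => cE.
have KU : ('ker F)%g \subset U by exact: subsetIl.
rewrite /Phi_index.
rewrite (logn_indexM p (K := Phi_level_group wt U s) Dker KU).
by rewrite cE pfactorK// leq_addr.
Qed.

End ExponentSums.

Section FreeChain.
Import boot.ssrbool boot.fintype boot.finset.

(** The members stay in [G], where freeness makes sense; only their images have to generate [U]. *)
Definition free_family (U : {group gT}) J (x : J -> G) : Prop :=
  [/\ <<[set phi (x j) | j : J]>>%g = U, forall j, 0 < W (x j) & aug_free x].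

Lemma free_family_tight (U : {group gT}) J (x : J -> G) :
  free_family U x -> tight p wt U (phi \o x).
Proof. by case=> genU x0 free_x; exact: aug_free_tight. Qed.

Definition weight_sum (theta : R) J (x : J -> G) : R :=
  \sum_(j | theta <= W (x j)) W (x j).

Let phiX := mulmapX phiM.

Let phi_normalized J (x : J -> G) t a j :
  phi (normalized_family x t a j) = normalized_family (phi \o x) t a j.
Proof. by rewrite /normalized_family; case: eqP => // _; rewrite phiM phiX. Qed.

Let phi_schreier J (x : J -> G) t (i : schreier_index p t) :
  phi (schreier_family x i) = schreier_family (phi \o x) i.
Proof.
case: i => [[[j tj] k]|] /=; last exact: phiX.
elim: (nat_of_ord k) => [//|m IHm] /=.
by rewrite (mulmapR phiM) IHm.
Qed.

Let wt_neq1 g : phi g != 1%g -> wt (phi g) = W g.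
Proof.
rewrite wtE; case: ifP => // exg /eqP[]; apply: (gval_eq0 hwt).
by rewrite wtE exg.
Qed.

(** The entries k = 0 of the new family keep all generators but t, whence the first estimate. If
    theta <= W (x j), all a^k W (x j) pass the threshold theta', and so does a^p if theta <= a,
    whence the second. *)
Lemma free_family_step (U V : {group gT}) a J (x : J -> G) :
  free_family U x -> maximal V U -> min_outside wt U V a ->
  exists (K : finType) (y : K -> G),
    [/\ free_family V y,
        forall theta, weight_sum theta x - a <= weight_sum theta y &
        forall theta theta', theta' <= theta * a ^+ p.-1 ->
          schreier_factor p a * (weight_sum theta x - 1) <=
          weight_sum theta' y - 1].
Proof.
move=> free_x maxV mina; have [genU x0 fx] := free_x.
have [t Vt wa] := tight_min_outside hwt pG (free_family_tight free_x) maxV mina.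
have xU j : (phi \o x) j \in U by rewrite -genU mem_gen//= (imset_f (phi \o x)).
have notV1 j : phi (x j) \notin V -> phi (x j) != 1%g.
  by apply: contraNneq => ->; rewrite group1.
have Wta : W (x t) = a by rewrite -wa /= wt_neq1// notV1.
have [e eP] := normalize_into_maximal pG maxV xU Vt.
have e_le j : j != t -> e j != 0%N -> W (x t) <= W (x j).
  move=> tj ej; have Vj : phi (x j) \notin V.
    by apply: contra_neqN ej => Vj; case: (eP j) => _; apply.
  rewrite Wta -(wt_neq1 (notV1 j Vj)); case: mina => _; apply.
  by rewrite inE Vj; exact: xU.
pose x' := normalized_family x t e.
have Wx' j : W (x' j) = W (x j) by exact: normalized_weight.
have x'0 j : 0 < W (x' j) by rewrite Wx'.
have fx' : aug_free x' by exact: aug_free_normalized.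
pose y (i : schreier_index p t) := schreier_family x' i.
have Wy i : W (y i) = schreier_weight (W \o x) i.
  rewrite schreier_family_weight//; case: i => [[j k]|]; rewrite /schreier_weight/=.
    by rewrite !Wx'.
  by rewrite Wx'.
have genV : <<[set phi (y i) | i : schreier_index p t]>>%g = V.
  have := @schreier_gen p gT p_pr pG U V J (normalized_family (phi \o x) t e) t.
  rewrite normalized_gen {1 2}/normalized_family eqxx => /(_ genU maxV Vt) <-.
    congr (<<_>>)%g; apply: eq_imset => i; rewrite phi_schreier.
    case: i => [[[j tj] k]|] /=; last by rewrite phi_normalized.
    have E l : phi (x' l) = normalized_family (phi \o x) t e l.
      exact: phi_normalized.
    by elim: (nat_of_ord k) => [|m IHm] /=; rewrite ?E ?IHm.
  by move=> j tj; rewrite /normalized_family (negbTE tj); case: (eP j) => /(_ tj).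
have a0 : 0 < a by rewrite -Wta.
have y0 i : 0 < W (y i).
  by rewrite Wy; case: i => [[j k]|]; rewrite /= ?mulr_gt0 ?exprn_gt0// x0.
have p_gt0 := prime_gt0 p_pr.
pose T theta j := \sum_(k < p | theta <= a ^+ k * W (x j)) a ^+ k * W (x j).
have ySE theta : weight_sum theta y =
    (if theta <= a ^+ p then a ^+ p else 0) + \sum_(j | j != t) T theta j.
  rewrite /weight_sum (eq_bigl _ _ (fun i => congr1 (>= theta) (Wy i))).
  under eq_bigr do rewrite Wy.
  by rewrite (@sum_schreier_weight R p J t (W \o x) (>= theta))/= Wta.
have xSE theta : weight_sum theta x = (if theta <= a then a else 0) +
    \sum_(j | j != t) (if theta <= W (x j) then W (x j) else 0).
  by rewrite /weight_sum big_mkcond/= (bigD1 t)//= Wta.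
have term0 k j : 0 <= a ^+ k * W (x j) by rewrite mulr_ge0 ?exprn_ge0// ltW.
exists (schreier_index p t), y; split.
- by split=> //; exact: aug_free_schreier.
- move=> theta; rewrite ySE xSE addrAC -[leLHS]addrC [leRHS]addrC lerD//.
    apply: ler_sum => j _; rewrite /T; case: ifP => [le_x|_]; last by rewrite sumr_ge0.
    rewrite (bigD1 (Ordinal p_gt0))/= ?expr0 ?mul1r// lerDl sumr_ge0//.
  apply: (@le_trans _ _ 0); last by case: ifP => // _; rewrite exprn_ge0// ltW.
  by rewrite subr_le0; case: ifP => _ //; rewrite ltW.
move=> theta theta' le_theta; rewrite ySE xSE.
set N := schreier_factor p a; have N1 : 1 <= N by rewrite schreier_factor_ge1// ltW.
set S := \sum_(j | j != t) (if theta <= _ then _ else _).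
have le_S : N * S <= \sum_(j | j != t) T theta' j.
  rewrite mulr_sumr; apply: ler_sum => j _; rewrite /T; case: ifP => [le_x|_]; last first.
    by rewrite mulr0 sumr_ge0.
  rewrite /N /schreier_factor mulr_suml [leRHS]big_mkcond/=; apply: ler_sum => k _.
  rewrite ifT//; apply: le_trans le_theta _.
  apply: (@le_trans _ _ (a ^+ p.-1 * W (x j))).
    by rewrite mulrC ler_wpM2l// exprn_ge0// ltW.
  rewrite ler_wpM2r ?(ltW (x0 j))// ler_wiXn2l ?(ltW a0)//.
    by rewrite ltW// -Wta (gval_lt1 hW).
  by rewrite -ltnS (prednK p_gt0) ltn_ord.
have NE := schreier_factor_mul p a; rewrite -/N in NE.
have ap0 : 0 <= a ^+ p by rewrite exprn_ge0// ltW.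
case: ifP => [le_a|_]; last first.
  apply: (@le_trans _ _ (\sum_(j | j != t) T theta' j - 1)); last first.
    by rewrite lerD2r lerDr; case: ifP.
  rewrite add0r mulrBr mulr1; lra.
rewrite ifT; first by lra.
apply: le_trans le_theta _; rewrite -[in leRHS](prednK p_gt0) exprS.
by rewrite ler_wpM2r// exprn_ge0// ltW.
Qed.

(** A heavy step costs a factor theta^(p-1) in the threshold, a light one its weight. Later factors
    multiply earlier losses, so the losses stand inside the product. *)
Lemma free_family_chain (theta : R) (U H : {group gT}) l J (x : J -> G) :
  0 < theta -> maximal_chain wt l U H -> free_family U x -> forall delta : R,
  0 <= delta -> exists (K : finType) (y : K -> G), free_family H y /\
    (\prod_(a <- l | (theta <= a)%R) schreier_factor p a) *
      (weight_sum delta x - 1 - \sum_(a <- l | (a < theta)%R) a) <=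
    weight_sum (delta * theta ^+ (p.-1 * count (>= theta) l)) y - 1.
Proof.
move=> theta0; elim: l U J x => [|a l IHl] U J x /=.
  move=> -> free_x delta _; exists J, x; split=> //.
  by rewrite !big_nil muln0 expr0 mulr1 mul1r subr0.
move=> [V [maxV mina lV]] free_x delta d0.
have [K [y [free_y ge_y1 ge_y2]]] := free_family_step free_x maxV mina.
rewrite !big_cons; set L := \sum_(_ <- _ | _) _; set P := \prod_(_ <- _ | _) _.
have l0 := maximal_chain_ge0 hwt lV.
have L0 : 0 <= L by rewrite /L big_seq_cond sumr_ge0// => b /andP[/(allP l0)].
have P1 : 1 <= P by exact: prod_schreier_factor_ge1.
have P0 : 0 <= P by exact: le_trans ler01 P1.
have [le_a|lt_a] := leP theta a; last first.
  have [K' [y' [free_y' le_y']]] := IHl V K y lV free_y delta d0.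
  exists K', y'; split=> //; rewrite add0n; apply: le_trans le_y'.
  rewrite ler_wpM2l//; have := ge_y1 delta; rewrite -/L; lra.
have a0 : 0 <= a by apply: le_trans le_a; exact: ltW.
have [K' [y' [free_y' le_y']]] :=
  IHl V K y lV free_y _ (mulr_ge0 d0 (exprn_ge0 p.-1 (ltW theta0))).
exists K', y'; split=> //.
rewrite mulnDr muln1 exprD mulrA; apply: le_trans le_y'.
rewrite mulrAC mulrC ler_wpM2l//.
have := @ge_y2 delta (delta * theta ^+ p.-1).
have -> : delta * theta ^+ p.-1 <= delta * a ^+ p.-1.
  by rewrite ler_wpM2l// lerXn2r// nnegrE// ltW.
move=> /(_ isT); have N1 := schreier_factor_ge1 p_pr a0.
(* The losses of the later steps may be multiplied by the current factor as well. *)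
have : L <= schreier_factor p a * L by rewrite ler_peMl.
rewrite -/L mulrBr; lra.
Qed.

End FreeChain.

End Augmentation.

End WeightedGroupRing.

(** * Finite quotients of a valued pro-p group *)

Section SubgroupSets.
Import Defs.
Variable G : groupType.
Implicit Types (A H K N : set G) (x y h : G).
Local Open Scope classical_set_scope.
Local Open Scope group_scope.

Lemma subgroup_gen_sub A H : is_subgroup H -> A `<=` H -> subgroup_gen A `<=` H.
Proof. by move=> hH AH x; apply; split. Qed.

Lemma subset_subgroup_gen A : A `<=` subgroup_gen A.
Proof. exact: sub_smallest. Qed.

Lemma subgroup_gen_subgroup A : is_subgroup (subgroup_gen A).
Proof.
split=> [K [[K1 _ _] _]|x y hx hy K KA|x hx K KA]; first exact: K1.
- by have [[_ KM _] _] := KA; apply: KM; [exact: hx|exact: hy].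
- by have [[_ _ KV] _] := KA; apply: KV; exact: hx.
Qed.

Lemma subgroup_genJ A h : (forall x, A x -> A (x ^ h)) ->
  forall x, subgroup_gen A x -> subgroup_gen A (x ^ h).
Proof.
move=> Ah; have [g1 gM gV] := subgroup_gen_subgroup A.
apply: (@subgroup_gen_sub A [set x | subgroup_gen A (x ^ h)]) => [|x Ax].
  by split=> [|x y /= gx gy|x /= gx]; rewrite /= ?conj1g// ?conjMg ?conjVg;
    [exact: gM|exact: gV].
by apply: subset_subgroup_gen; exact: Ah.
Qed.

Lemma set_mul_subgroup H K : is_subgroup H -> is_subgroup K ->
  (forall x h, K h -> H x -> H (x ^ h)) -> is_subgroup (set_mul H K).
Proof.
move=> [H1 HM HV] [K1 KM KV] nHK; split.
- by exists 1 => //; exists 1 => //; rewrite mulg1.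
- move=> _ _ [a Ha [b Kb <-]] [c Hc [d Kd <-]].
  exists (a * c ^ b^-1); first by apply: HM => //; apply: nHK => //; exact: KV.
  by exists (b * d); [exact: KM|rewrite conjgE invgK -!mulgA mulKg].
- move=> _ [a Ha [b Kb <-]]; exists (a^-1 ^ b); first by apply: nHK => //; exact: HV.
  by exists b^-1; [exact: KV|rewrite conjgE invgM -!mulgA mulgV mulg1].
Qed.

Lemma lcoset_eq N x y : is_subgroup N ->
  lcoset x N = lcoset y N <-> N (x^-1 * y).
Proof.
move=> [N1 NM NV]; split=> [xy|Nxy].
  have : lcoset y N y by exists 1 => //; rewrite mulg1.
  by rewrite -xy => -[n Nn <-]; rewrite mulKg.
apply/seteqP; split=> _ [n Nn <-].
  exists ((x^-1 * y)^-1 * n); first by apply: NM => //; exact: NV.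
  by rewrite invgM invgK !mulgA mulgV mul1g.
by exists (x^-1 * y * n); [exact: NM|rewrite !mulgA mulgV mul1g].
Qed.

Lemma set_mul_lcoset N x y : is_subgroup N ->
  (forall n, N n -> N (n ^ y)) -> (forall n, N n -> N (n ^ y^-1)) ->
  set_mul (lcoset x N) (lcoset y N) = lcoset (x * y) N.
Proof.
move=> [N1 NM NV] NJ NJV; apply/seteqP; split.
  move=> _ [_ [n Nn <-] [_ [m Nm <-] <-]]; exists (n ^ y * m).
    by apply: NM => //; exact: NJ.
  by rewrite conjgE !mulgA mulgK.
move=> _ [n Nn <-]; exists x; first by exists 1 => //; rewrite mulg1.
by exists (y * n); [exists n|rewrite mulgA].
Qed.

End SubgroupSets.

Section TopologicalGroup.
Variable G : topologicalGroupType.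
Implicit Types (H : set G) (x y : G).
Local Open Scope classical_set_scope.
Local Open Scope group_scope.

Lemma mulgl_continuous x : continuous (fun y : G => x * y).
Proof.
move=> y; apply: (@continuous2_cvg _ _ _ _ (nbhs y) _ _ _ (fun a b : G => a * b)).
- exact: (mulg_continuous (x, y)).
- exact: cvg_cst.
- exact: cvg_id.
Qed.

Lemma conjg_continuous x : continuous (fun y : G => y ^ x).
Proof.
move=> y; have -> : (fun y : G => y ^ x) = (fun y : G => x^-1 * (y * x)).
  by apply/funext => z; rewrite conjgE.
apply: (@continuous2_cvg _ _ _ _ (nbhs y) _ _ _ (fun a b : G => a * b)).
- exact: (mulg_continuous (x^-1, y * x)).
- exact: cvg_cst.
apply: (@continuous2_cvg _ _ _ _ (nbhs y) _ _ _ (fun a b : G => a * b)).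
- exact: (mulg_continuous (y, x)).
- exact: cvg_id.
- exact: cvg_cst.
Qed.

Lemma closure_stable (f : G -> G) H : continuous f ->
  (forall x, H x -> H (f x)) -> forall x, closure H x -> closure H (f x).
Proof.
move=> fc Hf x Hx U fU; have [y [Hy Uy]] := Hx _ (fc x U fU).
by exists (f y); split=> //; exact: Hf.
Qed.

Lemma closure_subgroup H : is_subgroup H -> is_subgroup (closure H).
Proof.
move=> [H1 HM HV]; split.
- exact: subset_closure.
- move=> x y Hx Hy U xyU.
  have [[A B] [/= xA yB] AB] := mulg_continuous (x, y) U xyU.
  have [a [Ha Aa]] := Hx _ xA; have [b [Hb Bb]] := Hy _ yB.
  by exists (a * b); split; [exact: HM|exact: (AB (a, b))].
- exact: closure_stable (@invg_continuous G) HV.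
Qed.

End TopologicalGroup.

Section FiniteQuotient.
Import boot.ssrbool boot.fintype boot.finset.
Variables (R : realType) (p : nat) (G : groupType) (W : G -> R) (eps : R).
Hypotheses (p_pr : prime p) (hW : group_valuation p W) (eps0 : 0 < eps).

(* [phi] is the projection onto G / G_{<eps} with the induced valuation. *)
Definition truncation (gT : finGroupType) (phi : G -> gT) (wt : gT -> R) : Prop :=
  [/\ forall g h, phi (g * h)%g = (phi g * phi h)%g,
      forall u, exists g, phi g = u,
      group_valuation p wt,
      (p.-group [set: gT])%g &
      forall g, wt (phi g) = if eps <= W g then W g else 0].

Variables (T : finType) (r : G -> T).
Hypothesis r_surj : forall u, exists g, r g = u.
Hypothesis rE : forall g h, r g = r h <-> W (g^-1 * h)%g < eps.

Let rep (u : T) : G := projT1 (cid (r_surj u)).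
Let repK u : r (rep u) = u.
Proof. exact: (projT2 (cid (r_surj u))). Qed.

Let r_mull g x y : r x = r y -> r (g * x)%g = r (g * y)%g.
Proof. by move=> /rE xy; apply/rE; rewrite invgM -mulgA mulKg. Qed.

(** The quotient is realized as the image of G in the permutations of the cosets, which supplies its
    group structure. The inverse matches the order of composition in [permM]. *)
Let act (g : G) (u : T) : T := r (g^-1 * rep u)%g.

Let actE g x : act g (r x) = r (g^-1 * x)%g.
Proof. by apply: r_mull; rewrite repK. Qed.

Let act_inj g : injective (act g).
Proof.
move=> u v; rewrite -(repK u) -(repK v) !actE => /(r_mull g).
by rewrite !mulKVg.
Qed.

Let sigma g : {perm T} := perm (@act_inj g).

Let sigmaM g h : sigma (g * h)%g = (sigma g * sigma h)%g.
Proof.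
apply/permP => u; rewrite permM !permE -(repK u) !actE.
by rewrite invgM mulgA.
Qed.

Let sigma_eq g h : sigma g = sigma h <-> W (g^-1 * h)%g < eps.
Proof.
have -> : W (g^-1 * h)%g = W (g * h^-1)%g.
  rewrite -(gvalV p_pr hW) invgM invgK -(gvalJ hW _ h^-1%g) conjgE invgK !mulgA.
  by rewrite mulgV mul1g.
split=> [sgh|lt_gh].
  have : sigma g (r 1%g) = sigma h (r 1%g) by rewrite sgh.
  by rewrite !permE !actE !mulg1 => /rE; rewrite invgK.
apply/permP => u; rewrite !permE -(repK u) !actE; apply/rE.
rewrite invgM invgK mulgA -(mulgA _ g) -mulgA.
by have := gvalJ hW (g * h^-1)%g (rep u); rewrite conjgE mulgA => ->.
Qed.

Let Q : {set {perm T}} := [set s | `[< exists g, sigma g = s >]].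

Let Q_group : group_set Q.
Proof.
apply/group_setP; split.
  by rewrite inE; apply/asboolP; exists 1%g; exact: mulmap1 sigmaM.
move=> s s'; rewrite !inE => /asboolW[g <-] /asboolW[h <-].
by apply/asboolP; exists (g * h)%g.
Qed.

Let QG := Group Q_group.

Let QP g : sigma g \in QG.
Proof. by rewrite inE; apply/asboolP; exists g. Qed.

Let phi (g : G) : subg_of QG := subg QG (sigma g).

Let phiM g h : phi (g * h)%g = (phi g * phi h)%g.
Proof. by rewrite /phi sigmaM subgM ?QP. Qed.

Let phi_surj u : exists g, phi g = u.
Proof.
have := subgP u; rewrite inE => /asboolW[g gu]; exists g.
by rewrite /phi gu sgvalK.
Qed.

Let phi_eq g h : phi g = phi h <-> W (g^-1 * h)%g < eps.
Proof.
split=> [/(congr1 sgval)|/sigma_eq gh]; last by rewrite /phi gh.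
by rewrite /phi !subgK ?QP// => /sigma_eq.
Qed.

Let phi1 := mulmap1 phiM.
Let phiX := mulmapX phiM.

Let trunc (v : R) := if eps <= v then v else 0.

Let trunc_le v : 0 <= v -> trunc v <= v.
Proof. by rewrite /trunc; case: ifP. Qed.

Let trunc_ge0 v : 0 <= trunc v.
Proof. by rewrite /trunc; case: ifP => // /(lt_le_trans eps0)/ltW. Qed.

Let trunc_mono u v : u <= v -> trunc u <= trunc v.
Proof.
rewrite {1}/trunc; case: ifP => [eu uv|_ _]; last exact: trunc_ge0.
by rewrite /trunc (le_trans eu uv).
Qed.

Let wt (u : subg_of QG) : R := trunc (W (projT1 (cid (phi_surj u)))).

Let wtE g : wt (phi g) = trunc (W g).
Proof.
rewrite /wt; case: cid => h /= /phi_eq lt_hg; rewrite /trunc.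
have [eh|he] := leP eps (W h).
  by rewrite -(mulKVg h g) (gvalM_id p_pr hW) ?eh// (lt_le_trans lt_hg).
by rewrite ifN// -ltNge -(mulKVg h g) (gvalM_lt hW).
Qed.

(** If the value of a commutator or of a p-th power is at least eps, so are the values of its
    entries, and truncation changes neither side of the inequality. *)
Let wt_valuation : group_valuation p wt.
Proof.
have [_ _ wM wR wX] := hW.
have w0 := gval_ge0 hW; have w1 := gval_lt1 hW.
split.
- move=> u; have [g <-] := phi_surj u; rewrite wtE trunc_ge0/=.
  by rewrite (le_lt_trans (trunc_le (w0 g))).
- move=> u; have [g <-] := phi_surj u; rewrite wtE -phi1; split.
    rewrite /trunc; case: ifP => [/(lt_le_trans eps0) + W0|/negbT]; rewrite ?W0 ?ltxx//.
    rewrite -ltNge => lt_g _; apply/phi_eq.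
    by rewrite mulg1 (gvalV p_pr hW).
  move/phi_eq; rewrite mulg1 (gvalV p_pr hW) /trunc => lt_g.
  by rewrite ifN// -ltNge.
- move=> u v; have [g <-] := phi_surj u; have [h <-] := phi_surj v.
  rewrite -phiM !wtE le_max; have := wM g h; rewrite le_max.
  by case/orP => /trunc_mono ->; rewrite ?orbT.
- move=> u v; have [g <-] := phi_surj u; have [h <-] := phi_surj v.
  rewrite -(mulmapR phiM) !wtE {1}/trunc; case: ifP => [le_c|_]; last by rewrite mulr_ge0.
  have c_le := wR g h.
  have eg : eps <= W g.
    by apply: le_trans le_c (le_trans c_le _); rewrite ler_piMr// ltW.
  have eh : eps <= W h.
    by apply: le_trans le_c (le_trans c_le _); rewrite ler_piMl// ltW.
  by rewrite /trunc eg eh.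
- move=> u; have [g <-] := phi_surj u; rewrite -phiX !wtE {1}/trunc.
  case: ifP => [le_X|_]; last by rewrite exprn_ge0.
  have X_le := wX g.
  have eg : eps <= W g.
    apply: le_trans le_X (le_trans X_le _); rewrite ler_iXnr ?prime_gt0//.
    exact: ltW.
  by rewrite /trunc eg.
Qed.

(** W (g^(p^m)) <= W(g)^(p^m) falls below eps, so every element has p-power order, and Cauchy's
    theorem excludes other primes. *)
Let pgroupQ : (p.-group [set: subg_of QG])%g.
Proof.
apply/pgroupP => q q_pr /(Cauchy q_pr)[u _ uq].
have [g gu] := phi_surj u.
have Xle m : W (g ^+ (p ^ m))%g <= W g ^+ (p ^ m).
  elim: m => [|m IHm]; first by rewrite expn0 expg1 expr1.
  have [_ _ _ _ wX] := hW; rewrite expnSr expgM exprM; apply: le_trans (wX _) _.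
  by rewrite lerXn2r// nnegrE ?exprn_ge0// (gval_ge0 hW).
have r1 : `|W g| < 1 by rewrite ger0_norm ?(gval_ge0 hW) ?(gval_lt1 hW).
have [m lt_m] : exists m, W g ^+ m < eps.
  have /cvgrPdist_lt/(_ eps eps0)[m _ /(_ m (leqnn m))] := cvg_expr r1.
  rewrite sub0r normrN ger0_norm ?exprn_ge0 ?(gval_ge0 hW)// => lt_m.
  by exists m.
have : (u ^+ (p ^ m) = 1)%g.
  rewrite -gu -phiX -phi1; apply/phi_eq; rewrite mulg1 (gvalV p_pr hW).
  apply: le_lt_trans (Xle m) _; apply: le_lt_trans lt_m.
  rewrite ler_wiXn2l ?(gval_ge0 hW) ?(ltW (gval_lt1 hW _))//.
  by rewrite ltnW// ltn_expl// prime_gt1.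
move/eqP; rewrite -order_dvdn uq => qp.
have := Euclid_dvdX p m q_pr; rewrite qp => /esym/andP[+ _].
by rewrite dvdn_prime2// inE/= => /eqP ->.
Qed.

Lemma truncation_of_cosets : exists (gT : finGroupType) (phi : G -> gT) (wt : gT -> R),
  truncation phi wt.
Proof. by exists (subg_of QG), phi, wt; split. Qed.

End FiniteQuotient.

(** By continuity of [W], G_{<eps} contains a normal subgroup of p-power index, so it has finitely
    many cosets. *)
Lemma truncation_exists (R : realType) (p : nat) (G : topologicalGroupType)
    (W : G -> R) (eps : R) :
  prime p -> pro_p p G -> valuation p W -> 0 < eps ->
  exists (gT : finGroupType) (phi : G -> gT) (wt : gT -> R), truncation p W eps phi wt.
Proof.
move=> p_pr [_ _ _ base] [Wc w01 W0 wM [wR wX]] eps0.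
have hW : group_valuation p W by split.
have nb : nbhs (1%g : G) [set g | W g < eps]%classic.
  have W1 : W 1%g = 0 by rewrite W0.
  have := Wc 1%g [set v | v < eps]%classic; apply.
  by rewrite W1; exact: lt_nbhsl.
have [N [[[N1 NM NV] _] _ [k Nk] NU]] := base _ nb.
pose K := [set g : G | W g < eps]%classic.
have Ksub : is_subgroup K.
  split=> [|g h|g]; rewrite /K/=; first by rewrite (gval1 hW).
    exact: gvalM_lt.
  by rewrite (gvalV p_pr hW).
pose CK := range (fun g => Defs.lcoset g K).
have finCK : finite_set CK.
  have /(finite_image (fun C => set_mul C K)) : finite_set (cosets_of *%g [set: G] N).
    by apply/finite_setP; exists (p ^ k)%N.
  apply: sub_finite_set => _ [g _ <-]; exists (Defs.lcoset g N); first by exists g.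
  apply/seteqP; split=> [_ [_ [n Nn <-] [b Kb <-]]|_ [b Kb <-]].
    exists (n * b)%g; last by rewrite mulgA.
    by case: Ksub => _ + _; apply=> //; exact: NU.
  by exists g; [exists 1%g => //; rewrite mulg1|exists b].
have mem_r g : Defs.lcoset g K \in fset_set CK.
  by rewrite in_fset_set// inE; exists g.
pose r g : fset_set CK := [` mem_r g]%fset.
apply: (@truncation_of_cosets _ _ _ _ _ p_pr hW eps0 (fset_set CK) r) => [u|g h].
  have := fsvalP u; rewrite in_fset_set// inE => -[g _ gu].
  by exists g; apply: val_inj.
have gh := lcoset_eq g h Ksub.
by split=> [[/gh]|/gh]; [|move=> ?; apply: val_inj].
Qed.

Section FiniteLevels.
Import boot.ssrbool boot.fintype boot.finset.

(** Carries [group_index] over to indices in finite groups: f and g have the same fibres on A, and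
    finiteness comes from g. *)
Lemma card_fset_set_image (T : Type) (T1 : choiceType) (S : finType)
    (A : set T) (f : T -> T1) (g : T -> S) (B : {set S}) :
  (forall a a', A a -> A a' -> f a = f a' <-> g a = g a') ->
  (forall s, s \in B <-> exists2 a, A a & g a = s) ->
  #|` fset_set (f @` A)%classic|%fset = #|B|.
Proof.
move=> fg BP.
have [[a0 Aa0]|noA] := pselect (exists a, A a); last first.
  have -> : (f @` A)%classic = classical_sets.set0.
    by rewrite -classical_sets.subset0 => t [a Aa _]; apply: noA; exists a.
  rewrite fset_set0 cardfs0; apply/esym/eq_card0 => s; apply/negP => /BP[a Aa _].
  by apply: noA; exists a.
have /choice[h hP] : forall s, exists a, A a /\ (s \in B -> g a = s).
  move=> s; have [/BP[a Aa gas]|_] := boolP (s \in B); first by exists a.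
  by exists a0.
pose BF := [fset s in B]%fset.
have BFE s : (s \in BF) = (s \in B) by rewrite /BF finmap.inE.
have fE : (f @` A)%classic = [set` [fset f (h s) | s in BF]%fset]%classic.
  apply/seteqP; split=> [_ [a Aa <-]|_ /= /imfsetP[s _ ->]]; last first.
    by exists (h s); case: (hP s).
  have Ba : g a \in B by apply/BP; exists a.
  apply/imfsetP; exists (g a) => /=; first by rewrite BFE.
  by have [Ah /(_ Ba)] := hP (g a) => gh; apply/fg.
rewrite fE set_fsetK card_in_imfset/=; first by rewrite card_finset.
move=> s s'; rewrite /= !BFE => Bs Bs'.
have [As /(_ Bs) gs] := hP s; have [As' /(_ Bs') gs'] := hP s'.
by move/(fg _ _ As As'); rewrite gs gs'.
Qed.

End FiniteLevels.

(** * Coefficients of rank and index read off a finite quotient *)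

Section TruncatedLevels.
Import boot.ssrbool boot.fintype boot.finset.
Variables (R : realType) (p : nat) (G : topologicalGroupType) (W : G -> R).
Variables (eps : R) (gT : finGroupType) (phi : G -> gT) (wt : gT -> R).
Hypotheses (p_pr : prime p) (hW : valuation p W) (eps0 : 0 < eps).
Hypothesis tr : truncation p W eps phi wt.
Implicit Types (H : set G) (a : R).
Local Open Scope group_scope.

Lemma valuation_group : group_valuation p W.
Proof. by case: hW => _ ? ? ? [? ?]; split. Qed.

Let hW' := valuation_group.
Let phiM g h : phi (g * h) = phi g * phi h. Proof. by case: tr. Qed.
Let phi_surj u : exists g, phi g = u. Proof. by case: tr. Qed.
Let hwt : group_valuation p wt. Proof. by case: tr. Qed.
Let pG : p.-group [set: gT]. Proof. by case: tr. Qed.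
Let wtE g : wt (phi g) = (if eps <= W g then W g else 0)%R. Proof. by case: tr. Qed.

Let phi1 := mulmap1 phiM.
Let phiV := mulmapV phiM.
Let phiX := mulmapX phiM.

Lemma truncation_lt g a : (eps <= a)%R -> (wt (phi g) < a)%R = (W g < a)%R.
Proof.
rewrite wtE => ea; case: (leP eps (W g)) => // lt_g.
by rewrite (lt_le_trans eps0 ea) (lt_le_trans lt_g ea).
Qed.

Lemma truncation_le g a : (eps <= a)%R -> (wt (phi g) <= a)%R = (W g <= a)%R.
Proof.
rewrite wtE => ea; case: (leP eps (W g)) => // lt_g.
by rewrite (ltW (lt_le_trans eps0 ea)) (ltW (lt_le_trans lt_g ea)).
Qed.

Lemma truncation_eq1 g : phi g = 1 <-> (W g < eps)%R.
Proof.
rewrite -(truncation_lt g (lexx eps)); split=> [->|]; first by rewrite (gval1 hwt).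
move=> lt_g; apply: (gval_eq0 hwt); move: lt_g; rewrite wtE; case: ifP => //.
by move=> eg; rewrite ltNge eg.
Qed.

(** Taking the generated subgroup gives a group for every set [H]; for a subgroup it is the plain
    image. *)
Definition image_group H : {group gT} :=
  <<[set u | `[< exists2 h, H h & phi h = u >]]>>%G.

Lemma mem_image_group H u : is_subgroup H ->
  u \in image_group H <-> exists2 h, H h & phi h = u.
Proof.
move=> [H1 HM HV]; rewrite /= gen_set_id; last first.
  apply/group_setP; split; first by rewrite inE; apply/asboolP; exists 1; rewrite ?phi1.
  move=> v v'; rewrite !inE => /asboolP[g Hg <-] /asboolP[h Hh <-].
  by apply/asboolP; exists (g * h); [exact: HM|rewrite phiM].
by rewrite inE; split=> [/asboolP|h]; last exact/asboolP.
Qed.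

Lemma image_group_setT : image_group [set: G]%classic = [set: gT] :> {set gT}.
Proof.
apply/eqP; rewrite eqEsubset subsetT; apply/subsetP => u _.
apply/(@mem_image_group [set: G]%classic) => //.
by have [g gu] := phi_surj u; exists g.
Qed.

Lemma truncation_nbhs g : nbhs g [set h | phi h = phi g]%classic.
Proof.
have [Wc _ _ _ _] := hW.
have : nbhs (g^-1 * g) [set h | W h < eps]%classic.
  rewrite mulVg; have := Wc 1 [set v | (v < eps)%R]%classic; apply.
  by rewrite (gval1 hW'); exact: lt_nbhsl.
move=> nb; have := @mulgl_continuous G g^-1 g _ nb.
apply: (@filterS _ (nbhs g) _ _ _ _) => h /= /truncation_eq1.
rewrite phiM phiV => gh; by rewrite -(mulKVg (phi g) (phi h)) gh mulg1.
Qed.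

Section Levels.
Variables (H : set G) (a : R).
Hypotheses (Hs : is_subgroup H) (ea : (eps <= a)%R).

Let U := image_group H.
Let a0 : (0 < a)%R. Proof. exact: lt_le_trans ea. Qed.

Let memU h : H h -> phi h \in U.
Proof. by move=> Hh; apply/mem_image_group => //; exists h. Qed.

Lemma level_subgroup : is_subgroup [set h | H h /\ (W h < a)%R]%classic.
Proof.
case: Hs => [H1 HM HV]; split=> [|g h [Hg ga] [Hh ha]|g [Hg ga]].
- by split=> //; rewrite (gval1 hW').
- by split; [exact: HM|exact: (gvalM_lt hW')].
- by split; [exact: HV|rewrite (gvalV p_pr hW')].
Qed.

Lemma c_sub_level_index : c_sub p W H a = level_index p wt U a.
Proof.
rewrite /c_sub /c_coef /level_index; congr logn.
have [s [s0 sa sE lE]] := lt_level hwt a0.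
pose L := level_group hwt U s.
have memL z : H z -> (phi z \in L) = (W z < a)%R.
  by move=> Hz; rewrite /L/= (in_level hwt)// memU// -sE truncation_lt.
have [H1 HM HV] := Hs.
rewrite lE -(card_lcosets (level_group hwt U a) L).
apply: (card_fset_set_image (g := fun g => phi g *: L)) => [g h|C].
  move=> [Hg _] [Hh _].
  have E := lcoset_eq g h level_subgroup.
  rewrite -[[set _ | _ in _]%classic]/(Defs.lcoset g _).
  rewrite -[[set _ | _ in _]%classic in X in _ = X]/(Defs.lcoset h _).
  have EL : (phi h \in phi g *: L) = (W (g^-1 * h)%g < a)%R.
    by rewrite mem_lcoset -phiV -phiM memL//; apply: HM => //; exact: HV.
  split=> [/E [_ gh]|gh].
    by apply/esym/lcoset_eqP; rewrite EL.
  apply/E; split; first by apply: HM => //; exact: HV.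
  by rewrite -EL; apply/lcoset_eqP.
split=> [/lcosetsP[u]|[h [Hh ha] <-]].
  rewrite (in_level hwt) ?(ltW a0)// => /andP[/mem_image_group -/(_ Hs)[h Hh <-]].
  by rewrite truncation_le// => ha ->; exists h.
apply/lcosetsP; exists (phi h) => //.
by rewrite (in_level hwt) ?(ltW a0)// memU// truncation_le.
Qed.

Hypothesis Hc : closed H.
Let N := frattini p H.
Let D := derived_subgroup H.
Let P := power_subgroup p H.

Let HJ g h : H g -> H h -> H (g ^ h).
Proof.
have [H1 HM HV] := Hs; move=> Hg Hh.
by rewrite conjgE; exact: (HM _ _ (HV _ Hh) (HM _ _ Hg Hh)).
Qed.

Let derived_conj x h : H h -> D x -> D (x ^ h).
Proof.
have [H1 HM HV] := Hs; move=> Hh; apply: subgroup_genJ => _ [g Hg [k Hk <-]].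
exists (g ^ h); first exact: HJ.
exists (k ^ h); first exact: HJ.
by rewrite -conjRg.
Qed.

Let power_conj x h : H h -> P x -> P (x ^ h).
Proof.
have [H1 HM HV] := Hs; move=> Hh; apply: subgroup_genJ => _ [g Hg <-].
exists (g ^ h); first exact: HJ.
by rewrite -conjXg.
Qed.

Let HX g n : H g -> H (g ^+ n).
Proof.
have [H1 HM HV] := Hs; move=> Hg; elim: n => [|n IHn]; first by rewrite expg0.
by rewrite expgS; exact: HM.
Qed.

Let D_sub : (D `<=` H)%classic.
Proof.
have [H1 HM HV] := Hs; apply: subgroup_gen_sub => // _ [g Hg [k Hk <-]].
by rewrite commgEl; exact: (HM _ _ (HV _ Hg) (HJ Hg Hk)).
Qed.

Let P_sub : (P `<=` H)%classic.
Proof. by apply: subgroup_gen_sub => // _ [g Hg <-]; exact: HX. Qed.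

Let DP_subgroup : is_subgroup (set_mul D P).
Proof.
apply: set_mul_subgroup; [exact: subgroup_gen_subgroup..|].
by move=> x h Ph; apply: derived_conj; exact: P_sub.
Qed.

Lemma frattini_subgroup : is_subgroup N.
Proof. exact: closure_subgroup DP_subgroup. Qed.

Lemma frattini_conj x h : H h -> N x -> N (x ^ h).
Proof.
move=> Hh.
apply: (closure_stable (@conjg_continuous G h)).
move=> _ [d Dd [q Pq <-]].
rewrite conjMg; exists (d ^ h); first exact: derived_conj.
by exists (q ^ h) => //; exact: power_conj.
Qed.

Lemma frattini_sub : (N `<=` H)%classic.
Proof.
have [H1 HM HV] := Hs.
rewrite [X in (_ `<=` X)%classic](closure_id H).1//; apply: closure_subset.
by move=> _ [d Dd [q Pq <-]]; apply: HM; [exact: D_sub|exact: P_sub].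
Qed.

(** The fibres of [phi] are neighbourhoods, so the closure adds nothing to the image of [H, H]
    H^p. *)
Lemma frattini_image u : u \in 'Phi(U) <-> exists2 n, N n & phi n = u.
Proof.
have pU : p.-group U by apply: pgroupS pG; apply: subsetT.
rewrite (Phi_joing pU) derg1 (MhoE 1 pU) expn1; split.
  have [N1 NM NV] := frattini_subgroup.
  move/(subsetP (_ : _ \subset image_group N)) => hu.
  apply/(mem_image_group u frattini_subgroup); apply: hu.
  apply/joing_subP; split; rewrite gen_subG; apply/subsetP => v.
    case/imset2P => v1 v2 /mem_image_group -/(_ Hs)[g Hg gv].
    move=> /mem_image_group -/(_ Hs)[h Hh hv] ->; rewrite -gv -hv.
    apply/mem_image_group; first exact: frattini_subgroup.
    exists [~ g, h]; last exact: mulmapR.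
    apply: subset_closure; exists [~ g, h].
      by apply: subset_subgroup_gen; exists g => //; exists h.
    by exists 1; [case: (subgroup_gen_subgroup [set x ^+ p | x in H]%classic)|rewrite mulg1].
  case/imsetP => v1 /mem_image_group -/(_ Hs)[g Hg <-] ->.
  apply/mem_image_group; first exact: frattini_subgroup.
  exists (g ^+ p); last exact: phiX.
  apply: subset_closure; exists 1.
    by case: (subgroup_gen_subgroup [set commg x y | x in H & y in H]%classic).
  by exists (g ^+ p); [apply: subset_subgroup_gen; exists g|rewrite mul1g].
move=> [n Nn <-]; have [_ [[d Dd [q Pq <-]] /= <-]] := Nn _ (truncation_nbhs n).
rewrite phiM; apply: groupM.
  apply: (subsetP (joing_subl _ _)).
  apply: (subgroup_gen_sub (H := [set x | phi x \in [~: U, U]]%classic)) Dd.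
    by split=> [|x y|x] /=; rewrite ?phi1 ?phiM ?phiV ?groupV//; exact: groupM.
  move=> _ [g Hg [h Hh <-]] /=.
  by rewrite (mulmapR phiM) mem_commg// memU.
apply: (subsetP (joing_subr _ _)).
pose X := <<[set x ^+ p | x in U]>>%G; rewrite -[_ \in _]/(phi q \in X).
apply: (subgroup_gen_sub (H := [set x | phi x \in X]%classic)) Pq.
  by split=> [|x y|x] /=; rewrite ?phi1 ?phiM ?phiV ?groupV//; exact: groupM.
move=> _ [g Hg <-] /=; rewrite phiX mem_gen//.
by apply/imsetP; exists (phi g); rewrite ?memU.
Qed.

Let coset x := Defs.lcoset x N.

Let coset_eq x y : coset x = coset y <-> N (x^-1 * y).
Proof. exact: lcoset_eq frattini_subgroup. Qed.

Let coset_mul x y : H y -> set_mul (coset x) (coset y) = coset (x * y).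
Proof.
have [H1 HM HV] := Hs; move=> Hy; apply: set_mul_lcoset => [|n Nn|n Nn].
- exact: frattini_subgroup.
- exact: frattini_conj.
- by apply: frattini_conj => //; exact: HV.
Qed.

Let quotient_valuation_lt x b : H x ->
  (quotient_valuation W (coset x) < b)%R <->
  exists y, [/\ H y, coset x = coset y & (W y < b)%R].
Proof.
have [H1 HM HV] := Hs; have [N1 _ _] := frattini_subgroup.
move=> Hx; split=> [|[y [Hy -> yb]]].
  case/inf_lt => [|_ [_ [n Nn <-] <-] xnb].
    by exists (W x), x => //; exists 1; rewrite ?mulg1.
  exists (x * n); split=> //; first by apply: HM => //; exact: frattini_sub.
  by apply/coset_eq; rewrite mulKg.
apply: le_lt_trans yb; apply: ge_inf.
  by exists 0%R => _ [z _ <-]; exact: (gval_ge0 hW').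
by exists y => //; exists 1; rewrite ?mulg1.
Qed.

(* The values above [a] are at least [b] for some [b > a], so that the infimum
   is at most [a] as soon as it is less than [b]. *)
Let value_gap : exists2 b : R, (a < b)%R & forall g, (W g <= a)%R = (W g < b)%R.
Proof.
have gap g : (a < W g)%R -> wt (phi g) = W g.
  by move=> ag; rewrite wtE ifT// (le_trans ea)// ltW.
have [[u0 au0]|no] := pselect (exists u, (a < wt u)%R); last first.
  exists (a + 1)%R => [|g]; first by rewrite ltrDl.
  apply/idP/idP => [/le_lt_trans|_]; first by apply; rewrite ltrDl.
  by rewrite leNgt; apply/negP => ag; apply: no; exists (phi g); rewrite gap.
have Pu0 : [pred u | (a < wt u)%R] u0 by [].
case: (arg_minP wt Pu0) => u /= au u_min; exists (wt u) => // g.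
apply/idP/idP => [/le_lt_trans|lt_g]; first exact.
by rewrite leNgt; apply/negP => ag; move: lt_g; rewrite -(gap g ag) ltNge u_min//= gap.
Qed.

(** Cosets of weight at most a, or below a, are those of elements of such weight. Hence both indices
    count the elements of [H] of weight at most a modulo H_{<a} Phi(H). *)
Lemma c_quotient_Phi_level_index : c_quotient p W H N a = Phi_level_index p wt U a.
Proof.
have [H1 HM HV] := Hs; have [N1 NM NV] := frattini_subgroup.
have [s [s0 sa sE lE]] := lt_level hwt a0.
have [b ab bE] := value_gap.
rewrite /c_quotient /c_coef /Phi_level_index lE; congr logn.
rewrite -[joing 'Phi(U) (level wt U s)]/(Phi_level wt U s : {set gT}).
pose L := Phi_level_group wt U s.
rewrite -(card_lcosets (Phi_level_group wt U a) L).
pose lt_set := [set y | H y /\ (W y < a)%R]%classic.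
have levelE c : [set C | quotient_set H N C /\ (quotient_valuation W C < c)%R]%classic =
    [set coset y | y in [set y | H y /\ (W y < c)%R]]%classic.
  apply/seteqP; split=> [_ [[x Hx <-]]|_ [y [Hy yc] <-]].
    by move=> /(quotient_valuation_lt c Hx)[y [Hy xy yc]]; exists y.
  by split; [exists y|apply/(quotient_valuation_lt c Hy); exists y].
have -> : [set C | quotient_set H N C /\ (quotient_valuation W C <= a)%R]%classic =
    [set coset y | y in [set y | H y /\ (W y <= a)%R]]%classic.
  rewrite (_ : [set y | H y /\ (W y <= a)%R]%classic =
    [set y | H y /\ (W y < b)%R]%classic); last first.
    by apply/seteqP; split=> y /=; rewrite bE.
  rewrite -levelE; apply/seteqP; split=> C /= [qC Ca]; split=> //.
    exact: le_lt_trans Ca ab.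
  have [x Hx xC] := qC; move: Ca; rewrite -xC.
  move=> /(quotient_valuation_lt b Hx)[y [Hy xy]]; rewrite -bE => ya.
  apply: le_trans ya; apply: ge_inf.
    by exists 0%R => _ [z _ <-]; exact: (gval_ge0 hW').
  by exists y => //; rewrite -/(coset x) xy; exists 1; rewrite ?mulg1.
rewrite levelE /group_index /cosets_of image_comp.
set f := (X in [set X y | y in _]%classic).
have LE : L = level wt U s * 'Phi(U) :> {set gT}.
  rewrite /L/= /Phi_level joingC.
  apply: (@norm_joinEr _ (level_group hwt U s) 'Phi(U)%G).
  exact: subset_trans (Phi_sub U) (level_norm hwt U s).
have memL z : H z -> phi z \in L <-> exists y n, [/\ lt_set y, N n & z = y * n].
  move=> Hz; rewrite LE; split=> [/mulsgP[l v]|[y [n [[Hy ya] Nn ->]]]]; last first.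
    rewrite phiM mem_mulg//; last by apply/frattini_image; exists n.
    by rewrite (in_level hwt)// memU//= -sE truncation_lt.
  rewrite (in_level hwt)// -sE => /andP[/mem_image_group -/(_ Hs)[h Hh <-] ha].
  move=> /frattini_image[n Nn nv] zE; rewrite -nv {v nv} in zE.
  have Hn := frattini_sub Nn.
  (* Its image is trivial, so it has weight below eps <= a and can be absorbed into h. *)
  pose k := (h * n)^-1 * z.
  have Hk : H k by apply: (HM _ _ (HV _ (HM _ _ Hh Hn)) Hz).
  have ka : (W k < a)%R.
    apply: lt_le_trans ea; apply/truncation_eq1.
    by rewrite /k phiM phiV phiM -zE mulVg.
  exists (h * k), (n ^ k); split; last by rewrite conjgE -(mulgA h) mulKVg mulgA /k mulKVg.
    split; first exact: HM.
    by apply: (gvalM_lt hW') => //; rewrite truncation_lt in ha.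
  exact: frattini_conj.
have fP x C : H x -> f x C <-> exists2 y, lt_set y & coset (x * y) = C.
  move=> Hx; split=> [[_ [y Ly <-] <-]|[y Ly <-]].
    by exists y => //; rewrite coset_mul//; case: Ly.
  by exists (coset y); [exists y|rewrite coset_mul//; case: Ly].
have f_sub x y : H x -> H y -> phi (x^-1 * y) \in L -> (f y `<=` f x)%classic.
  move=> Hx Hy /memL -/(_ (HM _ _ (HV _ Hx) Hy))[h [n [[Hh ha] Nn xyE]]].
  move=> C /fP -/(_ Hy)[z [Hz za] <-]; apply/fP => //; exists (h * z).
    by split; [exact: HM|exact: (gvalM_lt hW')].
  apply/coset_eq; have -> : y = x * (h * n) by rewrite -xyE mulKVg.
  have -> : (x * (h * z))^-1 * (x * (h * n) * z) = n ^ z.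
    by rewrite conjgE !invgM !mulgA mulgKV mulgKV.
  exact: frattini_conj.
apply: (card_fset_set_image (g := fun x => phi x *: L)) => [x y [Hx _] [Hy _]|C].
  have cosetE : (phi y \in phi x *: L) = (phi (x^-1 * y) \in L).
    by rewrite mem_lcoset phiM phiV.
  split=> [fxy|/lcoset_eqP xy].
    apply/esym/lcoset_eqP; rewrite cosetE; apply/memL.
      by apply: HM => //; exact: HV.
    have : f y (coset y).
      by apply/fP => //; exists 1; [split; rewrite ?(gval1 hW')|rewrite mulg1].
    rewrite -fxy => /fP -/(_ Hx)[z Lz /coset_eq Nz].
    by exists z, ((x * z)^-1 * y); split=> //; rewrite invgM !mulgA mulgV mul1g.
  apply/seteqP; split; apply: f_sub => //.
    by rewrite phiM phiV -mem_lcoset.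
  by rewrite phiM phiV -mem_lcoset lcoset_sym.
split=> [/lcosetsP[u]|[h [Hh ha] <-]].
  rewrite /= /Phi_level joingC (@norm_joinEr _ (level_group hwt U a) 'Phi(U)%G); last first.
    exact: subset_trans (Phi_sub U) (level_norm hwt U a).
  case/mulsgP => l v; rewrite (in_level hwt) ?(ltW a0)// => /andP[].
  move=> /mem_image_group -/(_ Hs)[h Hh <-]; rewrite truncation_le// => ha Pv -> ->.
  exists h => //; apply/lcoset_eqP; rewrite mem_lcoset invMg -mulgA mulVg mulg1 groupV.
  exact: subsetP (Phi_sub_level _ _ _) _ Pv.
apply/lcosetsP; exists (phi h) => //.
apply: (subsetP (level_sub_Phi_level _ _ _)).
by rewrite (in_level hwt) ?(ltW a0)// memU// truncation_le.
Qed.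

End Levels.

End TruncatedLevels.

(** * Weight functions on free pro-p groups *)

Section NCSeriesWeights.
Variables (R : realType) (p : nat) (X : choiceType).
Hypothesis p_pr : prime p.
Implicit Types (f g : ncseries p X) (m : seq X).

Lemma ncs_natrE n m : ncs_coef (n%:R : ncseries p X) m = ncs_coef 1 m *+ n.
Proof.
elim: n => [|n IHn]; first by rewrite !mulr0n.
by rewrite !mulrS -IHn.
Qed.

Lemma ncs_pchar : p%:R = 0 :> ncseries p X.
Proof.
apply/funext => m; rewrite -[LHS]/(ncs_coef _ m) ncs_natrE -mulr_natr.
by rewrite (pchar_Fp_0 p_pr) mulr0.
Qed.

Lemma ncs_augM f g : ncs_coef (f * g) [::] = ncs_coef f [::] * ncs_coef g [::].
Proof.
rewrite -[f * g]/(ncs_mul f g) /ncs_mul /ncs_coef big_ord_recl big_ord0 addr0.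
by rewrite take0.
Qed.

Lemma ncs_mono1M x f m :
  ncs_coef (ncs_mono p [:: x] * f) m =
  if m is y :: m' then (y == x)%:R * ncs_coef f m' else 0.
Proof.
rewrite -[ncs_mono p [:: x] * f]/(ncs_mul _ _) /ncs_mul /ncs_coef /ncs_mono.
case: m => [|y m]; first by rewrite big_ord_recl big_ord0 /= mul0r addr0.
rewrite big_ord_recl take0 mul0r add0r big_ord_recl/= take0 drop0 big1 ?addr0.
  by rewrite eqseq_cons eqxx andbT.
move=> i _; rewrite eqseq_cons; case: m i => [[]//|z m] i /=.
by rewrite andbF mul0r.
Qed.

Lemma ncs_mono_cons x m : ncs_mono p (x :: m) = ncs_mono p [:: x] * ncs_mono p m.
Proof.
apply/funext => m'; rewrite -[RHS]/(ncs_coef _ m') ncs_mono1M.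
case: m' => [|y m']//; rewrite /ncs_coef /ncs_mono eqseq_cons.
by case: eqP => _ /=; rewrite ?mul1r ?mul0r.
Qed.

Variables (w : ncseries p X -> R).
Hypothesis hw : series_weight w.

Lemma series_weight_aug f : w f < 1 -> ncs_coef f [::] = 0.
Proof.
case: hw => _ w0 w1 _ wmax lt_f; apply/eqP/negPn/negP => fn0.
have fN0 : f != 0 by apply: contraNneq fn0 => ->.
have [_ /(_ _ fn0)] := wmax f fN0.
by rewrite leNgt -[ncs_mono p [::]]/(1 : ncseries p X) w1 lt_f.
Qed.

(** Monomials starting with [x j] come from the j-th summand only, so the heaviest monomial of
    [f j], prefixed by [x j], survives in the sum. *)
Lemma series_weight_sum (J : finType) (x : J -> X) (f : J -> ncseries p X) j :
  injective x ->
  w (ncs_mono p [:: x j]) * w (f j) <= w (\sum_i ncs_mono p [:: x i] * f i).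
Proof.
case: hw => -[_ w01] w0 w1 [_ wM] wmax inj_x.
have [->|fj0] := eqVneq (f j) 0.
  have [_ ->//] := w0 0; rewrite mulr0.
  by case/andP: (w01 (\sum_i ncs_mono p [:: x i] * f i)).
have [[m fm ->] _] := wmax _ fj0; rewrite -wM -ncs_mono_cons.
set S := \sum_i _.
have Sm : ncs_coef S (x j :: m) = ncs_coef (f j) m.
  have coef_sum : ncs_coef S (x j :: m) =
      \sum_i ncs_coef (ncs_mono p [:: x i] * f i) (x j :: m).
    apply: (big_morph (fun g => ncs_coef g (x j :: m))) => //.
  rewrite coef_sum (bigD1 j)//= ncs_mono1M eqxx mul1r big1 ?addr0// => i ij.
  by rewrite ncs_mono1M (inj_eq inj_x) eq_sym (negbTE ij) mul0r.
have S0 : S != 0 by apply: contraNneq fm => S0; rewrite -Sm S0.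
by have [_] := wmax _ S0; apply; rewrite Sm.
Qed.

End NCSeriesWeights.

Section FreeTightFamilies.
Import boot.ssrbool boot.fintype boot.finset.
Variables (R : realType) (p : nat) (G : topologicalGroupType) (W : G -> R).
Variables (eps : R) (gT : finGroupType) (phi : G -> gT) (wt : gT -> R).
Hypotheses (p_pr : prime p) (hW : valuation p W) (eps0 : 0 < eps).
Hypothesis tr : truncation p W eps phi wt.

(** Words in X are dense and the fibres of [phi] are neighbourhoods, so every element of [gT] is the
    image of a word; letters of weight below eps have trivial image. *)
Lemma free_generating_image (X : set G) (Y : {group gT}) :
  free_generating_set p X ->
  (forall x : X, eps <= W (val x) -> phi (val x) \in Y) -> Y = [set: gT] :> {set gT}.
Proof.
move=> [_ denseX _] XY; have [phiM phi_surj hwt pG wtE] := tr.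
have phi1 := mulmap1 phiM; have phiV := mulmapV phiM.
have XY' (x : X) : phi (val x) \in Y.
  have [/XY//|lt_x] := leP eps (W (val x)).
  have [_ ->//] := truncation_eq1 eps0 tr (val x); exact: group1.
apply/eqP; rewrite eqEsubset subsetT; apply/subsetP => u _.
have [g <-] := phi_surj u.
have : closure (range (@fg_lift X G (fun x => val x))) g by rewrite denseX.
move=> /(_ _ (truncation_nbhs hW eps0 tr g))[_ [[v _ <-] /= <-]].
rewrite /fg_lift; elim: (val v) => [|[x b] s IHs] /=; first by rewrite phi1 group1.
by rewrite phiM groupM//; case: b; rewrite ?phiV ?groupV; exact: XY'.
Qed.

Lemma free_tight_families (X : set G) (H : set G) (l : seq R) (theta delta : R) :
  free_generating_set p X -> weight_function_wrt p X W -> is_subgroup H ->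
  maximal_chain wt l (image_group phi [set: G]%classic) (image_group phi H) ->
  0 < theta -> 0 <= delta ->
  exists (J K : finType) (x : J -> G) (y : K -> G),
    [/\ tight p wt (image_group phi [set: G]%classic) (phi \o x),
        tight p wt (image_group phi H) (phi \o y) &
        (\prod_(a <- l | (theta <= a)%R) schreier_factor p a) *
          (weight_sum W delta x - 1 - \sum_(a <- l | (a < theta)%R) a) <=
        weight_sum W (delta * theta ^+ (p.-1 * count (>= theta) l)) y - 1].
Proof.
move=> genX [mu [w [muX ws WE]]] Hs lH theta0 delta0.
have [phiM phi_surj hwt pG wtE] := tr.
have hW' := valuation_group hW.
have [muc mu1 muM muXE] := muX.
have [[wc w01] w0 w1 [wD wM] wmax] := ws.
have w_ge0 f : 0 <= w f by case/andP: (w01 f).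
have w_le1 f : w f <= 1 by case/andP: (w01 f).
(* One generator for each image: this makes the family finite and injective, and it still generates
   the quotient. *)
pose visible u := `[< exists x : X, eps <= W (val x) /\ phi (val x) = u >].
pose J : finType := {u | visible u}.
have /choice[xX xXP] : forall u : J, exists x : X,
    eps <= W (val x) /\ phi (val x) = val u.
  by case=> u /= /asboolP.
pose x u := val (xX u).
have inj_x : injective xX.
  by move=> u v uv; apply: val_inj; rewrite -(xXP u).2 -(xXP v).2 uv.
have free_x : free_family w mu W phi (image_group phi [set: G]%classic) x.
  split.
  - pose Y := <<[set phi (x j) | j : J]>>%G.
    rewrite -[LHS]/(Y : {set gT}) (image_group_setT tr).
    apply: (free_generating_image genX) => z ez.
    have vz : visible (phi (val z)) by apply/asboolP; exists z.
    pose j : J := exist (fun u => is_true (visible u)) _ vz.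
    by rewrite mem_gen//; apply/imsetP; exists j => //; rewrite /x (xXP j).2.
  - by move=> j; apply: lt_le_trans (xXP j).1.
  - move=> f _ j; have E i : mu (x i) - 1 = ncs_mono p [:: xX i].
      by rewrite muXE addrAC subrr add0r.
    rewrite WE E; under eq_bigr do rewrite E.
    exact: series_weight_sum.
pose aug (f : ncseries p X) := ncs_coef f [::].
have augD f g : aug (f + g) = aug f + aug g by [].
have aug1 : aug 1 = 1 by [].
have augM := @ncs_augM p X.
have aug_lt1 := series_weight_aug ws.
have p0 := ncs_pchar X p_pr.
have [K [y [free_y le_y]]] := free_family_chain p_pr hW' w_ge0 w_le1 w0 w1 wD wM p0
  mu1 muM WE augD augM aug1 aug_lt1 hwt pG phiM wtE theta0 lH free_x delta0.
have tight_of := free_family_tight p_pr hW' w0 mu1 muM WE augD augM aug1 aug_lt1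
  hwt pG phiM wtE.
by exists J, K, x, y; split=> //; exact: tight_of.
Qed.

End FreeTightFamilies.

(** * Passage to the limit *)

Lemma pos_lower_bound (R : realType) (s : seq R) : (forall a, a \in s -> 0 < a) ->
  exists e : R, [/\ 0 < e, e <= 1 & forall a, a \in s -> e <= a].
Proof.
elim: s => [|b s IHs] s0; first by exists 1; split.
have [a sa|e [e0 e1 es]] := IHs; first by apply: s0; rewrite in_cons sa orbT.
have b0 : 0 < b by apply: s0; rewrite mem_head.
exists (Num.min b e); split; rewrite ?lt_min ?b0 ?ge_min ?e1 ?orbT//.
move=> a; rewrite in_cons ge_min => /orP[/eqP->|/es ->]; rewrite ?lexx ?orbT//.
Qed.

Lemma prod_exp_count (R : realType) (F : {fset R}) (l : seq R) (f : R -> R) :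
  \prod_(a <- F) f a ^+ count_mem a l = \prod_(b <- l | b \in F) f b.
Proof.
elim: l => [|b l IHl]; first by rewrite big_nil big1.
under eq_bigr => a _ do rewrite /= exprD.
rewrite big_split/= IHl big_cons.
have -> : \prod_(a <- F) f a ^+ (b == a) = if b \in F then f b else 1.
  rewrite (eq_bigr (fun a => if a == b then f b else 1)) => [|a _]; last first.
    by rewrite eq_sym; case: eqP => [->|_]; rewrite ?expr1 ?expr0.
  rewrite -big_mkcond/= big_const_seq iter_mulr_1 (@eq_count _ _ (pred1 b))//.
  by rewrite count_uniq_mem ?fset_uniq//; case: (_ \in _).
by case: ifP => _; rewrite ?mul1r.
Qed.

Section Limits.
Variables (R : realType) (p : nat) (G : topologicalGroupType) (W : G -> R).
Hypotheses (p_pr : prime p) (hW : valuation p W).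
Implicit Types (H : set G) (F : {fset R}) (a : R).
Local Open Scope classical_set_scope.

Definition positive_value H F : Prop :=
  forall a, a \in F -> (W @` H) a /\ 0 < a.

Definition rank_sum H F : R :=
  \sum_(a <- F) (c_quotient p W H (frattini p H) a)%:R * a.

Definition index_prod H F : R :=
  \prod_(a <- F) schreier_factor p a ^+ (c_sub p W setT a - c_sub p W H a).

Lemma W_rank_le H (M : \bar R) :
  (forall F, positive_value H F -> ((rank_sum H F)%:E <= M)%E) ->
  (W_rank p W H <= M)%E.
Proof.
move=> le_M; apply: ge_ereal_sup => _ [S [finS SH] <-].
rewrite fsbig_finite//= sumEFin; apply: le_M => a.
by rewrite in_fset_set// inE; exact: SH.
Qed.

Lemma rank_sum_le H F : positive_value H F -> ((rank_sum H F)%:E <= W_rank p W H)%E.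
Proof.
move=> FH; apply: esum_ge; exists [set` F]; first by split => // a /FH.
by rewrite fsbig_finite//= set_fsetK sumEFin.
Qed.

Lemma index_prodE H F : positive_value setT F -> index_prod H F =
  \big[*%R/1]_(a <- F)
    ((1 - a ^+ p) / (1 - a)) ^+ (c_sub p W setT a - c_sub p W H a)%N.
Proof.
move=> Fpos; apply: eq_big_seq => a /Fpos[[g _ <-] _].
by rewrite schreier_factorE// (gval_lt1 (valuation_group hW)).
Qed.

Lemma index_prod_le H F : positive_value setT F ->
  ((index_prod H F)%:E <= W_index p W H)%E.
Proof.
move=> FG; apply: ereal_sup_ubound; exists [set` F].
  by split => // a /FG[[g _ <-] ?]; split=> //; exists g.
by rewrite fsbig_finite//= set_fsetK -index_prodE.
Qed.

Lemma index_prod_gt H a : (a%:E < W_index p W H)%E ->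
  exists2 F, positive_value setT F & a < index_prod H F.
Proof.
move=> /ereal_sup_gt[_ [S [finS SG] <-]].
have SF : positive_value setT (fset_set S).
  by move=> a'; rewrite in_fset_set// inE => /SG[].
by rewrite fsbig_finite//= lte_fin => lt_S; exists (fset_set S); rewrite ?index_prodE.
Qed.

Section Truncated.
Variables (eps : R) (gT : finGroupType) (phi : G -> gT) (wt : gT -> R).
Hypotheses (eps0 : 0 < eps) (tr : truncation p W eps phi wt).
Variable H : set G.
Hypotheses (Hs : is_subgroup H) (Hc : closed H).

Let hwt : group_valuation p wt. Proof. by case: tr. Qed.
Let pG : (p.-group [set: gT]%SET)%g. Proof. by case: tr. Qed.
Let wtE g : wt (phi g) = if eps <= W g then W g else 0. Proof. by case: tr. Qed.

Let setT_subgroup : is_subgroup [set: G].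
Proof. by []. Qed.

Let wt_neq0 g : wt (phi g) != 0 -> wt (phi g) = W g /\ eps <= W g.
Proof. by rewrite wtE; case: ifP => //; rewrite eqxx. Qed.

Lemma rank_sum_tight F (J : finType) (x : J -> gT) :
  tight p wt (image_group phi H) x -> (forall a, a \in F -> eps <= a) ->
  rank_sum H F = \sum_(j | wt (x j) \in F) wt (x j).
Proof.
move=> tx epsF; rewrite -(sum_tight_Phi_level_index hwt pG tx) => [|a /epsF].
  by apply: eq_big_seq => a /epsF ea; rewrite (c_quotient_Phi_level_index hW eps0 tr).
exact: lt_le_trans.
Qed.

Lemma tight_sum_le_rank (J : finType) (x : J -> gT) :
  tight p wt (image_group phi H) x ->
  ((\sum_j wt (x j))%:E <= W_rank p W H)%E.
Proof.
move=> tx; have [genU _] := tx.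
have xH j : exists2 h, H h & phi h = x j.
  apply/(mem_image_group tr (x j) Hs); rewrite -genU.
  by apply: mem_gen; apply/imsetP; exists j.
(* Nonzero weights in the quotient are at least eps and are values of [W] on [H]. *)
pose F := [fset wt (x j) | j in J & wt (x j) != 0]%fset.
have FP a : a \in F -> exists h, [/\ H h, W h = a & eps <= a].
  move=> /imfsetP[j /=]; rewrite !inE/= => xj0 ->.
  have [h Hh hx] := xH j; rewrite -hx in xj0 *.
  by have [E eh] := wt_neq0 xj0; exists h; rewrite E.
apply: le_trans (rank_sum_le (F := F) _); last first.
  move=> a /FP[h [Hh <- eh]]; split; first by exists h.
  exact: lt_le_trans eh.
rewrite lee_fin (rank_sum_tight tx) => [|a /FP[h []]//].
rewrite [leRHS]big_mkcond/=; apply: ler_sum => j _; case: ifP => // /negbT jF.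
have [->//|xj0] := eqVneq (wt (x j)) 0.
by case/negP: jF; apply/imfsetP; exists j => //=; rewrite !inE.
Qed.

Variable l : seq R.
Hypothesis lH : maximal_chain wt l (image_group phi setT) (image_group phi H).

Let count_l a : eps <= a -> (c_sub p W setT a - c_sub p W H a)%N = count_mem a l.
Proof.
move=> ea; rewrite !(c_sub_level_index p_pr hW eps0 tr)//.
by rewrite (level_index_chain p_pr hwt pG lH (lt_le_trans eps0 ea)) addKn.
Qed.

Let l_values a : a \in l -> exists g, W g = a /\ eps <= a.
Proof.
move=> /(maximal_chain_mem lH)[u _ [wu u1]].
have [_ /(_ u)[g gu] _ _ _] := tr; rewrite -gu in wu u1.
have /wt_neq0[E eg] : wt (phi g) != 0.
  by apply: contraNneq u1 => /(gval_eq0 hwt) ->.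
by exists g; rewrite -wu E.
Qed.

Lemma index_prod_chain F : (forall a, a \in F -> eps <= a) ->
  index_prod H F = \prod_(b <- l | b \in F) schreier_factor p b.
Proof.
by move=> eF; rewrite -prod_exp_count; apply: eq_big_seq => a /eF/count_l ->.
Qed.

Lemma prod_chain_le : ((\prod_(b <- l) schreier_factor p b)%:E <= W_index p W H)%E.
Proof.
pose F := [fset a in l]%fset; have lF a : (a \in F) = (a \in l) by rewrite !inE.
have -> : \prod_(b <- l) schreier_factor p b = index_prod H F.
  rewrite index_prod_chain => [|a]; last by rewrite lF => /l_values[g []].
  by rewrite [RHS]big_seq_cond [LHS]big_seq; apply: eq_bigl => b; rewrite lF andbb.
apply: index_prod_le => a; rewrite lF => /l_values[g [ga ea]].
by split; [exists g|exact: lt_le_trans ea].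
Qed.

End Truncated.

End Limits.

(** * The two bounds on the rank of H *)

Section MainBounds.
Variables (R : realType) (p : nat) (G : topologicalGroupType) (W : G -> R).
Variables (H : set G) (I : R).
Hypotheses (p_pr : prime p) (pro : pro_p p G) (hW : valuation p W).
Hypotheses (Hs : is_subgroup H) (Hc : closed H).
Hypothesis indexE : W_index p W H = I%:E.
Local Open Scope classical_set_scope.

Let setT_subgroup : is_subgroup [set: G].
Proof. by []. Qed.

(** With c the heavy steps, P their product and L the sum of the light weights, this bounds the loss
    P L by the gap between the W-index and P. *)
Lemma prod_schreier_factor_split (c : pred R) (l : seq R) : all (>= 0) l ->
  (\prod_(b <- l | c b) schreier_factor p b) *
    (1 + \sum_(b <- l | ~~ c b) b) <= \prod_(b <- l) schreier_factor p b.
Proof.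
move=> l0; rewrite [leRHS](bigID c)/= ler_wpM2l//.
  by apply: le_trans ler01 _; exact: prod_schreier_factor_ge1.
exact: prod_schreier_factor_ge.
Qed.

Lemma prod_schreier_factor_mono (c c' : pred R) (l : seq R) : all (>= 0) l ->
  (forall b, c b -> c' b) ->
  \prod_(b <- l | c b) schreier_factor p b <=
  \prod_(b <- l | c' b) schreier_factor p b.
Proof.
move=> + cc'; elim: l => [|b l IHl] /=; first by rewrite !big_nil.
move=> /andP[b0 l0]; rewrite !big_cons; have N1 := schreier_factor_ge1 p_pr b0.
have N0 := le_trans ler01 N1; have {}IHl := IHl l0.
case: ifP => [/cc' ->|_]; first by rewrite ler_wpM2l.
case: ifP => // _; apply: le_trans IHl _; rewrite ler_peMl//.
by apply: le_trans ler01 _; exact: prod_schreier_factor_ge1.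
Qed.

Lemma sum_tight_mem_le (gT : finGroupType) (wt : gT -> R) (J : finType)
    (x : J -> gT) (F : {fset R}) :
  (forall u, 0 <= wt u) -> \sum_(j | wt (x j) \in F) wt (x j) <= \sum_j wt (x j).
Proof.
move=> wt0; rewrite big_mkcond/=; apply: ler_sum => j _.
by case: ifP.
Qed.

Lemma W_index_real_ge1 : 1 <= I.
Proof.
have := @index_prod_le _ _ _ _ hW H fset0; rewrite indexE lee_fin.
by rewrite /index_prod big_seq_fset0; apply.
Qed.

Lemma W_rank_upper (r : R) : W_rank p W [set: G] = r%:E ->
  (W_rank p W H <= (1 + I * (r - 1))%:E)%E.
Proof.
move=> rG; apply: W_rank_le => // F posF; rewrite lee_fin.
apply/ler_addgt0Pl => e e0.
(* As r - 1 may be negative, P <= I is not enough: P must also approximate I, up to eta. *)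
pose eta := e / (`|r - 1| + 1).
have eta0 : 0 < eta by rewrite divr_gt0// ltr_wpDl.
have [|F' posF' ltF'] := @index_prod_gt _ _ _ _ hW H (I - eta).
  by rewrite indexE lte_fin ltrBlDr ltrDl.
have [eps [eps0 _ epsP]] : exists e' : R,
    [/\ 0 < e', e' <= 1 & forall a, a \in enum_fset F ++ enum_fset F' -> e' <= a].
  by apply: pos_lower_bound => a; rewrite mem_cat => /orP[/posF[]|/posF'[]].
have epsF a : a \in F -> eps <= a by move=> aF; apply: epsP; rewrite mem_cat aF.
have epsF' a : a \in F' -> eps <= a.
  by move=> aF; apply: epsP; rewrite mem_cat aF orbT.
have [gT [phi [wt tr]]] := truncation_exists p_pr pro hW eps0.
have [_ _ hwt pG _] := tr.
have [|l lH] := @maximal_chain_exists _ gT wt (image_group phi setT) (image_group phi H).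
  by rewrite (image_group_setT tr) finset.subsetT.
have [J [x tx]] := tight_exists hwt pG (image_group phi setT).
have [K [z tz]] := tight_exists hwt pG (image_group phi H).
have l0 := maximal_chain_ge0 hwt lH.
have rank_x : \sum_j wt (x j) <= r.
  by rewrite -lee_fin -rG; exact: (tight_sum_le_rank hW eps0 tr _ closedT tx).
have rank_z : rank_sum p W H F <= \sum_i wt (z i).
  rewrite (rank_sum_tight hW eps0 tr Hs Hc tz epsF).
  exact: sum_tight_mem_le (gval_ge0 hwt).
have := schreier_inequality p_pr hwt pG lH tx tz.
set P := \prod_(_ <- _) _ => ineq.
have P_le : P <= I by rewrite -lee_fin -indexE; exact: (prod_chain_le p_pr hW eps0 tr Hs lH).
have P_ge : I - eta < P.
  apply: lt_le_trans ltF' _; rewrite (index_prod_chain p_pr hW eps0 tr Hs lH epsF').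
  exact: prod_schreier_factor_mono.
have P0 : 0 <= P by apply: le_trans ler01 _; exact: prod_schreier_factor_ge1.
have e_ge : (I - P) * `|r - 1| <= e.
  apply: (@le_trans _ _ (eta * (`|r - 1| + 1))); last by rewrite divfK// gt_eqF// ltr_wpDl.
  by apply: ler_pM; rewrite ?subr_ge0// ?lerDl// lerBlDl -lerBlDr ltW.
have : (I - P) * - (r - 1) <= (I - P) * `|r - 1|.
  by rewrite ler_wpM2l ?subr_ge0// ler_normr lexx orbT.
have : P * (\sum_j wt (x j) - 1) <= P * (r - 1) by rewrite ler_wpM2l// lerD2r.
rewrite mulrBl !mulrN; lra.
Qed.

Lemma W_rank_lower (F : {fset R}) : weight_function p W ->
  positive_value W setT F ->
  ((1 + I * (rank_sum p W setT F - 1))%:E <= W_rank p W H)%E.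
Proof.
move=> [X [genX wX]] posF; set sigma := rank_sum _ _ _ _.
have sigma0 : 0 <= sigma.
  by rewrite /sigma /rank_sum big_seq sumr_ge0// => a /posF[_ a0]; rewrite mulr_ge0// ltW.
apply/lee_addgt0Pr => e e0.
(* The error (I - P) (sigma - 1) + P L will be at most eta (sigma + 1) + eta = e. *)
pose eta := e / (sigma + 2).
have s20 : 0 < sigma + 2 by rewrite ltr_wpDl.
have eta0 : 0 < eta by rewrite divr_gt0.
have [|F' posF' ltF'] := @index_prod_gt _ _ _ _ hW H (I - eta).
  by rewrite indexE lte_fin ltrBlDr ltrDl.
have [theta [theta0 theta1 thetaP]] : exists e' : R,
    [/\ 0 < e', e' <= 1 & forall a, a \in enum_fset F ++ enum_fset F' -> e' <= a].
  by apply: pos_lower_bound => a; rewrite mem_cat => /orP[/posF[]|/posF'[]].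
have thetaF a : a \in F -> theta <= a by move=> aF; apply: thetaP; rewrite mem_cat aF.
have thetaF' a : a \in F' -> theta <= a.
  by move=> aF; apply: thetaP; rewrite mem_cat aF orbT.
(* The chain is known only after eps is fixed. In any chain the number n0 of steps of weight at
   least theta satisfies n0 theta <= I, so eps lies below the final threshold theta theta^((p-1)
   n0). *)
pose M := Num.bound (I / theta).
pose eps := theta * theta ^+ (p.-1 * M).
have eps0 : 0 < eps by rewrite mulr_gt0 ?exprn_gt0.
have eps_theta : eps <= theta.
  by rewrite /eps ler_piMr ?(ltW theta0)// exprn_ile1// ltW.
have [gT [phi [wt tr]]] := truncation_exists p_pr pro hW eps0.
have [_ _ hwt pG wtE] := tr.
have [|l lH] := @maximal_chain_exists _ gT wt (image_group phi setT) (image_group phi H).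
  by rewrite (image_group_setT tr) finset.subsetT.
have l0 := maximal_chain_ge0 hwt lH.
have [J [K [x [y [tx ty le_y]]]]] := free_tight_families p_pr hW eps0 tr genX wX Hs lH
  theta0 (ltW theta0).
move: le_y; set P := \prod_(_ <- _ | _) _; set L := \sum_(_ <- _ | _) _.
set n0 := count _ _ => le_y.
have P1 : 1 <= P by exact: prod_schreier_factor_ge1.
have I1 := W_index_real_ge1.
have PL : P * (1 + L) <= I.
  have := prod_chain_le p_pr hW eps0 tr Hs lH; rewrite indexE lee_fin.
  apply: le_trans; apply: le_trans (prod_schreier_factor_split (fun b => theta <= b) l0).
  by under [X in _ <= _ * (1 + X)]eq_bigl => b do rewrite -ltNge.
have L0 : 0 <= L by rewrite /L big_seq_cond sumr_ge0// => b /andP[/(allP l0)].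
have P_le : P <= I by apply: le_trans PL; rewrite ler_peMr ?lerDl// (le_trans ler01).
have n0M : (n0 <= M)%N.
  have n0_le : n0%:R * theta <= I.
    apply: le_trans P_le; apply: (@le_trans _ _ (1 + \sum_(a <- l | theta <= a) a)).
      rewrite /n0 -sum1_count natr_sum mulr_suml ler_wpDl//.
      by apply: ler_sum => a; rewrite mul1r.
    exact: prod_schreier_factor_ge.
  rewrite -(ler_nat R) ltW//; apply: le_lt_trans (archi_boundP _).
    by rewrite ler_pdivlMr.
  by rewrite divr_ge0 ?(ltW theta0)// (le_trans ler01).
have P_ge : I - eta < P.
  apply: lt_le_trans ltF' _.
  rewrite (index_prod_chain p_pr hW eps0 tr Hs lH) => [|a /thetaF']; last exact: le_trans.
  by apply: prod_schreier_factor_mono => // a /thetaF'.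
have rank_y : weight_sum W (theta * theta ^+ (p.-1 * n0)) y <= \sum_j wt (phi (y j)).
  rewrite /weight_sum big_mkcond/=; apply: ler_sum => j _.
  case: ifP => [le_y'|_]; last exact: gval_ge0 hwt _.
  rewrite wtE ifT//; apply: le_trans le_y'; rewrite /eps ler_wpM2l ?(ltW theta0)//.
  by rewrite ler_wiXn2l ?(ltW theta0)// leq_mul2l n0M orbT.
have rank_x : sigma <= weight_sum W theta x.
  rewrite /sigma (rank_sum_tight hW eps0 tr _ closedT tx) => [|//|a /thetaF]; last first.
    exact: le_trans.
  rewrite /weight_sum big_mkcond [leRHS]big_mkcond/=; apply: ler_sum => j _.
  case: ifP => [/thetaF|_]; last by case: ifP => // _; exact: gval_ge0 (valuation_group hW) _.
  rewrite wtE; case: ifP => [_ ->//|_]; by rewrite leNgt theta0.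
have rank_H := tight_sum_le_rank hW eps0 tr Hs Hc ty.
apply: le_trans (leeD2r _ rank_H); rewrite -EFinD lee_fin.
have le1 : P * (sigma - 1 - L) <= \sum_j wt (phi (y j)) - 1.
  apply: le_trans (le_trans le_y _); last by rewrite lerD2r.
  by rewrite ler_wpM2l ?(le_trans ler01)// !lerD2r.
have le2 : (I - P) * (sigma - 1) <= eta * (sigma + 1).
  apply: (@le_trans _ _ ((I - P) * (sigma + 1))).
    by rewrite ler_wpM2l ?subr_ge0//; lra.
  by rewrite ler_wpM2r ?addr_ge0//; lra.
have le3 : eta * (sigma + 2) = e by rewrite /eta divfK// gt_eqF.
have le4 : P * L <= I - P by move: PL; rewrite mulrDr mulr1; lra.
have le5 : eta * (sigma + 2) = eta * (sigma + 1) + eta.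
  by rewrite -{3}[eta]mulr1 -mulrDr -addrA.
rewrite /=; move: le1 le2; rewrite mulrBr mulrBl; lra.
Qed.

End MainBounds.

Local Open Scope classical_set_scope.
Local Open Scope ereal_scope.

Theorem theorem3p12 (R : realType) (p : nat) (G : topologicalGroupType)
    (W : G -> R) (H : set G) :
  prime p -> pro_p p G -> valuation p W ->
  is_subgroup H -> closed H -> W_index p W H < +oo ->
  (W_rank p W H - 1 <= W_index p W H * (W_rank p W [set: G] - 1)) /\
  (free_pro_p p G -> weight_function p W ->
   W_rank p W H - 1 = W_index p W H * (W_rank p W [set: G] - 1)).
Proof.
move=> p_pr pro hW Hs Hc index_lt.
have rank_ge0 K : 0 <= W_rank p W K.
  by apply: esum_ge0 => a [_ a0]; rewrite lee_fin mulr_ge0// ltW.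
have [I indexE] : exists I : R, W_index p W H = I%:E.
  have : (index_prod p W H fset0)%:E <= W_index p W H by apply: index_prod_le.
  by case: (W_index p W H) index_lt => [I _ _|//|//]; exists I.
have I1 := W_index_real_ge1 hW indexE; have I0 := lt_le_trans ltr01 I1.
rewrite indexE.
have upper : W_rank p W H - 1 <= I%:E * (W_rank p W [set: G] - 1).
  case rG: (W_rank p W [set: G]) => [r| |].
  - have := W_rank_upper p_pr pro hW Hs Hc indexE rG.
    case: (W_rank p W H) => [h| |]//; last by rewrite addNye !leNye.
    by rewrite -!EFinB -EFinM !lee_fin lerBlDl.
  - have -> : +oo - 1 = +oo :> \bar R by [].
    by rewrite gt0_muley ?lte_fin// leey.
  - by have := rank_ge0 [set: G]; rewrite rG.
split=> // _ weightW; apply/eqP; rewrite eq_le upper/=.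
have lower (F : {fset R}) := W_rank_lower p_pr pro hW Hs Hc indexE (F := F) weightW.
case rH: (W_rank p W H) => [h| |]; last 2 first.
- by rewrite /= leey.
- by have := rank_ge0 H; rewrite rH.
(* A finite rank of [H] bounds all partial sums for [G], so the rank of [G] is finite too. *)
have rG_le : W_rank p W [set: G] <= (1 + (h - 1) / I)%:E.
  apply: W_rank_le => // F posF; have := lower F posF; rewrite rH !lee_fin => le_h.
  by rewrite -lerBlDl ler_pdivlMr// mulrC lerBrDl.
case rG: (W_rank p W [set: G]) rG_le => [r| |]// rG_le; last first.
  by have := rank_ge0 [set: G]; rewrite rG.
rewrite lee_fin -lerBlDl ler_pdivlMr// mulrC in rG_le.
by rewrite -!EFinB -EFinM lee_fin.
Qed.
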